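(* Let $K$ be a number field which is a normal (Galois) extension of $\mathbb{Q}$ of degree $N=[K:\mathbb{Q}]\ge 2$, let $M\ge 2$, and let $(a_m,b_m)\in\mathbb{Z}^+\times\mathbb{Z}$ for $m=1,\dots,M$ satisfy $$\prod_{m,k=1,\ m\ne k}^{M}(a_m b_k-a_k b_m)\ne 0 .$$ Then for large real $x$, $$S(x):=\sum_{1\le n\le x}\ \prod_{m=1}^M \mathbf{b}_K(a_m n+b_m)\ \ll\ \gamma(a_1,b_1,\dots,a_M,b_M)\,\frac{x}{(\log x)^{M(1-1/N)}},$$ where $$\gamma(a_1,b_1,\dots,a_M,b_M)=\prod_{p\in\mathbb{P}'}\Bigl(1+\frac{M}{p}\Bigr),$$ and the implied constant depends only on $M$ and $K$ (not on $a_1,b_1,\dots,a_M,b_M$).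
   Context: $\mathcal{O}_K$ denotes the ring of integers of $K$. For an integer $n$, $\mathbf{b}_K(n)=1$ if $n$ is a positive integer and there exists a nonzero integral ideal $\mathfrak{A}$ of $\mathcal{O}_K$ with norm $\mathcal{N}(\mathfrak{A})=n$, and $\mathbf{b}_K(n)=0$ otherwise. $p$ always denotes a rational prime and $\mathbb{P}$ is the set of rational primes. For each divisor $r$ of $N$, $\mathbb{P}_r$ is the set of primes $p$ not dividing the discriminant of $K$ such that $p\mathcal{O}_K=\mathfrak{P}_1\cdots\mathfrak{P}_{N/r}$ with distinct prime ideals $\mathfrak{P}_i$ each of norm $p^r$. The finite set $\mathbb{P}'$ is defined by $$\mathbb{P}'=\Bigl\{p\in\bigcup_{r\mid N,\ r>1}\mathbb{P}_r:\ p \text{ divides } \prod_{m=1}^M a_m\prod_{m,k=1,\,m\ne k}^M(a_mb_k-a_kb_m)\Bigr\}.$$ *)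

(* Defs.v *)
From HB Require Import structures.
From mathcomp Require Import all_boot all_order all_algebra all_field.
From mathcomp Require Import all_classical all_reals all_analysis.

Set Implicit Arguments.
Unset Strict Implicit.
Unset Printing Implicit Defensive.

Import Order.TTheory GRing.Theory Num.Theory.
Local Open Scope ring_scope.

Section NumberField.
Variable L : splittingFieldType rat.

Definition OK (x : L) : Prop :=
  exists p : {poly int}, p \is monic /\ root (map_poly (fun z : int => z%:~R : L) p) x.

Definition is_ideal (A : L -> Prop) : Prop :=
  [/\ (forall x, A x -> OK x), A 0,
      (forall x y, A x -> A y -> A (x + y)) &
      (forall r x, OK r -> A x -> A (r * x))].

Definition nonzero_ideal (A : L -> Prop) : Prop :=
  is_ideal A /\ exists x, A x /\ x != 0.

Definition ideal_norm (A : L -> Prop) (n : nat) : Prop :=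
  exists f : 'I_n -> L,
    [/\ (forall i, OK (f i)),
        (forall i j, A (f i - f j) -> i = j) &
        (forall x, OK x -> exists i, A (x - f i))].

Definition bK (z : int) : Prop :=
  0 < z /\ exists A, nonzero_ideal A /\ ideal_norm A `|z|%N.

Definition ideal_eq (A B : L -> Prop) : Prop := forall x, A x <-> B x.

Definition ideal_mul (A B : L -> Prop) (x : L) : Prop :=
  exists n (u v : 'I_n -> L),
    (forall i, A (u i) /\ B (v i)) /\ x = \sum_(i < n) u i * v i.

Definition ideal_prod (s : seq (L -> Prop)) : L -> Prop := foldr ideal_mul OK s.

Definition prime_ideal (P : L -> Prop) : Prop :=
  [/\ nonzero_ideal P, ~ P 1 &
      (forall x y, OK x -> OK y -> P (x * y) -> P x \/ P y)].

Definition pOK (p : nat) (x : L) : Prop := exists y, OK y /\ x = p%:R * y.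

Definition int_basis (w : 'I_(\dim {:L}) -> L) : Prop :=
  [/\ (forall i, OK (w i)),
      (forall x, OK x -> exists c : 'I_(\dim {:L}) -> int,
                   x = \sum_i (c i)%:~R * w i) &
      (forall c : 'I_(\dim {:L}) -> int,
         \sum_i (c i)%:~R * w i = 0 -> forall i, c i = 0)].

Definition disc_of (w : 'I_(\dim {:L}) -> L) : L :=
  \det (\matrix_(i, j) galTrace 1%VS {:L} (w i * w j)).

Definition p_dvd_disc (p : nat) : Prop :=
  exists w, int_basis w /\ exists z : int, disc_of w = (p%:Z * z)%:~R.

Definition P_r (r p : nat) : Prop :=
  [/\ prime p, ~ p_dvd_disc p &
    exists s : seq (L -> Prop),
      [/\ size s = (\dim {:L} %/ r)%N,
          (forall i, (i < size s)%N ->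
             prime_ideal (nth OK s i) /\ ideal_norm (nth OK s i) (p ^ r)),
          (forall i j, (i < size s)%N -> (j < size s)%N -> i <> j ->
             ~ ideal_eq (nth OK s i) (nth OK s j)) &
          ideal_eq (ideal_prod s) (pOK p)]].

Definition Dprod (M : nat) (a b : 'I_M -> int) : int :=
  (\prod_(m < M) a m) *
  \prod_(m < M) \prod_(k < M | k != m) (a m * b k - a k * b m).

Definition in_P' (M : nat) (a b : 'I_M -> int) (p : nat) : Prop :=
  (exists r, [/\ (r %| \dim {:L})%N, (1 < r)%N & P_r r p]) /\
  (p %| `|Dprod a b|)%N.

(* gamma; every p in P' divides D <> 0, so p <= |D| *)
Definition gamma (R : realType) (M : nat) (a b : 'I_M -> int) : R :=
  \prod_(p < `|Dprod a b|%N.+1 | `[< in_P' a b p >]) (1 + M%:R / p%:R).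

Definition S (R : realType) (M : nat) (a b : 'I_M -> int) (x : R) : R :=
  \sum_(1 <= n < (Num.truncn x).+1)
     \prod_(m < M) (if `[< bK (a m * n%:Z + b m) >] then 1 else 0).

End NumberField.

(* Main.v *)
(** Fix an integral primitive element [alpha] of [K] with minimal polynomial [f],
    and discard the finitely many primes dividing its discriminant [Delta].

    - Since [K] is Galois, every other prime [p] either has [N] distinct roots of
      [f] mod [p], or none.  In the second case all primes above [p] are
      conjugate, kernels of homomorphisms [Z[alpha] / Delta -> k], and have norm
      [p ^ r] with [r > 1]; moreover the norm of an ideal is never exactly
      divisible by [p], because the [p]-torsion of the quotient would be cyclic,
      and [alpha] would act on it by a root of [f] mod [p].
    - Split primes have density at most [1 / N].  Consider the polynomials of
      degree [< N] with coefficients in [0, X).  The norm of the difference of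
      two of them is divisible by [p] at least once for each root of [f] mod [p]
      at which they agree; by Cauchy-Schwarz, a proportion at least [1 / p] of the
      pairs agree at a given root, so the bound [O(X ^ N)] for these norms gives
      [sum_(p <= X ^ N, p split) ln p / p <= ln X + O(1)].  With Mertens' theorem
      and partial summation, the sum of [1 / p] over the non-split primes
      [p <= z] is at least [(1 - 1 / N) ln (ln z) - O(1)].
    - If all [a_m n + b_m] are norms then none of them is exactly divisible by a
      non-split [p]; when [p] does not divide the determinants this excludes
      [M (p - 1)] classes of [n] mod [p ^ 2].  Attach to each such [p] the function
      equal to [-1] on the excluded classes and to the constant [g p] making its
      mean zero on the others.  The products of these functions are nearly
      orthogonal, and the second moment of their sum [F] over moduli at most [Q],
      compared with its constant value on the sifted set, bounds that set by
      [O(X / F)].  Markov's inequality for [ln q] shows that [F] is at least half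
      of the full Euler product over [p <= z] for [z] a small power of [Q]. *)
Require Import Defs.
From HB Require Import structures.
From mathcomp Require Import all_boot all_order all_algebra all_field.
From mathcomp Require Import all_fingroup all_solvable.
From mathcomp Require Import all_classical all_reals all_analysis.
From mathcomp Require Import ring lra zify.

Set Implicit Arguments.
Unset Strict Implicit.
Unset Printing Implicit Defensive.

Import Order.TTheory GRing.Theory Num.Theory.
Local Open Scope ring_scope.

(** * Integers of [L] *)

Section RingOfIntegers.
Variable L : splittingFieldType rat.
Implicit Types x y : L.

Lemma intrL_eq0 (z : int) : ((z%:~R : L) == 0) = (z == 0).
Proof. by rewrite -(rmorph_int (in_alg L)) fmorph_eq0 intr_eq0. Qed.

Lemma intrL_inj : injective (intr : int -> L).
Proof. by move=> y z /eqP; rewrite -subr_eq0 -rmorphB intrL_eq0 subr_eq0 => /eqP. Qed.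

Lemma OK_integralP x : OK x <-> integralOver (intr : int -> L) x.
Proof. by split=> [[p [pm pr]]|[p pm pr]]; exists p. Qed.

Lemma OKD x y : OK x -> OK y -> OK (x + y).
Proof.
by move=> /OK_integralP ix /OK_integralP iy; apply/OK_integralP; exact: integral_add.
Qed.

Lemma OKN x : OK x -> OK (- x).
Proof. by move=> /OK_integralP ix; apply/OK_integralP; exact: integral_opp. Qed.

Lemma OKB x y : OK x -> OK y -> OK (x - y).
Proof. by move=> ox oy; apply: OKD => //; exact: OKN. Qed.

Lemma OKM x y : OK x -> OK y -> OK (x * y).
Proof.
by move=> /OK_integralP ix /OK_integralP iy; apply/OK_integralP; exact: integral_mul.
Qed.

Lemma OK_int (z : int) : OK (z%:~R : L).
Proof.
exists ('X - z%:P); split; first exact: monicXsubC.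
by rewrite map_polyXsubC rootE hornerXsubC subrr.
Qed.

Lemma OK0 : OK (0 : L). Proof. exact: (OK_int 0). Qed.
Lemma OK1 : OK (1 : L). Proof. exact: (OK_int 1). Qed.

Lemma OKX x n : OK x -> OK (x ^+ n).
Proof.
by move=> ox; elim: n => [|n IH]; [exact: OK1 | rewrite exprS; exact: OKM].
Qed.

Lemma OK_sum (I : Type) (r : seq I) (P : pred I) (F : I -> L) :
  (forall i, P i -> OK (F i)) -> OK (\sum_(i <- r | P i) F i).
Proof. by move=> H; elim/big_ind: _ => //; [exact: OK0 | exact: OKD]. Qed.

Lemma OK_prod (I : Type) (r : seq I) (P : pred I) (F : I -> L) :
  (forall i, P i -> OK (F i)) -> OK (\prod_(i <- r | P i) F i).
Proof. by move=> H; elim/big_ind: _ => //; [exact: OK1 | exact: OKM]. Qed.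

Lemma OK_det n (A : 'M[L]_n) : (forall i j, OK (A i j)) -> OK (\det A).
Proof.
move=> H; apply: OK_sum => s _; apply: OKM; last by apply: OK_prod.
exact/OKX/OKN/OK1.
Qed.

Lemma OK_rmorph (s : {rmorphism L -> L}) x : OK x -> OK (s x).
Proof.
move=> [p [pm pr]]; exists p; split=> //.
have -> : map_poly (fun z : int => z%:~R : L) p =
          map_poly s (map_poly (fun z : int => z%:~R : L) p).
  by rewrite -map_poly_comp; apply: eq_map_poly => z /=; rewrite rmorph_int.
exact: rmorph_root.
Qed.

Lemma OK_horner (h : {poly int}) x : OK x -> OK (map_poly intr h).[x].
Proof.
move=> ox; rewrite horner_coef; apply: OK_sum => i _.
by apply: OKM; [rewrite coef_map; exact: OK_int | exact: OKX].
Qed.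

Lemma OK_coef_prod_XsubC (s : seq L) i :
  (forall a, a \in s -> OK a) -> OK (\prod_(a <- s) ('X - a%:P))`_i.
Proof.
elim: s i => [|a s IH] i H.
  by rewrite big_nil coef1; case: (i == 0%N); [exact: OK1 | exact: OK0].
rewrite big_cons mulrBl coefB coefXM coefCM; apply: OKB.
  case: eqP => _; first exact: OK0.
  by apply: IH => b bs; apply: H; rewrite inE bs orbT.
apply: OKM; first by apply: H; rewrite inE eqxx.
by apply: IH => b bs; apply: H; rewrite inE bs orbT.
Qed.

(** The rational number is carried to [algC], where a rational algebraic integer is known to be an
    integer. *)
Lemma OK_rat_int x : x \in 1%VS -> OK x -> exists z : int, x = z%:~R.
Proof.
move=> /vlineP[q ->] [p [pm pr]].
have h : ratr q \in Aint.
  apply: (@root_monic_Aint (map_poly (fun z : int => z%:~R : algC) p)).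
  - have -> : map_poly (fun z : int => z%:~R : algC) p =
       map_poly (@ratr algC) (map_poly (fun z : int => z%:~R : rat) p).
      by rewrite -map_poly_comp; apply: eq_map_poly => z /=; rewrite ratr_int.
    apply: rmorph_root; rewrite -(fmorph_root (in_alg L)).
    rewrite -map_poly_comp; move: pr; congr (is_true (root _ _)).
    by apply: eq_map_poly => z /=; rewrite -(rmorph_int (in_alg L)).
  - exact: (monic_map (intr : {rmorphism int -> algC}) pm).
  - by apply/polyOverP => i; rewrite coef_map /= intr_int.
have : (ratr q : algC) \is a Num.int by apply: Cint_rat_Aint => //; apply: Crat_rat.
move=> /intrP[z]; rewrite -(ratr_int _ z) => /(fmorph_inj (@ratr algC)) ->.
by exists z; rewrite -(rmorph_int (in_alg L)).
Qed.

Lemma algebraic_int_poly x :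
  exists p : {poly int}, p != 0 /\ root (map_poly intr p) x.
Proof.
have /polyOver1P[q eq] := minPolyOver 1%AS x.
have [p [a a0 eqp]] := rat_poly_scale q; exists p.
have q0 : q != 0.
  apply: contraTneq (monic_minPoly 1%AS x) => q0.
  by rewrite eq q0 rmorph0 monicE lead_coef0 eq_sym oner_eq0.
split; first by apply: contraNneq q0 => p0; rewrite eqp p0 rmorph0 scaler0.
have := root_minPoly 1%AS x; rewrite eq eqp map_polyZ rootZ; last first.
  by rewrite fmorph_eq0 invr_eq0 intr_eq0.
rewrite -map_poly_comp; congr (is_true (root _ _)).
by apply: eq_map_poly => z /=; rewrite -(rmorph_int (in_alg L)).
Qed.

(** If an integer polynomial of degree [n + 1] with leading coefficient [a] kills [x], multiplying
    it by [a ^ n] gives a monic integer polynomial in [a x]. *)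
Lemma OK_scaled x : exists d : int, d != 0 /\ OK (d%:~R * x).
Proof.
have [p [p0 px]] := algebraic_int_poly x.
set a := lead_coef p; have a0 : a != 0 by rewrite lead_coef_eq0.
exists a; split=> //.
have [|n1] := leqP (size p) 1.
  move=> /size1_polyC ep; move: px; rewrite ep map_polyC rootC intrL_eq0 => p00.
  by move: p0; rewrite ep polyC_eq0 p00.
have [n en] : exists n, size p = n.+2 by exists (size p).-2; case: (size p) n1 => [|[]].
pose r : {poly int} := \poly_(i < n.+1) (p`_i * a ^+ (n - i)).
have sr : (size r < size ('X^(n.+1) : {poly int}))%N by rewrite size_polyXn ltnS size_poly.
exists ('X^(n.+1) + r); split.
  by rewrite monicE lead_coefDl // lead_coefXn.
rewrite rmorphD /= map_polyXn rootE hornerD hornerXn.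
have -> : (map_poly (fun z : int => z%:~R : L) r).[a%:~R * x] =
    a%:~R ^+ n * \sum_(i < n.+1) (p`_i)%:~R * x ^+ i.
  rewrite (@horner_coef_wide _ n.+1); last first.
    by rewrite size_map_inj_poly ?size_poly //; exact: intrL_inj.
  rewrite mulr_sumr; apply: eq_bigr => i _.
  rewrite coef_map coef_poly ltn_ord /= rmorphM rmorphXn /= exprMn.
  have -> : (a%:~R : L) ^+ n = a%:~R ^+ (n - i) * a%:~R ^+ i.
    by rewrite -exprD subnK // -ltnS.
  ring.
move: px; rewrite rootE horner_coef size_map_inj_poly ?en ?rmorph0 //; last exact: intrL_inj.
rewrite big_ord_recr /= coef_map /=.
have <- : a = p`_n.+1 by rewrite /a lead_coefE en.
move=> /eqP e; rewrite exprMn exprSr -mulrA -mulrDr mulf_eq0 expf_eq0 intrL_eq0 (negbTE a0) andbF /=.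
apply/eqP; rewrite -[RHS]e addrC; congr (_ + _).
by apply: eq_bigr => i _; rewrite coef_map.
Qed.
End RingOfIntegers.

(** * Conjugates, integral coordinates and the discriminant *)

Section Conjugates.
Variable L : splittingFieldType rat.
Hypothesis galL : galois 1%VS {:L}.
Local Notation N := (\dim {:L}).
Local Notation G := ('Gal({:L} / 1)%g).

Lemma card_gal : #|G| = N.
Proof. by rewrite -(galois_dim galL) dimv1 divn1. Qed.

(** The Galois group is indexed by ['I_N], like the powers of [alpha], so that the Vandermonde
    matrix of the conjugates is square. *)
Definition gal_enum (i : 'I_N) : gal_of {:L} :=
  enum_val (cast_ord (esym card_gal) i).

Lemma gal_enum_in i : gal_enum i \in G.
Proof. exact: enum_valP. Qed.

Lemma gal_enum_inj : injective gal_enum.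
Proof. by move=> i j /enum_val_inj /cast_ord_inj. Qed.

Lemma big_gal_enum (T : Type) (idx : T) (op : Monoid.com_law idx)
    (F : gal_of {:L} -> T) :
  \big[op/idx]_(s in G) F s = \big[op/idx]_(i < N) F (gal_enum i).
Proof.
rewrite big_enum_val; apply: (reindex (cast_ord (esym card_gal))).
by exists (cast_ord card_gal) => i _; rewrite ?cast_ordK ?cast_ordKV.
Qed.

Lemma gal_enum_surj s : s \in G -> exists i, gal_enum i = s.
Proof.
move=> sG; exists (cast_ord card_gal (enum_rank_in sG s)).
by rewrite /gal_enum cast_ordK enum_rankK_in.
Qed.

Lemma gal_enum_id : exists i, forall x, gal_enum i x = x.
Proof.
have [i ei] := gal_enum_surj (group1 G).
by exists i => x; rewrite ei gal_id.
Qed.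

Lemma gal_alg (s : gal_of {:L}) (q : rat) : s (q%:A) = q%:A.
Proof. by rewrite linearZ rmorph1. Qed.

Lemma gal_fixed_rat x : (forall s, s \in G -> s x = x) -> x \in 1%VS.
Proof.
move=> H; rewrite -(galois_fixedField galL).
by apply/fixedFieldP; rewrite ?memvf.
Qed.

Lemma OK_gal (s : gal_of {:L}) x : OK x -> OK (s x).
Proof. exact: OK_rmorph. Qed.

Lemma OK_fixed_int x : OK x -> (forall s, s \in G -> s x = x) ->
  exists z : int, x = z%:~R.
Proof. by move=> ox fx; apply: OK_rat_int => //; exact: gal_fixed_rat. Qed.

(** A separable generator times a nonzero integer still generates the field, and [OK_scaled] makes
    it integral. *)
Lemma integral_primitive_element :
  exists alpha : L, OK alpha /\ <<1%VS; alpha>>%VS = {:L}%VS.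
Proof.
have /and3P[_ sepL _] := galL.
set a := separable_generator 1%AS {:L}%AS.
have ea : {:L}%VS = <<1%VS; a>>%VS := eq_adjoin_separable_generator sepL (sub1v _).
have [d [d0 oda]] := OK_scaled a; exists (d%:~R * a); split=> //.
apply/eqP; rewrite eqEsubv subvf /= {1}ea.
apply/FadjoinP; split; first exact: sub1v.
rewrite [X in X \in _](_ : a = (d%:~R^-1 : rat) *: (d%:~R * a)); last first.
  by rewrite mulrzl -scaler_int scalerA mulVf ?intr_eq0 // scale1r.
by rewrite memvZ // memv_adjoin.
Qed.

Variable alpha : L.
Hypothesis OK_alpha : OK alpha.
Hypothesis gen_alpha : <<1%VS; alpha>>%VS = {:L}%VS.

Definition conjugate (i : 'I_N) : L := gal_enum i alpha.

Lemma OK_conjugate i : OK (conjugate i).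
Proof. exact: OK_gal. Qed.

Lemma rat_poly_rep x : exists p : {poly rat},
  (size p <= N)%N /\ x = (map_poly (in_alg L) p).[alpha].
Proof.
have xa : x \in <<1%AS; alpha>>%VS by rewrite gen_alpha memvf.
have /polyOver1P[p ep] := Fadjoin_polyOver 1%AS alpha x.
exists p; split; last by rewrite -ep Fadjoin_poly_eq.
rewrite -(size_map_poly (in_alg L)) -ep; apply: leq_trans (size_Fadjoin_poly _ _ _) _.
by rewrite adjoin_degreeE gen_alpha dimv1 divn1.
Qed.

Lemma gal_horner_rat (s : gal_of {:L}) (p : {poly rat}) x :
  s (map_poly (in_alg L) p).[x] = (map_poly (in_alg L) p).[s x].
Proof.
rewrite -horner_map -map_poly_comp; congr (_.[_]).
by apply: eq_map_poly => q; exact: gal_alg.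
Qed.

Lemma gal_horner_int (s : gal_of {:L}) (p : {poly int}) x :
  s (map_poly intr p).[x] = (map_poly intr p).[s x].
Proof.
rewrite -horner_map -map_poly_comp; congr (_.[_]).
by apply: eq_map_poly => q /=; rewrite rmorph_int.
Qed.

Lemma conjugate_inj : injective conjugate.
Proof.
move=> i j e; apply: gal_enum_inj; apply/eqP/gal_eqP => x _.
have [p [_ ->]] := rat_poly_rep x.
by rewrite !gal_horner_rat -/(conjugate i) e.
Qed.

(** The coefficients of the product are integral and fixed by the Galois group, which only permutes
    the factors, so they are integers. *)
Lemma int_minpoly : exists f : {poly int},
  f \is monic /\ map_poly intr f = \prod_(i < N) ('X - (conjugate i)%:P).
Proof.
set P := \prod_(i < N) _.
have PG : P = \prod_(s in G) ('X - (s alpha)%:P).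
  by rewrite (big_gal_enum _ (fun s => 'X - (s alpha)%:P)).
have Pint k : exists z : int, P`_k = z%:~R.
  apply: OK_fixed_int.
    rewrite /P -(big_map conjugate xpredT (fun x => 'X - x%:P)).
    by apply: OK_coef_prod_XsubC => a /mapP[i _ ->]; exact: OK_conjugate.
  move=> t tG; rewrite -coef_map; suff -> : map_poly t P = P by [].
  rewrite PG rmorph_prod [RHS](reindex_inj (mulIg t)) /=.
  apply: eq_big => [s|s sG]; first by rewrite groupMr.
  by rewrite map_polyXsubC galM // memvf.
pose z k := projT1 (cid (Pint k)).
have ez k : (z k)%:~R = P`_k by rewrite /z; case: cid.
have sP : size P = N.+1 by rewrite size_prod_XsubC /index_enum -enumT size_enum_ord.
exists (\poly_(k < N.+1) z k).
have em : map_poly intr (\poly_(k < N.+1) z k) = P.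
  apply/polyP => k; rewrite coef_map coef_poly; case: ltnP => h //=.
  by rewrite nth_default // sP.
split=> //.
have : P \is monic by exact: monic_prod_XsubC.
rewrite -em !monicE lead_coef_map_inj ?rmorph0 //; last exact: intrL_inj.
by rewrite -(rmorph1 (intr : {rmorphism int -> L})) (inj_eq (@intrL_inj L)).
Qed.

Variable f : {poly int}.
Hypothesis f_monic : f \is monic.
Hypothesis f_prod : map_poly intr f = \prod_(i < N) ('X - (conjugate i)%:P).

Lemma size_int_minpoly : size f = N.+1.
Proof.
rewrite -(size_map_inj_poly (@intrL_inj L)) ?rmorph0 // f_prod.
by rewrite size_prod_XsubC /index_enum -enumT size_enum_ord.
Qed.

Lemma root_conjugate (h : {poly int}) i :
  (map_poly intr h).[alpha] = 0 -> (map_poly intr h).[conjugate i] = 0.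
Proof. by move=> h0; rewrite -gal_horner_int h0 rmorph0. Qed.

(** Such a polynomial vanishes at the [N] distinct conjugates of [alpha], more than its degree
    allows. *)
Lemma small_int_poly_eq0 (h : {poly int}) :
  (size h <= N)%N -> (map_poly intr h).[alpha] = 0 -> h = 0.
Proof.
move=> sh h0; apply/eqP; apply: contraTT sh => hn0; rewrite -ltnNge.
have := @max_poly_roots _ (map_poly intr h) [seq conjugate i | i : 'I_N].
rewrite size_map size_enum_ord size_map_inj_poly ?rmorph0 //; last exact: intrL_inj.
apply.
- apply: contraNneq hn0 => /polyP hm; apply/eqP/polyP => i.
  by have /eqP := hm i; rewrite coef_map !coef0 intrL_eq0 => /eqP.
- by apply/allP => _ /mapP[i _ ->]; rewrite rootE root_conjugate.
- by rewrite map_inj_uniq ?enum_uniq //; exact: conjugate_inj.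
Qed.

Lemma int_minpoly_alpha0 : (map_poly intr f).[alpha] = 0.
Proof.
have [i0 hi] := gal_enum_id; rewrite f_prod horner_prod (bigD1 i0) //=.
by rewrite hornerXsubC /conjugate hi subrr mul0r.
Qed.

Lemma int_minpoly_dvd (h : {poly int}) :
  (map_poly intr h).[alpha] = 0 -> exists q, h = q * f.
Proof.
move=> h0; exists (Pdiv.Ring.rdivp h f).
have e := Pdiv.RingMonic.rdivp_eq f_monic h.
suff r0 : Pdiv.Ring.rmodp h f = 0 by rewrite {1}e r0 addr0.
apply: small_int_poly_eq0.
  by rewrite -ltnS -size_int_minpoly Pdiv.Ring.ltn_rmodpN0 // monic_neq0.
move: h0; rewrite {1}e rmorphD rmorphM hornerD hornerM /=.
by rewrite int_minpoly_alpha0 mulr0 add0r.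
Qed.

Let V := Vandermonde N (\row_(i < N) conjugate i).
Let T := \matrix_(i < N, j < N) galTrace 1%VS {:L} (alpha ^+ i * alpha ^+ j).

Lemma galTraceE x : galTrace 1%VS {:L} x = \sum_(i < N) gal_enum i x.
Proof. by rewrite /galTrace (big_gal_enum _ (fun s => s x)). Qed.

Lemma trace_mx_Vandermonde : T = V *m V^T.
Proof.
apply/matrixP => i j; rewrite !mxE galTraceE.
by apply: eq_bigr => k _; rewrite !mxE rmorphM !rmorphXn.
Qed.

Lemma OK_Vandermonde i j : OK (V i j).
Proof. by rewrite !mxE; apply/OKX/OK_conjugate. Qed.

Lemma galTrace_int x : OK x -> exists z : int, galTrace 1%VS {:L} x = z%:~R.
Proof.
move=> ox; apply: OK_rat_int.
  by rewrite -{2}(galois_fixedField galL) galTrace_fixedField ?memvf.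
by apply: OK_sum => s _; exact: OK_gal.
Qed.

Lemma trace_mx_int : exists T0 : 'M[int]_N, T = map_mx intr T0.
Proof.
have H i j : exists z : int, T i j = z%:~R.
  by rewrite mxE; apply/galTrace_int/OKM; exact: OKX.
exists (\matrix_(i, j) projT1 (cid (H i j))).
by apply/matrixP => i j; rewrite [RHS]mxE !mxE; case: cid => z /= <-; rewrite mxE.
Qed.

Lemma Vandermonde_det_neq0 : \det V != 0.
Proof.
rewrite det_Vandermonde; apply/prodf_neq0 => i _; apply/prodf_neq0 => j ij.
rewrite !mxE subr_eq0; apply: contraTneq ij => /conjugate_inj ->.
by rewrite ltnn.
Qed.

Lemma OK_adj_Vandermonde i j : OK ((\adj V) i j).
Proof.
rewrite !mxE; apply: OKM; first exact/OKX/OKN/OK1.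
by apply: OK_det => k l; rewrite !mxE; apply/OKX/OK_conjugate.
Qed.

(** Cramer's rule: the coordinates come from the conjugates of [x] by inverting the Vandermonde
    matrix, so [\det V] times a coordinate is already integral. The second factor yields the square,
    which is rational. *)
Lemma OK_disc_coords x k (p : {poly rat}) : OK x -> (size p <= N)%N ->
  x = (map_poly (in_alg L) p).[alpha] -> OK (\det V ^+ 2 * (p`_k)%:A).
Proof.
move=> ox sp ex.
have [kN|kN] := ltnP k N; last first.
  rewrite nth_default ?scale0r ?mulr0; first exact: OK0.
  exact: leq_trans kN.
pose c := \row_(i < N) ((p`_i)%:A : L).
have es : c *m V = \row_i gal_enum i x.
  apply/rowP => i; rewrite !mxE [in RHS]ex gal_horner_rat (@horner_coef_wide _ N).
    by apply: eq_bigr => l _; rewrite !mxE coef_map.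
  by rewrite size_map_poly.
have ec : (c *m V) *m \adj V = \det V *: c.
  by rewrite -mulmxA mul_mx_adj mul_mx_scalar.
have -> : \det V ^+ 2 * (p`_k)%:A = \det V * (\det V *: c) 0 (Ordinal kN).
  by rewrite !mxE expr2 mulrA.
rewrite -ec es; apply: OKM; first by apply: OK_det => i j; exact: OK_Vandermonde.
rewrite mxE; apply: OK_sum => i _; apply: OKM; last exact: OK_adj_Vandermonde.
by rewrite mxE; exact: OK_gal.
Qed.

(** The powers of [alpha] are integral combinations of an integral basis, so the two trace
    determinants differ by the square of an integer. *)
Lemma p_dvd_disc_trace p : p_dvd_disc L p ->
  exists z : int, \det T = (p%:Z * z)%:~R.
Proof.
move=> [w [[wO wgen _] [z ez]]].
have H i : exists c : 'I_N -> int, alpha ^+ i = \sum_k (c k)%:~R * w k.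
  exact/wgen/OKX.
pose C : 'M[int]_N := \matrix_(i, k) projT1 (cid (H (i : 'I_N))) k.
have eC (i : 'I_N) : alpha ^+ i = \sum_k (C i k)%:~R * w k.
  rewrite {1}(projT2 (cid (H i))); apply: eq_bigr => k _; by rewrite mxE.
pose W := \matrix_(i, j) galTrace 1%VS {:L} (w i * w j).
have -> : T = map_mx intr C *m W *m (map_mx intr C)^T.
  apply/matrixP => i j; rewrite !mxE.
  rewrite (eC i) (eC j).
  have -> : galTrace 1 {:L} ((\sum_k (C i k)%:~R * w k) * (\sum_k (C j k)%:~R * w k))
     = \sum_l \sum_k (C i k)%:~R * (C j l)%:~R * galTrace 1 {:L} (w k * w l).
    rewrite galTraceE; under [RHS]eq_bigr => l _ do
      under eq_bigr => k _ do rewrite galTraceE mulr_sumr.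
    under [RHS]eq_bigr => l _ do rewrite exchange_big /=.
    rewrite [RHS]exchange_big /=; apply: eq_bigr => s _.
    rewrite rmorphM !rmorph_sum mulr_sumr; apply: eq_bigr => l _.
    rewrite mulr_suml; apply: eq_bigr => k _.
    by rewrite !rmorphM !rmorph_int; ring.
  apply: eq_bigr => l _; rewrite !mxE mulr_suml; apply: eq_bigr => k _.
  by rewrite !mxE; ring.
rewrite !det_mulmx det_tr det_map_mx; exists (\det C ^+ 2 * z).
by rewrite -[\det W]/(disc_of w) ez -!rmorphM /=; congr (_%:~R); ring.
Qed.

(** [D] is the discriminant of the powers of [alpha]. It is an integer as a determinant of traces,
    and a multiple of each difference of conjugates as the square of a Vandermonde determinant. *)
Lemma discriminant_facts : exists D : int,
  [/\ D != 0,
      (forall p, p_dvd_disc L p -> (p%:Z %| D)%Z),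
      (forall x, OK x -> exists h : {poly int},
          (size h <= N)%N /\ D%:~R * x = (map_poly intr h).[alpha]) &
      (forall i j, i != j -> exists y, OK y /\
          D%:~R = (conjugate i - conjugate j) * y)].
Proof.
have [T0 eT] := trace_mx_int; exists (\det T0).
have eD : (\det T0)%:~R = \det V ^+ 2.
  by rewrite -det_map_mx -eT trace_mx_Vandermonde det_mulmx det_tr expr2.
split.
- by rewrite -(intrL_eq0 L) eD expf_neq0 // Vandermonde_det_neq0.
- move=> p /p_dvd_disc_trace[z]; rewrite eT det_map_mx => /intrL_inj ->.
  exact: dvdz_mulr.
- move=> x ox; have [p [sp ep]] := rat_poly_rep x.
  have H k : exists z : int, (\det T0)%:~R * (p`_k)%:A = z%:~R :> L.
    rewrite eD; apply: OK_rat_int; last exact: (OK_disc_coords _ ox).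
    rewrite -eD mulrzl; apply: rpredMz; exact: rpredZ (mem1v _).
  exists (\poly_(k < N) projT1 (cid (H k))); split; first exact: size_poly.
  rewrite {1}ep (@horner_coef_wide _ N) ?size_map_poly // mulr_sumr.
  rewrite (@horner_coef_wide _ N); last first.
    by rewrite size_map_inj_poly ?size_poly //; exact: intrL_inj.
  apply: eq_bigr => k _; rewrite !coef_map coef_poly ltn_ord /= mulrA.
  by case: cid => z /= ->.
- move=> i j; wlog ij : i j / (i < j)%N => [W ij|_].
    have /orP[h|h] : (i < j)%N || (j < i)%N by rewrite -neq_ltn.
      exact: W.
    have [|y [oy ey]] := W _ _ h; first by rewrite eq_sym.
    by exists (- y); split; [exact: OKN | rewrite ey; ring].
  rewrite eD det_Vandermonde (bigD1 i) //= (bigD1 j) //= !mxE.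
  set A := \prod_(_ < _ | _) _; set B := \prod_(_ < _ | _) _.
  have oA : OK A.
    by apply: OK_prod => k _; rewrite !mxE; apply: OKB; exact: OK_conjugate.
  have oB : OK B.
    apply: OK_prod => k _; apply: OK_prod => l _.
    by rewrite !mxE; apply: OKB; exact: OK_conjugate.
  exists (- (A * B * ((conjugate j - conjugate i) * A * B))); split; last by ring.
  apply: OKN; apply: OKM; first exact: OKM.
  by apply: OKM => //; apply: OKM => //; apply: OKB; exact: OK_conjugate.
Qed.
End Conjugates.
(** * Reduction modulo primes *)

Lemma intr_pchar_eq0 (k : fieldType) p (z : int) : p \in [pchar k] ->
  ((z%:~R : k) == 0) = (p%:Z %| z)%Z.
Proof.
move=> cp; rewrite dvdzE absz_nat; case: z => n.
  by rewrite -pmulrn (dvdn_pcharf cp).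
by rewrite NegzE mulrNz oppr_eq0 -pmulrn abszN (dvdn_pcharf cp).
Qed.

Section Reduction.
Variable L : splittingFieldType rat.
Hypothesis galL : galois 1%VS {:L}.
Local Notation N := (\dim {:L}).
Variable alpha : L.
Hypothesis OK_alpha : OK alpha.
Hypothesis gen_alpha : <<1%VS; alpha>>%VS = {:L}%VS.
Variable f : {poly int}.
Hypothesis f_monic : f \is monic.
Local Notation conj := (conjugate galL alpha).
Hypothesis f_prod : map_poly intr f = \prod_(i < N) ('X - (conj i)%:P).
Variable D : int.
Hypothesis D_gen : forall x, OK x -> exists h : {poly int},
  (size h <= N)%N /\ D%:~R * x = (map_poly intr h).[alpha].
Hypothesis D_diff : forall i j, i != j -> exists y, OK y /\
  D%:~R = (conj i - conj j) * y.
Variables (p : nat) (k : fieldType).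
Hypothesis charp : p \in [pchar k].
Hypothesis p_D : ~~ (p%:Z %| D)%Z.
Variable beta : k.
Hypothesis root_beta : root (map_poly intr f) beta.

Let D0 : (D%:~R : k) != 0.
Proof. by rewrite (intr_pchar_eq0 _ charp). Qed.

(* The homomorphism from the integers of [L] to [k] sending [alpha] to [beta];
   it is a junk value outside [Z[alpha] / D]. *)
Definition reduction (x : L) : k :=
  match pselect (exists h : {poly int}, D%:~R * x = (map_poly intr h).[alpha]) with
  | left H => (map_poly intr (projT1 (cid H))).[beta] / D%:~R
  | right _ => 0
  end.

Lemma horner_beta0 (h : {poly int}) :
  (map_poly intr h).[alpha] = 0 -> (map_poly intr h).[beta] = 0.
Proof.
move=> /(int_minpoly_dvd gen_alpha f_monic f_prod)[q ->].
by rewrite rmorphM hornerM (eqP root_beta) mulr0.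
Qed.

(** The value does not depend on [h]: two choices differ by a multiple of [f], which vanishes at
    [beta]. *)
Lemma reductionE x (h : {poly int}) :
  D%:~R * x = (map_poly intr h).[alpha] -> reduction x = (map_poly intr h).[beta] / D%:~R.
Proof.
move=> e; rewrite /reduction; case: pselect => [H|H]; last by case: H; exists h.
case: cid => g /= eg; congr (_ / _); apply/eqP; rewrite -subr_eq0 -hornerN -hornerD.
by rewrite -rmorphB horner_beta0 // rmorphB hornerD hornerN -e -eg subrr.
Qed.

Lemma reductionD x y : OK x -> OK y -> reduction (x + y) = reduction x + reduction y.
Proof.
move=> /D_gen[g [_ eg]] /D_gen[h [_ eh]].
rewrite (reductionE eg) (reductionE eh) (@reductionE _ (g + h)).
  by rewrite rmorphD hornerD mulrDl.
by rewrite rmorphD hornerD mulrDr eg eh.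
Qed.

(** With [D x = g(alpha)], [D y = h(alpha)] and [D x y = l(alpha)], the polynomial [D l - g h] kills
    [alpha], hence [beta]. *)
Lemma reductionM x y : OK x -> OK y -> reduction (x * y) = reduction x * reduction y.
Proof.
move=> ox oy; have [g [_ eg]] := D_gen ox; have [h [_ eh]] := D_gen oy.
have [l [_ el]] := D_gen (OKM ox oy).
rewrite (reductionE eg) (reductionE eh) (reductionE el).
have : (map_poly intr (D%:P * l - g * h)).[alpha] = 0.
  rewrite rmorphB !rmorphM hornerD hornerN !hornerM -eg -eh -el.
  by rewrite /= map_polyC hornerC /=; ring.
move=> /horner_beta0; rewrite rmorphB !rmorphM hornerD hornerN !hornerM /=.
rewrite map_polyC hornerC /= => /eqP; rewrite subr_eq0 => /eqP e.
by rewrite mulrACA -e; field.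
Qed.

Lemma reduction_int (z : int) : reduction z%:~R = z%:~R.
Proof.
rewrite (@reductionE _ (D * z)%:P); last by rewrite map_polyC hornerC /= rmorphM.
by rewrite map_polyC hornerC /= rmorphM mulrAC divff // mul1r.
Qed.

Lemma reductionN x : OK x -> reduction (- x) = - reduction x.
Proof.
move=> ox; rewrite -mulN1r -(mulN1r (reduction x)).
by rewrite reductionM //; [rewrite (reduction_int (-1)) | exact/OKN/OK1].
Qed.

Lemma reductionB x y : OK x -> OK y -> reduction (x - y) = reduction x - reduction y.
Proof. by move=> ox oy; rewrite reductionD ?reductionN //; exact: OKN. Qed.

Lemma reduction_horner (h : {poly int}) x : OK x ->
  reduction (map_poly intr h).[x] = (map_poly intr h).[reduction x].
Proof.
move=> ox; elim/poly_ind: h => [|h c IH].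
  by rewrite !rmorph0 !horner0 (reduction_int 0).
rewrite !rmorphD !rmorphM /= !map_polyX !map_polyC !hornerMXaddC /= -IH.
by rewrite reductionD ?reductionM ?reduction_int //; [exact: OK_horner| exact: OKM (OK_horner _ ox) ox|exact: OK_int].
Qed.

Definition redconj (i : 'I_N) : k := reduction (conj i).

(** [D] is a multiple of the difference of two conjugates, and its reduction is not zero. *)
Lemma redconj_inj : injective redconj.
Proof.
move=> i j e; apply/eqP; apply: contraT => ij.
have [y [oy ey]] := D_diff ij.
have := reduction_int D; rewrite ey reductionM ?reductionB //; last 3 first.
- exact: OK_conjugate.
- exact: OK_conjugate.
- by apply: OKB; exact: OK_conjugate.
by rewrite -/(redconj i) e subrr mul0r => /esym/eqP; rewrite (negbTE D0).
Qed.

Lemma root_redconj i : root (map_poly intr f) (redconj i).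
Proof.
rewrite rootE -reduction_horner; last exact: OK_conjugate.
have e0 := int_minpoly_alpha0 f_prod.
by rewrite (@root_conjugate _ galL alpha f i e0) (reduction_int 0).
Qed.

(** The reduced conjugates are [N] distinct roots of a monic polynomial of degree [N]: one root in
    [k] makes [f] split there. *)
Lemma reduced_minpoly_prod :
  map_poly intr f = \prod_(i < N) ('X - (redconj i)%:P) :> {poly k}.
Proof.
have m1 : (map_poly intr f : {poly k}) \is monic by exact: monic_map.
have := @all_roots_prod_XsubC _ (map_poly intr f : {poly k}) [seq redconj i | i : 'I_N].
rewrite (monicP m1) scale1r big_map big_enum => -> //.
- rewrite size_map size_enum_ord.
  rewrite size_map_poly_id0 ?(size_int_minpoly f_prod) //.
  by rewrite (monicP f_monic) oner_neq0.
- by apply/allP => _ /mapP[i _ ->]; exact: root_redconj.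
- by rewrite uniq_rootsE map_inj_uniq ?enum_uniq //; exact: redconj_inj.
Qed.

Lemma reduction_gal i x (h : {poly int}) :
  D%:~R * x = (map_poly intr h).[alpha] -> OK x ->
  reduction (gal_enum galL i x) = (map_poly intr h).[redconj i] / D%:~R.
Proof.
move=> e ox; rewrite -reduction_horner; last exact: OK_conjugate.
rewrite -gal_horner_int -e rmorphM rmorph_int reductionM ?reduction_int.
- by rewrite mulrAC divff // mul1r.
- exact: OK_int.
- exact: OK_gal.
Qed.

(** The polynomial [h] of degree less than [N] with [D x = h(alpha)] has [N] distinct roots mod [p],
    so [p] divides its coefficients. As [D] is invertible mod [p], this passes from [D x] to [x]. *)
Lemma reduction_gal_eq0 x : OK x ->
  (forall i, reduction (gal_enum galL i x) = 0) -> pOK p x.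
Proof.
move=> ox H; have [h [sh eh]] := D_gen ox.
have h0 : (map_poly intr h : {poly k}) = 0.
  apply/eqP; apply: contraT => hn0.
  have := @max_poly_roots _ (map_poly intr h : {poly k}) [seq redconj i | i : 'I_N] hn0.
  rewrite size_map size_enum_ord ltnNge (leq_trans (size_poly _ _) sh) ; apply.
    apply/allP => _ /mapP[i _ ->]; rewrite rootE.
    have /eqP := H i; rewrite (reduction_gal _ eh) // mulf_eq0 invr_eq0 (negbTE D0).
    by rewrite orbF.
  by rewrite map_inj_uniq ?enum_uniq //; exact: redconj_inj.
have hp i : exists c, h`_i = p%:Z * c.
  have /eqP := congr1 (fun q : {poly k} => q`_i) h0.
  rewrite coef_map coef0 (intr_pchar_eq0 _ charp) => /dvdzP[c ->].
  by exists c; rewrite mulrC.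
pose h' := \poly_(i < size h) projT1 (cid (hp i)).
have eh' : h = p%:Z *: h'.
  apply/polyP => i; rewrite coefZ coef_poly; case: ltnP => hi.
    by case: cid => c /=.
  by rewrite nth_default // mulr0.
have : coprimez p D.
  by rewrite coprimezE absz_nat prime_coprime ?(pcharf_prime charp).
move=> /coprimezP[[u v] /= euv].
have eD : D%:~R * x = p%:R * (map_poly intr h').[alpha].
  by rewrite eh eh' map_polyZ hornerZ /= -pmulrn.
exists (u%:~R * x + v%:~R * (map_poly intr h').[alpha]); split.
  by apply: OKD; apply: OKM => //; [exact: OK_int|exact: OK_int|exact: OK_horner].
rewrite mulrDr [_ * (v%:~R * _)]mulrCA -eD.
have e1 : 1 = u%:~R * p%:R + v%:~R * D%:~R :> L.
  by rewrite pmulrn -!rmorphM -rmorphD /= euv.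
by rewrite !mulrA -mulrDl [p%:R * _]mulrC -e1 mul1r.
Qed.
End Reduction.

(** * Decomposition of the primes not dividing [D] *)

Section PrimeDecomposition.
Variable L : splittingFieldType rat.
Hypothesis galL : galois 1%VS {:L}.
Local Notation N := (\dim {:L}).
Variable alpha : L.
Hypothesis OK_alpha : OK alpha.
Hypothesis gen_alpha : <<1%VS; alpha>>%VS = {:L}%VS.
Variable f : {poly int}.
Hypothesis f_monic : f \is monic.
Local Notation conj := (conjugate galL alpha).
Hypothesis f_prod : map_poly intr f = \prod_(i < N) ('X - (conj i)%:P).
Variable D : int.
Hypothesis D_gen : forall x, OK x -> exists h : {poly int},
  (size h <= N)%N /\ D%:~R * x = (map_poly intr h).[alpha].
Hypothesis D_diff : forall i j, i != j -> exists y, OK y /\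
  D%:~R = (conj i - conj j) * y.
Variable p : nat.
Hypothesis p_prime : prime p.
Hypothesis p_D : ~~ (p%:Z %| D)%Z.

Lemma intr_Fp_lift (c : 'F_p) : (((c : nat)%:Z)%:~R : 'F_p) = c.
Proof. by rewrite -pmulrn natr_Zp. Qed.

Lemma poly_Fp_lift (q : {poly 'F_p}) : exists h : {poly int},
  map_poly intr h = q /\ (size h <= size q)%N.
Proof.
exists (\poly_(i < size q) (nat_of_ord (nth (0 : 'F_p) q i))%:Z); split; last exact: size_poly.
apply/polyP => i; rewrite coef_map coef_poly; case: ltnP => hi /=.
  exact: intr_Fp_lift.
by rewrite nth_default.
Qed.

Lemma dvd_horner_Fp (h : {poly int}) (c : int) :
  root (map_poly intr h : {poly 'F_p}) c%:~R = (p%:Z %| h.[c])%Z.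
Proof. by rewrite rootE horner_map (intr_pchar_eq0 _ (pchar_Fp p_prime)). Qed.

(** Take [k = 'F_p]: a single root defines a reduction into ['F_p], and the reduced conjugates are
    [N] distinct roots. *)
Lemma split_of_root (c : int) : (p%:Z %| f.[c])%Z ->
  exists r : 'I_N -> int, (forall i, (p%:Z %| f.[r i])%Z) /\
    (forall i j, i != j -> ~~ (p%:Z %| r i - r j)%Z).
Proof.
rewrite -dvd_horner_Fp => rc; have cp := pchar_Fp p_prime.
pose b := redconj galL alpha D (c%:~R : 'F_p).
exists (fun i => (b i : nat)%:Z); split=> [i|i j ij].
  rewrite -dvd_horner_Fp intr_Fp_lift.
  exact: (root_redconj OK_alpha gen_alpha f_monic f_prod D_gen cp p_D rc).
rewrite -(intr_pchar_eq0 _ cp) rmorphB /= !intr_Fp_lift subr_eq0.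
apply: contra ij => /eqP e; apply/eqP.
exact: (redconj_inj OK_alpha gen_alpha f_monic f_prod D_gen D_diff cp p_D rc e).
Qed.

(** * Primes modulo which [f] has no root *)

Section Nonsplit.
Variable k : splittingFieldType 'F_p.
Variable beta : k.
Hypothesis root_beta : root (map_poly intr f) beta.
Hypothesis no_root : forall c : int, ~~ (p%:Z %| f.[c])%Z.

Let cp : p \in [pchar k].
Proof. by rewrite pchar_lalg pchar_Fp. Qed.

Let red := reduction alpha D beta.
Let b := redconj galL alpha D beta.
Let OKc i : OK (conj i) := OK_conjugate galL OK_alpha i.
Let D0 : (D%:~R : k) != 0.
Proof. by rewrite (intr_pchar_eq0 _ cp). Qed.

Lemma map_poly_int_Fp (h : {poly int}) :
  map_poly (in_alg k) (map_poly intr h : {poly 'F_p}) = map_poly intr h.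
Proof.
by rewrite -map_poly_comp; apply: eq_map_poly => z /=; rewrite -(rmorph_int (in_alg k)).
Qed.

Lemma polyOver_int (h : {poly int}) : (map_poly intr h : {poly k}) \is a polyOver 1%VS.
Proof. by apply/polyOver1P; exists (map_poly intr h); rewrite map_poly_int_Fp. Qed.

Lemma red_gal i x (h : {poly int}) : D%:~R * x = (map_poly intr h).[alpha] -> OK x ->
  red (gal_enum galL i x) = (map_poly intr h).[b i] / D%:~R.
Proof.
by move=> e ox; exact: (reduction_gal OK_alpha gen_alpha f_monic f_prod D_gen cp p_D root_beta).
Qed.

Lemma redconj_horner i x : OK x -> exists q : {poly k},
  q \is a polyOver 1%VS /\ red (gal_enum galL i x) = q.[b i].
Proof.
move=> ox; have [h [_ eh]] := D_gen ox.
exists ((D%:~R^-1 : k) *: map_poly intr h); split; last first.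
  by rewrite (red_gal _ eh) // hornerZ mulrC.
apply: polyOverZ; last exact: polyOver_int.
by rewrite rpredV; apply: rpred_int.
Qed.

(** Up to the factor [D], every integer of the field is a polynomial in the [i]-th conjugate. Hence
    all roots of [f] mod [p] generate the same extension of ['F_p] and have the same degree. *)
Lemma redconj_mem i j : b j \in <<1%VS; b i>>%VS.
Proof.
have [l el] := gal_enum_surj galL (groupM (gal_enum_in galL j) (groupVr (gal_enum_in galL i))).
have e : conj j = gal_enum galL i (conj l).
  by rewrite /conjugate el -galM ?memvf // mulgKV.
have [q [qo eq]] := redconj_horner i (OKc l).
have -> : b j = q.[b i] by rewrite -eq /b /redconj e.
by apply: mempx_Fadjoin.
Qed.

Definition residue_degree := adjoin_degree 1%AS beta.
Local Notation r := residue_degree.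

Lemma redconj_base : exists i, b i = beta.
Proof.
have [i ei] := gal_enum_id galL; exists i; rewrite /b /redconj /conjugate ei.
have e : D%:~R * alpha = (map_poly intr (D *: 'X)).[alpha].
  by rewrite map_polyZ map_polyX hornerZ hornerX.
rewrite (reductionE gen_alpha f_monic f_prod root_beta e).
by rewrite map_polyZ map_polyX hornerZ hornerX mulrAC divff // mul1r.
Qed.

Lemma adjoin_degree_redconj i : adjoin_degree 1%AS (b i) = r.
Proof.
have [j ej] := redconj_base.
have e : <<1%VS; b i>>%VS = <<1%VS; beta>>%VS.
  apply/eqP; rewrite eqEsubv -ej.
  by apply/andP; split; apply/FadjoinP; split; rewrite ?sub1v ?redconj_mem.
by rewrite /residue_degree !adjoin_degreeE e.
Qed.

Lemma residue_degree_gt0 : (0 < r)%N.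
Proof. by rewrite /residue_degree. Qed.

Lemma residue_degree_gt1 : (1 < r)%N.
Proof.
rewrite ltn_neqAle residue_degree_gt0 andbT eq_sym; apply/negP => r1.
have : beta \in 1%VS by rewrite -(adjoin_deg_eq1 1%AS).
move=> /vlineP[c ec].
have := no_root (c : nat)%:Z; rewrite -dvd_horner_Fp intr_Fp_lift.
by rewrite -(fmorph_root (in_alg k)) map_poly_int_Fp /= -ec root_beta.
Qed.

Fact redmin_ex i : exists q : {poly 'F_p}, minPoly 1%AS (b i) = map_poly (in_alg k) q.
Proof. by have /polyOver1P := minPolyOver 1%AS (b i). Qed.

(** These are the irreducible factors of [f] mod [p], descended from [k] to ['F_p]. *)
Definition redmin i : {poly 'F_p} := projT1 (cid (redmin_ex i)).

Lemma redminE i : map_poly (in_alg k) (redmin i) = minPoly 1%AS (b i).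
Proof. by rewrite /redmin; case: cid => q /= ->. Qed.

Lemma size_redmin i : size (redmin i) = r.+1.
Proof. by rewrite -(size_map_poly (in_alg k)) redminE size_minPoly adjoin_degree_redconj. Qed.

Lemma redmin_monic i : redmin i \is monic.
Proof. by rewrite -(map_monic (in_alg k)) redminE monic_minPoly. Qed.

Lemma redmin_dvd i (q : {poly 'F_p}) :
  (redmin i %| q) = root (map_poly (in_alg k) q) (b i).
Proof.
rewrite -(dvdp_map (in_alg k)) redminE; apply/idP/idP => [h|h].
  by rewrite -dvdp_XsubCl; apply: dvdp_trans h; rewrite dvdp_XsubCl root_minPoly.
by apply: minPoly_dvdp => //; apply/polyOver1P; exists q.
Qed.

Lemma redmin_irr i : irreducible_poly (redmin i).
Proof.
split; first by rewrite size_redmin ltnS residue_degree_gt0.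
move=> q q1 qd; have : map_poly (in_alg k) q %| minPoly 1%AS (b i).
  by rewrite -redminE dvdp_map.
move=> /minPoly_irr; rewrite -redminE.
have -> : map_poly (in_alg k) q \is a polyOver 1%AS by apply/polyOver1P; exists q.
move=> /(_ isT) /orP[|]; first by rewrite eqp_map.
by rewrite -(rmorph1 (map_poly (in_alg k))) eqp_map -size_poly_eq1 (negbTE q1).
Qed.

Lemma redmin_root_eq i j : root (map_poly (in_alg k) (redmin i)) (b j) = (redmin j == redmin i).
Proof.
rewrite -redmin_dvd; apply/idP/eqP => [h|->]; last exact: dvdpp.
apply/eqP; rewrite -eqp_monic ?redmin_monic //.
by rewrite -dvdp_size_eqp // !size_redmin.
Qed.

Lemma redmin_coprime i j : redmin i != redmin j -> coprimep (redmin i) (redmin j).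
Proof.
move=> ij; rewrite irreducible_poly_coprime; last exact: redmin_irr.
by rewrite redmin_dvd redmin_root_eq.
Qed.

Lemma reduced_prod : map_poly intr f = \prod_(i < N) ('X - (b i)%:P) :> {poly k}.
Proof.
exact: (reduced_minpoly_prod OK_alpha gen_alpha f_monic f_prod D_gen D_diff cp p_D root_beta).
Qed.

Lemma b_inj : injective b.
Proof.
exact: (redconj_inj OK_alpha gen_alpha f_monic f_prod D_gen D_diff cp p_D root_beta).
Qed.

(** The minimal polynomial divides the product of the distinct ['X - b j], so it is a subproduct,
    with as many factors as its degree. *)
Lemma card_redmin i : #|[pred j | redmin j == redmin i]| = r.
Proof.
have : minPoly 1%AS (b i) %| \prod_(j <- enum 'I_N) ('X - (b j)%:P).
  rewrite big_enum -reduced_prod; apply: minPoly_dvdp; first exact: polyOver_int.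
  by rewrite reduced_prod /root horner_prod (bigD1 i) //= hornerXsubC subrr mul0r.
move=> /dvdp_prod_XsubC[mk emk].
have : size (minPoly 1%AS (b i)) = (size (mask mk (enum 'I_N))).+1.
  by rewrite (eqp_size emk) size_prod_XsubC.
rewrite size_minPoly adjoin_degree_redconj => -[->].
rewrite -(card_uniqP (mask_uniq (enum_uniq _) mk)); apply: eq_card => j.
rewrite inE /= -redmin_root_eq redminE (eqp_root emk).
rewrite -(big_map b xpredT (fun x => 'X - x%:P)) root_prod_XsubC.
by rewrite mem_map //; exact: b_inj.
Qed.

Definition redmins : seq {poly 'F_p} := undup [seq redmin i | i <- enum 'I_N].

Lemma redminsP q : reflect (exists i, q = redmin i) (q \in redmins).
Proof.
rewrite mem_undup; apply: (iffP mapP) => [[i _ ->]|[i ->]]; first by exists i.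
by exists i; rewrite ?mem_enum.
Qed.

Lemma size_redmins : (size redmins * r)%N = N.
Proof.
have := big_undup_iterop_count addn [seq redmin i | i <- enum 'I_N] xpredT (fun=> 1%N).
rewrite [RHS]big_const_seq count_predT iter_addn_0 mul1n size_map size_enum_ord => <-.
rewrite -/redmins big_seq (eq_bigr (fun=> r)) -?big_seq.
  by rewrite big_const_seq count_predT iter_addn_0 mulnC.
move=> q /redminsP[i ->]; rewrite Monoid.iteropE iter_addn_0 mul1n.
rewrite count_map -(card_redmin i) cardE size_filter enumT.
by apply: eq_count => j /=; rewrite inE.
Qed.

(** Dedekind's prime ideal attached to the factor [q] of [f] mod [p]. Membership is tested on [D x],
    which is a polynomial in [alpha]; this is harmless since [p] does not divide [D]. *)
Definition red_ideal (q : {poly 'F_p}) (x : L) : Prop :=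
  OK x /\ exists h : {poly int}, D%:~R * x = (map_poly intr h).[alpha] /\
    q %| map_poly intr h.

Lemma red_idealP i x : OK x ->
  red_ideal (redmin i) x <-> red (gal_enum galL i x) = 0.
Proof.
move=> ox; split=> [[_ [h [eh dh]]]|].
  rewrite (red_gal _ eh) //; move: dh; rewrite redmin_dvd map_poly_int_Fp.
  by move=> /eqP ->; rewrite mul0r.
have [h [_ eh]] := D_gen ox; rewrite (red_gal _ eh) // => /eqP.
rewrite mulf_eq0 invr_eq0 (negbTE D0) orbF => h0.
by split=> //; exists h; split=> //; rewrite redmin_dvd map_poly_int_Fp.
Qed.

Lemma red_ideal_horner i (h : {poly int}) :
  redmin i %| map_poly intr h -> red_ideal (redmin i) (map_poly intr h).[alpha].
Proof.
move=> dh; split; first exact: OK_horner.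
exists (D *: h); split; first by rewrite map_polyZ hornerZ.
by rewrite map_polyZ -mul_polyC dvdp_mull.
Qed.

Lemma red_galB i x y : OK x -> OK y ->
  red (gal_enum galL i (x - y)) = red (gal_enum galL i x) - red (gal_enum galL i y).
Proof.
move=> ox oy; rewrite rmorphB.
by apply: (reductionB gen_alpha f_monic f_prod D_gen cp p_D root_beta); exact: OK_gal.
Qed.

Lemma red_galM i x y : OK x -> OK y ->
  red (gal_enum galL i (x * y)) = red (gal_enum galL i x) * red (gal_enum galL i y).
Proof.
move=> ox oy; rewrite rmorphM.
by apply: (reductionM gen_alpha f_monic f_prod D_gen cp p_D root_beta); exact: OK_gal.
Qed.

Lemma red_gal_int i z : red (gal_enum galL i z%:~R) = z%:~R.
Proof.
by rewrite rmorph_int; exact: (reduction_int gen_alpha f_monic f_prod cp p_D root_beta).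
Qed.

Lemma red_ideal_ideal i : is_ideal (red_ideal (redmin i)).
Proof.
split=> [x []//| |x y [ox hx] [oy hy]|c x oc [ox hx]].
- by apply/(red_idealP _ (OK0 L)); rewrite (red_gal_int i 0).
- apply/red_idealP; first exact: OKD.
  rewrite -[y]opprK red_galB ?[- y]opprK //; last exact: OKN.
  have /red_idealP -> // : red_ideal (redmin i) x by [].
  have /red_idealP : red_ideal (redmin i) y by [].
  move=> /(_ oy) ey; rewrite -[- y]sub0r red_galB ?(red_gal_int i 0) ?ey ?subrr //.
  exact: OK0.
- apply/red_idealP; first exact: OKM.
  have /red_idealP ex : red_ideal (redmin i) x by [].
  by rewrite red_galM // ex // mulr0.
Qed.

Lemma p_in_red_ideal i : red_ideal (redmin i) p%:R.
Proof.
have e : p%:R = (p%:Z)%:~R :> L by rewrite -pmulrn.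
rewrite e; apply/red_idealP; first exact: OK_int.
by rewrite red_gal_int -pmulrn; apply/eqP; rewrite -(dvdn_pcharf cp).
Qed.

Lemma red_ideal_prime i : prime_ideal (red_ideal (redmin i)).
Proof.
split.
- split; first exact: red_ideal_ideal.
  exists p%:R; split; first exact: p_in_red_ideal.
  by rewrite pmulrn intrL_eq0 -lt0n prime_gt0.
- move=> /red_idealP; rewrite (red_gal_int i 1) => /(_ (OK1 L)) /eqP.
  by rewrite oner_eq0.
- move=> x y ox oy /red_idealP; rewrite red_galM // => /(_ (OKM ox oy)) /eqP.
  rewrite mulf_eq0 => /orP[|] /eqP h; [left|right]; exact/red_idealP.
Qed.

(** The residue field is generated by [b i] over ['F_p]; representatives are the [p ^ r] polynomials
    of degree less than [r], lifted to integer coefficients and evaluated at [alpha]. *)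
Lemma red_ideal_norm i : ideal_norm (red_ideal (redmin i)) (p ^ r).
Proof.
have card : #|{ffun 'I_r -> 'F_p}| = (p ^ r)%N by rewrite card_ffun card_Fp // card_ord.
pose tf (t : 'I_(p ^ r)) : {ffun 'I_r -> 'F_p} := enum_val (cast_ord (esym card) t).
pose q (g : {ffun 'I_r -> 'F_p}) : {poly 'F_p} := \poly_(l < r) (if insub l is Some l' then g l' else 0).
pose h g := projT1 (cid (poly_Fp_lift (q g))).
have hq g : map_poly intr (h g) = q g by rewrite /h; case: cid => ? [/= -> _].
have rh g : red (gal_enum galL i (map_poly intr (h g)).[alpha]) = (map_poly (in_alg k) (q g)).[b i].
  rewrite (@red_gal i _ (D *: h g)); last exact: OK_horner.
    by rewrite map_polyZ hornerZ mulrAC divff // mul1r -hq map_poly_int_Fp.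
  by rewrite map_polyZ hornerZ.
exists (fun t => (map_poly intr (h (tf t))).[alpha]); split=> [t|t u|x ox].
- exact: OK_horner.
- move=> /red_idealP; rewrite red_galB; try exact: OK_horner.
  move=> /(_ (OKB (OK_horner _ OK_alpha) (OK_horner _ OK_alpha))).
  rewrite !rh => /eqP; rewrite -hornerN -hornerD -rmorphB -rootE -redmin_dvd => hd.
  have : q (tf t) - q (tf u) == 0.
    apply: contraTT hd => nz; apply/negP => /dvdp_leq => /(_ nz).
    apply/negP; rewrite -ltnNge size_redmin ltnS; apply: leq_trans (size_polyD _ _) _.
    by rewrite size_polyN geq_max !size_poly.
  rewrite subr_eq0 => /eqP e.
  suff /enum_val_inj /cast_ord_inj : tf t = tf u by [].
  apply/ffunP => l; have := congr1 (fun s : {poly 'F_p} => s`_l) e.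
  by rewrite !coef_poly ltn_ord valK.
- have [s [sO es]] := redconj_horner i ox.
  have vm : red (gal_enum galL i x) \in <<1%VS; b i>>%VS by rewrite es mempx_Fadjoin.
  have /polyOver1P[g eg] := Fadjoin_polyOver 1%AS (b i) (red (gal_enum galL i x)).
  have sg : (size g <= r)%N.
    rewrite -(size_map_poly (in_alg k)) -eg -(adjoin_degree_redconj i).
    exact: size_Fadjoin_poly.
  pose t := cast_ord card (enum_rank [ffun l : 'I_r => g`_l]).
  have et : q (tf t) = g.
    apply/polyP => l; rewrite coef_poly /tf cast_ordK enum_rankK.
    case: ltnP => hl; first by rewrite insubT ffunE.
    by rewrite nth_default // (leq_trans sg).
  exists t; apply/red_idealP; first by apply: OKB => //; exact: OK_horner.
  rewrite red_galB //; last exact: OK_horner.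
  by rewrite rh et -eg Fadjoin_poly_eq // subrr.
Qed.

Lemma red_ideal_inj i j : ideal_eq (red_ideal (redmin i)) (red_ideal (redmin j)) ->
  redmin i = redmin j.
Proof.
move=> e; have [h [eh _]] := poly_Fp_lift (redmin i).
have : red_ideal (redmin i) (map_poly intr h).[alpha].
  by apply: red_ideal_horner; rewrite eh.
move=> /e /(red_idealP j (OK_horner h OK_alpha)).
rewrite (@red_gal j _ (D *: h)); last exact: OK_horner.
  rewrite map_polyZ hornerZ mulrAC divff // mul1r -map_poly_int_Fp eh => /eqP.
  by rewrite -rootE redmin_root_eq => /eqP.
by rewrite map_polyZ hornerZ.
Qed.

Lemma ideal_mul_sub (A B : L -> Prop) x : is_ideal A -> is_ideal B ->
  ideal_mul A B x -> A x /\ B x.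
Proof.
move=> [AO A0 AD AM] [BO B0 BD BM] [n [u [v [H ->]]]]; split.
  elim/big_ind: _ => // l _; rewrite mulrC; apply: AM; last by have [] := H l.
  by apply: BO; have [] := H l.
elim/big_ind: _ => // l _; apply: BM; last by have [] := H l.
by apply: AO; have [] := H l.
Qed.

Lemma ideal_mul_ideal (A B : L -> Prop) : is_ideal A -> is_ideal B ->
  is_ideal (ideal_mul A B).
Proof.
move=> iA iB; split=> [x| |x y|c x oc].
- by move=> /(ideal_mul_sub iA iB)[Ax _]; case: iA => + _ _ _; apply.
- by exists 0%N, (fun=> 0), (fun=> 0); split; [case | rewrite big_ord0].
- move=> [m [u [v [H ->]]]] [n [u' [v' [H' ->]]]].
  exists (m + n)%N, (fun l : 'I_(m + n) => match fintype.split l with inl a => u a | inr a => u' a end),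
    (fun l : 'I_(m + n) => match fintype.split l with inl a => v a | inr a => v' a end); split.
    by move=> l; case: splitP => a _.
  rewrite big_split_ord /=; congr (_ + _); apply: eq_bigr => a _.
    by rewrite (unsplitK (inl a)).
  by rewrite (unsplitK (inr a)).
- move=> [n [u [v [H ->]]]]; exists n, (fun l => c * u l), v; split.
    move=> l; have [Au Bv] := H l; split=> //; by case: iA => _ _ _; apply.
  by rewrite mulr_sumr; apply: eq_bigr => l _; rewrite mulrA.
Qed.

Lemma OK_ideal : is_ideal (@OK L).
Proof. by split=> //; [exact: OK0 | exact: OKD | exact: OKM]. Qed.

Lemma red_ideal_prod (s : seq {poly 'F_p}) : {subset s <= redmins} ->
  is_ideal (ideal_prod [seq red_ideal q | q <- s]).
Proof.
elim: s => [|q s IH] sub; first exact: OK_ideal.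
apply: ideal_mul_ideal; last by apply: IH => z zs; apply: sub; rewrite inE zs orbT.
have /redminsP[i ->] : q \in redmins by apply: sub; rewrite inE eqxx.
exact: red_ideal_ideal.
Qed.

Lemma red_ideal_prod_sub (s : seq {poly 'F_p}) x : {subset s <= redmins} ->
  ideal_prod [seq red_ideal q | q <- s] x -> forall q, q \in s -> red_ideal q x.
Proof.
elim: s => [|q s IH] sub // H z.
have sub' : {subset s <= redmins} by move=> y ys; apply: sub; rewrite inE ys orbT.
have /redminsP[i ei] : q \in redmins by apply: sub; rewrite inE eqxx.
have [] := ideal_mul_sub _ (red_ideal_prod sub') H; first by rewrite ei; exact: red_ideal_ideal.
by move=> qx sx; rewrite inE => /predU1P[-> //|]; exact: IH.
Qed.

(* Chinese remainder: a Bezout relation mod p makes the factors comaximal. *)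
Lemma red_ideal_prod_cap (s : seq {poly 'F_p}) x : uniq s -> {subset s <= redmins} ->
  OK x -> (forall q, q \in s -> red_ideal q x) ->
  ideal_prod [seq red_ideal q | q <- s] x.
Proof.
elim: s x => [|q s IH] x //= /andP[qs us] sub ox H.
have sub' : {subset s <= redmins} by move=> y ys; apply: sub; rewrite inE ys orbT.
have /redminsP[i ei] : q \in redmins by apply: sub; rewrite inE eqxx.
have cop : coprimep q (\prod_(z <- s) z).
  rewrite big_seq; elim/big_ind: _ => [|y z|z zs]; first exact: coprimep1.
    by rewrite coprimepMr => -> ->.
  have /redminsP[j ej] := sub' _ zs; rewrite ei ej; apply: redmin_coprime.
  by rewrite -ei -ej; apply: contraNneq qs => ->.
have /Bezout_eq1_coprimepP[[u v] /= uv] := cop.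
have [a [ea _]] := poly_Fp_lift (u * q).
set y := (map_poly intr a).[alpha].
have oy : OK y by exact: OK_horner.
have qy : red_ideal q y by rewrite ei; apply: red_ideal_horner; rewrite ea ei dvdp_mull.
have sy z : z \in s -> red_ideal z (1 - y).
  move=> zs; have /redminsP[j ej] := sub' _ zs.
  have -> : 1 - y = (map_poly intr (1 - a)).[alpha].
    by rewrite rmorphB hornerD hornerN rmorph1 hornerC.
  rewrite ej; apply: red_ideal_horner; rewrite -ej rmorphB rmorph1 /= ea -uv addrC addKr.
  by apply: dvdp_mull; rewrite (big_rem z) //= dvdp_mulr.
have sid z : z \in s -> is_ideal (red_ideal z).
  by move=> zs; have /redminsP[j ->] := sub' _ zs; exact: red_ideal_ideal.
(* The decomposition is [x = y x + x (1 - y)], with [y] in the first ideal and [1 - y] in the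
   product of the others. *)
exists 2%N, (fun l => if l == ord0 then y else x),
   (fun l => if l == ord0 then x else 1 - y); split; last first.
  by rewrite big_ord_recl big_ord1 /=; ring.
move=> l; case: ifP => _; split=> //.
- by apply: IH => // z zs; apply: H; rewrite inE zs orbT.
- by apply: H; rewrite inE eqxx.
- by apply: IH => //; apply: OKB => //; exact: OK1.
Qed.

(** An element of the product is killed by all the reductions, hence divisible by [p] by
    [reduction_gal_eq0]. Conversely [p] lies in every factor, and the product contains the
    intersection. *)
Lemma ideal_prod_redmins : ideal_eq (ideal_prod [seq red_ideal q | q <- redmins]) (pOK p).
Proof.
move=> x; split.
  move=> /(red_ideal_prod_sub (fun _ h => h)) H.
  have Hi i : red_ideal (redmin i) x by apply: H; apply/redminsP; exists i.
  have [i0 _] := redconj_base; have [ox _] := Hi i0.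
  apply: (reduction_gal_eq0 OK_alpha gen_alpha f_monic f_prod D_gen D_diff cp p_D root_beta ox).
  by move=> i; exact/red_idealP.
move=> [y [oy ->]]; apply: red_ideal_prod_cap => //.
- exact: undup_uniq.
- apply: OKM => //; rewrite pmulrn; exact: OK_int.
- move=> q /redminsP[i ->]; have [_ _ _ iM] := red_ideal_ideal i.
  by rewrite mulrC; apply: iM => //; exact: p_in_red_ideal.
Qed.

Hypothesis D_disc : forall p, p_dvd_disc L p -> (p%:Z %| D)%Z.

Lemma nonsplit_P_r_of_root : exists2 d, (d %| N)%N & (1 < d)%N /\ P_r L d p.
Proof.
exists r; first by apply/dvdnP; exists (size redmins); rewrite size_redmins.
split; first exact: residue_degree_gt1.
split=> //; first by move=> /D_disc; rewrite (negbTE p_D).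
exists [seq red_ideal q | q <- redmins]; rewrite size_map; split.
- by rewrite -size_redmins mulnK // residue_degree_gt0.
- move=> i hi; rewrite (nth_map 0) //.
  have /redminsP[j ->] := mem_nth 0 hi.
  by split; [exact: red_ideal_prime | exact: red_ideal_norm].
- move=> i j hi hj ij; rewrite !(nth_map 0) // => e.
  have /redminsP[i' ei] := mem_nth 0 hi; have /redminsP[j' ej] := mem_nth 0 hj.
  apply: ij; apply/eqP; rewrite -(nth_uniq 0 hi hj (undup_uniq _)); apply/eqP.
  by move: e; rewrite ei ej => /red_ideal_inj.
- exact: ideal_prod_redmins.
Qed.
End Nonsplit.

(** A splitting field of [f] mod [p] provides [k] and the root [beta]. *)
Lemma nonsplit_P_r : (forall p, p_dvd_disc L p -> (p%:Z %| D)%Z) ->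
  (forall c : int, ~~ (p%:Z %| f.[c])%Z) ->
  exists2 d, (d %| N)%N & (1 < d)%N /\ P_r L d p.
Proof.
move=> D_disc no_root.
have f0 : (map_poly intr f : {poly 'F_p}) != 0.
  by apply: monic_neq0; exact: monic_map.
have [k [rs ers _]] := FinSplittingFieldFor f0.
have [beta rb] : exists beta, beta \in rs.
  case: rs ers => [|c rs] ers; last by exists c; rewrite inE eqxx.
  have := eqp_size ers; rewrite big_nil size_poly1 size_map_poly.
  rewrite size_map_poly_id0 ?(size_int_minpoly f_prod); last first.
    by rewrite (monicP f_monic) oner_neq0.
  by move=> [] /eqP; rewrite -leqn0 leqNgt adim_gt0.
have root_beta : root (map_poly intr f : {poly k}) beta.
  by rewrite -map_poly_int_Fp (eqp_root ers) root_prod_XsubC.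
exact: (nonsplit_P_r_of_root root_beta no_root D_disc).
Qed.
End PrimeDecomposition.
(** * Ideal norms at primes without a root *)

Section IdealIndex.
Variable L : splittingFieldType rat.
Variable A : L -> Prop.
Hypothesis idA : is_ideal A.
Variables (n : nat) (rep : 'I_n -> L).
Hypothesis OK_rep : forall i, OK (rep i).
Hypothesis rep_inj : forall i j, A (rep i - rep j) -> i = j.
Hypothesis rep_surj : forall x, OK x -> exists i, A (x - rep i).

Let A0 : A 0. Proof. by case: idA. Qed.
Let AD x y : A x -> A y -> A (x + y). Proof. by case: idA => _ _ + _; apply. Qed.
Let AM c x : OK c -> A x -> A (c * x). Proof. by case: idA => _ _ _; apply. Qed.
Let AN x : A x -> A (- x).
Proof. by rewrite -mulN1r; apply: AM; exact/OKN/OK1. Qed.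
Let AB x y : A x -> A y -> A (x - y). Proof. by move=> ax /AN; exact: AD. Qed.

(** [d] is the value outside the domain, as ['I_n] has no canonical element. *)
Definition class_of (d : 'I_n) (x : L) : 'I_n :=
  match pselect (exists i, A (x - rep i)) with
  | left H => projT1 (cid H)
  | right _ => d
  end.

Lemma class_ofP d x : OK x -> A (x - rep (class_of d x)).
Proof.
by move=> ox; rewrite /class_of; case: pselect => [H|/(_ (rep_surj ox))//]; case: cid.
Qed.

Lemma translate_inj x : OK x -> injective (fun i => class_of i (rep i + x)).
Proof.
move=> ox i j e; apply: rep_inj.
have := AB (class_ofP i (OKD (OK_rep i) ox)) (class_ofP j (OKD (OK_rep j) ox)).
by rewrite e; congr A; ring.
Qed.

(* The regular representation of the additive quotient group by [A]. *)
Definition translate (x : L) : {perm 'I_n} :=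
  match pselect (OK x) with left H => perm (translate_inj H) | right _ => 1%g end.

Lemma translateP x i : OK x -> A (rep i + x - rep (translate x i)).
Proof.
move=> ox; rewrite /translate; case: pselect => // H; rewrite permE.
by apply: class_ofP; exact: OKD.
Qed.

Lemma translateM x y : OK x -> OK y -> translate (x + y) = (translate x * translate y)%g.
Proof.
move=> ox oy; apply/permP => i; rewrite permM; apply: rep_inj.
have := AB (AD (translateP i ox) (translateP (translate x i) oy)) (translateP i (OKD ox oy)).
by congr A; ring.
Qed.

(** The argument in ['I_n] is a point at which the two permutations are compared. *)
Lemma translate_eq x y : OK x -> OK y -> 'I_n -> translate x = translate y -> A (x - y).
Proof.
move=> ox oy i e; have := AB (translateP i ox) (translateP i oy).
by rewrite e; congr A; ring.
Qed.

Lemma eq_translate x y : OK x -> OK y -> A (x - y) -> translate x = translate y.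
Proof.
move=> ox oy a; apply/permP => i; apply: rep_inj.
have := AD (AB (translateP i oy) (translateP i ox)) a.
by congr A; ring.
Qed.

Lemma translate0 : translate 0 = 1%g.
Proof.
apply/permP => i; rewrite perm1; apply/esym/rep_inj.
by have := translateP i (OK0 L); rewrite addr0.
Qed.

Lemma translateX x m : OK x -> translate (m%:R * x) = (translate x ^+ m)%g.
Proof.
move=> ox; elim: m => [|m IH]; first by rewrite mul0r translate0 expg0.
rewrite -natr1 mulrDl mul1r translateM // ?IH ?expgSr //.
by apply: OKM => //; rewrite pmulrn; exact: OK_int.
Qed.

Definition quotient_group := [set translate (rep i) | i : 'I_n].

Lemma translate_in x : OK x -> translate x \in quotient_group.
Proof.
move=> ox; have [i hi] := rep_surj ox.
by apply/imsetP; exists i => //; exact: eq_translate.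
Qed.

Lemma group_set_quotient : 'I_n -> group_set quotient_group.
Proof.
move=> d; apply/group_setP; split; first by rewrite -translate0 translate_in //; exact: OK0.
move=> _ _ /imsetP[i _ ->] /imsetP[j _ ->].
by rewrite -translateM // translate_in //; exact: OKD.
Qed.

Lemma card_quotient_group : 'I_n -> #|quotient_group| = n.
Proof.
move=> d; rewrite card_imset ?card_ord // => i j /translate_eq e.
by apply: rep_inj; exact: e.
Qed.

(* If [p] divided the index exactly once, the [p]-torsion of the quotient would
   be cyclic, so [alpha] would act on it by an integer, a root of [f] mod [p]. *)
Lemma prime_sq_dvd_index (alpha : L) (f : {poly int}) p :
  OK alpha -> (map_poly intr f).[alpha] = 0 -> prime p ->
  (forall c : int, ~~ (p%:Z %| f.[c])%Z) -> (p %| n)%N -> (0 < n)%N -> (p ^ 2 %| n)%N.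
Proof.
move=> oa fa pp no_root pn n0.
have d : 'I_n by exact: (Ordinal n0).
pose G := Group (group_set_quotient d).
have cG : #|G| = n := card_quotient_group d.
have aG : abelian G.
  apply/centsP => _ /imsetP[i _ ->] _ /imsetP[j _ ->].
  by rewrite /commute -!translateM // addrC.
have pG : (p %| #|G|)%N by rewrite cG.
have [s sG os] := Cauchy pp pG.
have /imsetP[i _ es] := sG; set a := rep i in es.
have oka : OK a by exact: OK_rep.
have OKn m : OK (m%:R : L) by rewrite pmulrn; exact: OK_int.
have na : ~ A a.
  move=> Aa; have : s = 1%g by rewrite es -translate0; apply: eq_translate; rewrite ?subr0 //; exact: OK0.
  by move=> s1; move: os pp; rewrite s1 order1 => <-.
have pa : A (p%:R * a).
  rewrite -[X in A X]subr0; apply: (translate_eq _ _ d); rewrite ?translate0.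
  - exact: OKM.
  - exact: OK0.
  - by rewrite translateX // -es -os expg_order.
apply: contraT => np; exfalso.
have lp : logn p n = 1%N.
  apply/eqP; rewrite eqn_leq; apply/andP; split; last by rewrite logn_gt0 mem_primes pp n0.
  by rewrite leqNgt -pfactor_dvdn.
(* Since [p] divides the order of [G] exactly once, the subgroup generated by [s] is a Sylow
   subgroup; being normal, it contains every element of order dividing [p], in particular the class
   of [alpha * a]. *)
have hall : (p.-Hall(G) <[s]>)%g.
  by rewrite pHallE cycle_subG sG /= [#|_|]os cG p_part lp expn1.
have nor : normal <[s]>%g G by rewrite /normal cycle_subG sG sub_abelian_norm // cycle_subG.
have ya : translate (alpha * a) \in <[s]>%g.
  rewrite (mem_normal_Hall hall nor); last by apply: translate_in; exact: OKM.
  apply: (@pnat_dvd _ p); last exact: pnat_id.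
  rewrite order_dvdn -translateX; last exact: OKM.
  apply/eqP; rewrite -translate0; apply: eq_translate.
  - by apply: OKM => //; exact: OKM.
  - exact: OK0.
  - by rewrite subr0 mulrCA; exact: AM.
have /cycleP[m em] := ya.
have am : A (alpha * a - m%:R * a).
  by apply: (translate_eq _ _ d); [exact: OKM | exact: OKM | rewrite em es translateX].
have fm (h : {poly int}) : A ((map_poly intr h).[alpha] * a - (h.[m%:Z])%:~R * a).
  elim/poly_ind: h => [|h c IH]; first by rewrite rmorph0 !horner0 !mul0r subrr.
  rewrite rmorphD rmorphM /= map_polyX map_polyC !hornerMXaddC /= rmorphD rmorphM /=.
  have := AD (AM oa IH) (AM (OK_int L h.[m%:Z]) am).
  by rewrite -pmulrn; congr A; ring.
have := fm f; rewrite fa mul0r sub0r => /AN; rewrite opprK => fma.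
(* Both [p] and [f(m)] kill [a] modulo [A] and they are coprime, so [a] would lie in [A]. *)
have : coprimez p f.[m%:Z].
  rewrite coprimezE absz_nat prime_coprime //; exact: (no_root m%:Z).
move=> /coprimezP[[u v] /= euv]; apply: na.
have -> : a = u%:~R * (p%:R * a) + v%:~R * ((f.[m%:Z])%:~R * a).
  by rewrite !mulrA -mulrDl pmulrn -!rmorphM -rmorphD /= euv mul1r.
by apply: AD; apply: AM => //; exact: OK_int.
Qed.
End IdealIndex.

Lemma bK_prime_sq_dvd (L : splittingFieldType rat) (alpha : L) (f : {poly int}) p (z : int) :
  OK alpha -> (map_poly intr f).[alpha] = 0 -> prime p ->
  (forall c : int, ~~ (p%:Z %| f.[c])%Z) -> bK L z -> (p%:Z %| z)%Z ->
  ((p ^ 2)%N%:Z %| z)%Z.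
Proof.
move=> oa fa pp nr [z0 [A [[idA _] [rep [orep irep srep]]]]].
rewrite !dvdzE !absz_nat => pz.
apply: (prime_sq_dvd_index idA orep irep srep oa fa pp nr pz).
by rewrite absz_gt0 gt_eqF.
Qed.
(** * Chebyshev and Mertens estimates *)

Section PrimeSums.
Variable R : realType.
Implicit Types (n m k p : nat).

Lemma ln_nat_ge0 n : 0 <= ln (n%:R : R).
Proof.
case: n => [|n]; first by rewrite ln0.
by apply: ln_ge0; rewrite ler1n.
Qed.

Lemma ln_natM m n : (0 < m)%N -> (0 < n)%N ->
  ln ((m * n)%N%:R : R) = ln m%:R + ln n%:R.
Proof. by move=> m0 n0; rewrite natrM lnM // posrE ltr0n. Qed.

Lemma ler_ln_nat m n : (0 < m)%N -> (m <= n)%N -> ln (m%:R : R) <= ln n%:R.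
Proof.
move=> m0 mn; rewrite ler_ln ?posrE ?ltr0n ?ler_nat //; exact: leq_trans mn.
Qed.

Lemma ln_logn_sum n k : (0 < k)%N -> (k < n)%N ->
  ln (k%:R : R) = \sum_(0 <= p < n | prime p) (logn p k)%:R * ln p%:R.
Proof.
move=> k0; case: n => // n; rewrite ltnS => kn.
have {1}-> : k = (\prod_(0 <= p < n.+1 | prime p) p ^ logn p k)%N.
  rewrite -[LHS](partnT k0) (widen_partn _ kn).
  rewrite (bigID prime) /= [X in (_ * X)%N]big1 ?muln1; last first.
    by move=> p; rewrite /= lognE => /negbTE ->.
  by apply: eq_bigl => p.
suff [] : (0 < \prod_(0 <= p < n.+1 | prime p) p ^ logn p k)%N /\
   ln ((\prod_(0 <= p < n.+1 | prime p) p ^ logn p k)%N%:R : R) =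
    \sum_(0 <= p < n.+1 | prime p) (logn p k)%:R * ln p%:R by [].
elim/big_ind2: _ => [|x1 x2 y1 y2 [x10 Hx] [y10 Hy]|p pp]; first by rewrite ln1.
  by rewrite muln_gt0 x10 y10 ln_natM // Hx Hy.
rewrite expn_gt0 prime_gt0 //; split=> //.
by rewrite natrX lnXn ?ltr0n ?prime_gt0 // mulr_natl.
Qed.

Lemma logn_sum_le_ln n k : (0 < k)%N ->
  \sum_(0 <= p < n | prime p) (logn p k)%:R * ln p%:R <= ln (k%:R : R).
Proof.
move=> k0; rewrite (@ln_logn_sum (n + k.+1) k) ?ltn_addl //.
rewrite (@big_cat_nat _ _ _ n 0 (n + k.+1)) ?leq_addr //= lerDl.
by apply: sumr_ge0 => p _; rewrite mulr_ge0 ?ler0n ?ln_nat_ge0.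
Qed.

(** The two central coefficients of row [2m + 1] are equal, and their sum is at most
    [2 ^ (2m + 1)]. *)
Lemma bin_middle_le m : ('C(m.*2.+1, m) <= 4 ^ m)%N.
Proof.
have : ('C(m.*2.+1, m) + 'C(m.*2.+1, m.+1) <= 2 ^ m.*2.+1)%N.
  rewrite -[X in (X ^ _)%N]/(1 + 1)%N expnDn.
  rewrite -(big_mkord xpredT (fun i => 'C(m.*2.+1, i) * (1 ^ (m.*2.+1 - i) * 1 ^ i)))%N.
  rewrite (@big_cat_nat _ _ _ m 0) //=; last by rewrite -addnn; lia.
  rewrite (@big_ltn _ _ _ m); last by rewrite -addnn; lia.
  rewrite (@big_ltn _ _ _ m.+1); last by rewrite -addnn; lia.
  rewrite !exp1n !muln1; lia.
have -> : 'C(m.*2.+1, m.+1) = 'C(m.*2.+1, m).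
  have <- : (m.*2.+1 - m = m.+1)%N by rewrite -addnn; lia.
  by rewrite bin_sub // -addnn; lia.
by rewrite addnn -mul2n expnS leq_pmul2l // -mul2n expnM.
Qed.


Lemma fact_prime_ndvd n p : prime p -> (n < p)%N -> ~~ (p %| n`!)%N.
Proof.
move=> pp; elim: n => [|n IH] np; first by rewrite fact0 dvdn1; case: p pp {np} => [|[]].
rewrite factS Euclid_dvdM // negb_or IH ?andbT; last exact: ltnW.
by rewrite gtnNdvd.
Qed.

(** Such a prime divides [(2m + 1)!] but neither [m!] nor [(m + 1)!]. *)
Lemma logn_bin_middle m p : prime p -> (m.+1 < p <= m.*2.+1)%N ->
  (0 < logn p 'C(m.*2.+1, m))%N.
Proof.
move=> pp /andP[mp pm].
have h : ('C(m.*2.+1, m) * (m`! * (m.*2.+1 - m)`!) = (m.*2.+1)`!)%N.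
  by rewrite bin_fact // -addnn; lia.
have : (p %| (m.*2.+1)`!)%N by rewrite dvdn_fact // pm prime_gt0.
rewrite -h Euclid_dvdM // => /orP[H|].
  by rewrite logn_gt0 mem_primes pp bin_gt0 H andbT -addnn; lia.
have -> : (m.*2.+1 - m = m.+1)%N by rewrite -addnn; lia.
by rewrite Euclid_dvdM // (negbTE (fact_prime_ndvd pp mp)) orbF
   (negbTE (fact_prime_ndvd pp (ltnW mp))).
Qed.

(** Induction of Erdos: an even [n > 2] is not prime; for [n = 2m + 1] the primes above [m + 1]
    divide a binomial coefficient at most [4 ^ m], and the others are covered by the case
    [m + 1]. *)
Lemma chebyshev_theta n :
  \sum_(0 <= p < n.+1 | prime p) ln (p%:R : R) <= n%:R * ln 4%:R.
Proof.
have ln40 : 0 <= ln (4%:R : R) by exact: ln_nat_ge0.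
elim/ltn_ind: n => n IH.
have [n2|n3] := leqP n 2.
  case: n n2 {IH} => [|[|[|//]]] _; rewrite unlock /= ?addr0 ?mul0r ?mul1r //.
  apply: (@le_trans _ _ (ln 4%:R)); first exact: ler_ln_nat.
  by rewrite mulr_natl mulr2n lerDl.
case/boolP: (odd n) => on; last first.
  rewrite big_mkcond big_nat_recr //= -big_mkcond ifF; last first.
    apply/negbTE; apply: contra on => pn; case: (even_prime pn) => // h.
    by rewrite h in n3.
  rewrite addr0; case: n IH n3 {on} => // n IH n3.
  apply: le_trans (IH n _) _ => //.
  by rewrite ler_wpM2r // ler_nat.
set m := n./2; have en : n = m.*2.+1 by rewrite -[LHS]odd_double_half on.
have m0 : (0 < m)%N by move: n3; rewrite en -addnn; lia.
rewrite (@big_cat_nat _ _ _ m.+2 0) //=; last by rewrite en -addnn; lia.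
have -> : n%:R * ln (4%:R : R) = m.+1%:R * ln 4%:R + m%:R * ln 4%:R.
  by rewrite -mulrDl -natrD en -addnn addSn.
apply: lerD; first by apply: IH; rewrite en -addnn; lia.
have -> : m%:R * ln (4%:R : R) = ln ((4 ^ m)%N%:R).
  by rewrite natrX lnXn // mulr_natl.
have b0 : (0 < 'C(m.*2.+1, m))%N by rewrite bin_gt0 -addnn; lia.
apply: le_trans (ler_ln_nat b0 (bin_middle_le m)).
apply: le_trans (logn_sum_le_ln n.+1 b0).
rewrite [X in _ <= X](@big_cat_nat _ _ _ m.+2 0) //=; last by rewrite en -addnn; lia.
rewrite -[X in X <= _]add0r; apply: lerD.
  by apply: sumr_ge0 => p _; rewrite mulr_ge0 ?ler0n ?ln_nat_ge0.
rewrite big_nat_cond [X in _ <= X]big_nat_cond; apply: ler_sum => p /andP[/andP[mp pn] pp].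
rewrite ler_peMl ?ln_nat_ge0 // ler1n; apply: logn_bin_middle => //.
by rewrite mp -ltnS -en.
Qed.

Lemma ln_succ_le n : (0 < n)%N -> ln (n.+1%:R : R) - ln n%:R <= n%:R^-1.
Proof.
move=> n0; have n0' : 0 < (n%:R : R) by rewrite ltr0n.
rewrite -ln_div ?posrE ?ltr0n //.
have -> : (n.+1%:R : R) / n%:R = 1 + n%:R^-1.
  by rewrite -natr1 mulrDl divff ?gt_eqF // mul1r.
by apply: le_ln1Dx; apply: lt_le_trans (_ : 0 <= _); rewrite ?ltrN10 ?invr_ge0 ?ltW.
Qed.

Lemma ln_fact_ge n : n%:R * ln n%:R - n%:R <= ln (n`!%:R : R).
Proof.
elim: n => [|n IH]; first by rewrite mul0r subr0 ln_nat_ge0.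
rewrite factS ln_natM ?fact_gt0 //.
case: n IH => [|n] IH; first by rewrite ln1; lra.
have := ln_succ_le (ltn0Sn n) ; set u := ln n.+2%:R; set v := ln _ => h.
have h2 : n.+1%:R * (u - v) <= 1.
  by rewrite mulrC -ler_pdivlMr ?ltr0n // div1r.
have e : (n.+2%:R : R) = n.+1%:R + 1 by rewrite natr1.
rewrite -/v in IH; move: IH h2; rewrite e; lra.
Qed.

Lemma ln_fact_le n : ln (n`!%:R : R) <= n%:R * ln n%:R.
Proof.
rewrite mulr_natl; case: n => [|n]; first by rewrite ln1 mulr0n.
rewrite -lnXn ?ltr0n // -natrX; apply: ler_ln_nat; first exact: fact_gt0.
elim: n.+1 => // m IH; rewrite factS expnS leq_mul //.
apply: leq_trans IH _; case: m => // m; rewrite leq_exp2r // leqnSn.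
Qed.

(** Legendre's formula: multiplied by [p - 1], the sum of the [n %/ p ^ k] telescopes, with
    [n %/ p ^ m] left over after [m] terms. *)
Lemma logn_fact_le n p : prime p -> (logn p n`! * p.-1 <= n)%N.
Proof.
move=> pp; rewrite logn_fact //.
have p0 := prime_gt0 pp.
suff H m : ((\sum_(1 <= k < m.+1) n %/ p ^ k) * p.-1 + n %/ p ^ m <= n)%N.
  by apply: leq_trans (H n); rewrite leq_addr.
elim: m => [|m IH]; first by rewrite big_geq // mul0n add0n expn0 divn1.
rewrite big_nat_recr //= mulnDl -addnA; apply: leq_trans IH; rewrite leq_add2l.
by rewrite -mulnSr prednK // expnSr divnMA leq_divM.
Qed.

Lemma logn_fact_ge n p : prime p -> (n %/ p <= logn p n`!)%N.
Proof.
move=> pp; rewrite logn_fact //; case: n => [|n]; first by rewrite div0n.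
by rewrite big_ltn // expn1 leq_addr.
Qed.

(** Termwise comparison with the differences of [G k = (ln k + 2) / k]; the bound is [G 1]. *)
Lemma sum_ln_div_telescope n :
  \sum_(2 <= k < n) ln (k%:R : R) / (k%:R * (k%:R - 1)) <= 2.
Proof.
pose G (k : nat) : R := (ln k%:R + 2) / k%:R.
have step k : (2 <= k)%N -> ln (k%:R : R) / (k%:R * (k%:R - 1)) <= G k.-1 - G k.
  case: k => [|[|k]] // _; rewrite /G /=.
  have := ln_succ_le (ltn0Sn k).
  set u := ln k.+2%:R; set v := ln _; rewrite -[k.+2%:R]natr1.
  set x : R := k.+1%:R; have x1 : 1 <= x by rewrite ler1n.
  have x0 : x != 0 by rewrite pnatr_eq0.
  have x10 : x + 1 != 0 by lra.
  move=> h; rewrite -subr_ge0 addrK; clearbody x.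
  have -> : (v + 2) / x - (u + 2) / (x + 1) - u / ((x + 1) * x) =
      (2 - (x + 1) * (u - v)) / (x * (x + 1)) by field; rewrite x0 x10.
  rewrite divr_ge0 //; last by rewrite mulr_ge0; lra.
  rewrite subr_ge0; apply: (@le_trans _ _ ((x + 1) * x^-1)).
    by rewrite ler_wpM2l //; lra.
  rewrite mulrDl mulfV // mul1r -[2]/(1 + 1) lerD2l invf_le1 //; lra.
have [n2|n2] := leqP n 2; first by rewrite big_geq.
apply: (@le_trans _ _ (\sum_(2 <= k < n) (G k.-1 - G k))).
  by apply: ler_sum_nat => k /andP[k2 _]; exact: step.
have -> : \sum_(2 <= k < n) (G k.-1 - G k) = G 1 - G n.-1.
  case: n n2 => [|[|n]] // _; rewrite big_add1 /= -opprB -telescope_sumr // -sumrN.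
  by apply: eq_bigr => i _; rewrite opprB.
rewrite /G ln1 add0r divr1 gerBl divr_ge0 ?ler0n //.
by rewrite addr_ge0 ?ln_nat_ge0.
Qed.


Lemma ln_fact_sum n :
  ln (n`!%:R : R) = \sum_(0 <= p < n.+1 | prime p) (logn p n`!)%:R * ln p%:R.
Proof.
apply/eqP; rewrite eq_le logn_sum_le_ln ?fact_gt0 // andbT.
rewrite (@ln_logn_sum (n.+1 + n`!.+1) _) ?fact_gt0 //; last by rewrite addnS ltnS leq_addl.
rewrite (@big_cat_nat _ _ _ n.+1 0 (n.+1 + n`!.+1)) ?leq_addr //=.
rewrite [X in _ + X]big_nat_cond [X in _ + X]big1 ?addr0 //.
move=> p /andP[/andP[np _] pp]; have := fact_prime_ndvd pp np.
by rewrite lognE pp fact_gt0 /= => /negbTE ->; rewrite mul0r.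
Qed.

(** Legendre's formula bounds [ln n!] by [n] times the sum of [ln p / (p - 1)], at the cost of [1]
    from [ln_fact_ge]. Replacing [p - 1] by [p] costs at most [2]. *)
Lemma mertens_lower n : (0 < n)%N ->
  ln (n%:R : R) - 3 <= \sum_(0 <= p < n.+1 | prime p) ln p%:R / p%:R.
Proof.
move=> n0; have n0' : 0 < (n%:R : R) by rewrite ltr0n.
have h1 : ln (n%:R : R) - 1 <= \sum_(0 <= p < n.+1 | prime p) ln p%:R / (p%:R - 1).
  rewrite -(ler_pM2l n0') mulrBr mulr1; apply: le_trans (ln_fact_ge n) _.
  rewrite ln_fact_sum mulr_sumr; apply: ler_sum => p pp.
  rewrite mulrCA mulrC ler_wpM2l ?ln_nat_ge0 //.
  have p1 : 0 < (p%:R - 1 : R) by rewrite subr_gt0 ltr1n prime_gt1.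
  rewrite ler_pdivlMr // -[1]/(1%:R) -natrB ?prime_gt0 // -natrM ler_nat subn1.
  exact: logn_fact_le.
have h2 : \sum_(0 <= p < n.+1 | prime p) ln (p%:R : R) / (p%:R - 1) =
   \sum_(0 <= p < n.+1 | prime p) ln p%:R / p%:R +
   \sum_(0 <= p < n.+1 | prime p) ln (p%:R : R) / (p%:R * (p%:R - 1)).
  rewrite -big_split; apply: eq_bigr => p pp /=.
  have p1 : (p%:R - 1 : R) != 0 by rewrite gt_eqF // subr_gt0 ltr1n prime_gt1.
  have p0 : (p%:R : R) != 0 by rewrite pnatr_eq0 -lt0n prime_gt0.
  by field; rewrite p0 p1.
have h3 : \sum_(0 <= p < n.+1 | prime p) ln (p%:R : R) / (p%:R * (p%:R - 1)) <= 2.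
  apply: le_trans (sum_ln_div_telescope n.+1).
  have [n1|n2] := ltnP n.+1 2; first by case: n n0 n1 {n0' h1 h2}.
  rewrite (@big_cat_nat _ _ _ 2 0) //= [X in X + _]big_nat_cond [X in X + _]big1 ?add0r.
    rewrite big_mkcond; apply: ler_sum_nat => k /andP[k2 _]; case: ifP => // _.
    by rewrite divr_ge0 ?ln_nat_ge0 // mulr_ge0 ?ler0n // subr_ge0 ler1n ltnW.
  by case=> [|[|//]].
lra.
Qed.

(** The multiplicity of [p] in [n!] exceeds [n / p - 1]; Chebyshev's bound takes care of the terms
    [-1]. *)
Lemma mertens_upper n : (0 < n)%N ->
  \sum_(0 <= p < n.+1 | prime p) ln (p%:R : R) / p%:R <= ln n%:R + ln 4%:R.
Proof.
move=> n0; have n0' : 0 < (n%:R : R) by rewrite ltr0n.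
rewrite -(ler_pM2l n0') mulrDr.
have := ln_fact_le n; have := chebyshev_theta n => h1 h2.
apply: le_trans (lerD h2 h1); rewrite ln_fact_sum -big_split mulr_sumr.
apply: ler_sum => p pp /=; rewrite -[X in _ + X]mul1r -mulrDl mulrCA mulrC.
rewrite ler_wpM2r ?ln_nat_ge0 //.
have p0 : 0 < (p%:R : R) by rewrite ltr0n prime_gt0.
rewrite ler_pdivrMr // natr1 -natrM ler_nat.
apply: ltnW; apply: leq_trans (_ : (n %/ p).+1 * p <= _)%N.
  by rewrite ltn_ceil // prime_gt0.
by rewrite leq_mul // ltnS logn_fact_ge.
Qed.

(* Abel summation against the decreasing weight [1 / ln]. *)
Lemma sum_inv_lower (a : nat -> R) (c C : R) :
  0 <= c -> 0 <= C -> (forall n, 0 <= a n) -> a 0%N = 0 -> a 1%N = 0 ->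
  (forall n, (0 < n)%N ->
     c * ln n%:R - C <= \sum_(0 <= k < n.+1) a k * ln k%:R) ->
  forall z, (2 <= z)%N ->
  c * ln (ln z%:R) - (c * ln (ln 3) + C / ln 2) <= \sum_(0 <= k < z.+1) a k.
Proof.
move=> c0 C0 a0 a00 a10 H.
pose A n := \sum_(0 <= k < n.+1) a k * ln (k%:R : R).
have ln2 : 0 < ln (2 : R) by rewrite ln_gt0 // ltr1n.
have lnk k : (2 <= k)%N -> 0 < ln (k%:R : R).
  by move=> k2; rewrite ln_gt0 // ltr1n.
have AH n : (0 < n)%N -> 0 <= A n - (c * ln n%:R - C).
  by move=> n0; rewrite subr_ge0; exact: H.
(* Strengthened for the induction: the boundary term of the Abel summation is kept and the double
   logarithm is taken one step ahead. The base case [z = 2] accounts for [ln (ln 3)] and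
   [C / ln 2]. *)
suff I z : (2 <= z)%N -> c * ln (ln z.+1%:R) - (c * ln (ln 3) + C / ln 2)
    + (A z - (c * ln z%:R - C)) / ln z%:R <= \sum_(0 <= k < z.+1) a k.
  move=> z z2; apply: le_trans (I z z2); rewrite -[X in X <= _]addr0 lerD //.
    rewrite lerD2r ler_wpM2l // ler_ln ?posrE ?lnk ?(leqW z2) //.
    by apply: ler_ln_nat => //; exact: ltnW.
  by apply: divr_ge0; [apply/AH/ltnW | apply/ltW/lnk].
elim: z => // z IH; rewrite ltnS leq_eqVlt => /predU1P[<-|z2].
  rewrite /A unlock /= a00 a10 !mul0r !add0r !addr0.
  have -> : (a 2%N * ln 2%:R - (c * ln 2%:R - C)) / ln (2%:R : R) = a 2%N - c + C / ln 2.
    by field; rewrite gt_eqF.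
  lra.
have {IH} := IH z2.
have uz := lnk _ z2; have uz1 := lnk _ (leqW z2).
have -> : A z.+1 = A z + a z.+1 * ln z.+1%:R by rewrite /A big_nat_recr.
rewrite [in X in _ -> _ <= X]big_nat_recr //=.
have := AH z (ltnW z2).
have le_uv : ln (z%:R : R) <= ln z.+1%:R by apply: ler_ln_nat => //; exact: ltnW.
(* The increments of [ln] decrease, because [z (z + 2) <= (z + 1) ^ 2]. *)
have lnln : ln (ln z.+2%:R) - ln (ln z.+1%:R) <= (ln z.+1%:R - ln z%:R) / ln (z.+1%:R : R).
  have h2 : ln (z.+2%:R : R) + ln z%:R <= ln z.+1%:R + ln z.+1%:R.
    have z0 := ltnW z2; rewrite -!ln_natM //; apply: ler_ln_nat.
      by rewrite muln_gt0.
    nia.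
  have h3 : ln (z.+1%:R : R) <= ln z.+2%:R by exact: ler_ln_nat.
  apply: (@le_trans _ _ ((ln z.+2%:R - ln z.+1%:R) / ln z.+1%:R)); last first.
    by rewrite ler_wpM2r ?invr_ge0 ?(ltW uz1) //; lra.
  have uz2 : 0 < ln (z.+2%:R : R) by exact: lnk.
  rewrite -ln_div ?posrE //.
  have -> : ln z.+2%:R / ln z.+1%:R = 1 + (ln z.+2%:R - ln z.+1%:R) / ln (z.+1%:R : R).
    by rewrite mulrBl divff ?gt_eqF // addrC subrK.
  apply: le_ln1Dx; apply: lt_le_trans (_ : 0 <= _); rewrite ?ltrN10 //.
  by rewrite divr_ge0 ?subr_ge0 // ltW.
move: (\sum_(0 <= k < z.+1) a k) => Sz.
have lninv : (ln (z.+1%:R : R))^-1 <= (ln z%:R)^-1 by rewrite lef_pV2.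
move: (ler_wpM2l c0 lnln); move: lninv uz uz1.
move: (ln (ln z.+2%:R)) (ln (ln z.+1%:R)) (A z) (a z.+1).
move: (ln (z%:R : R)) (ln (z.+1%:R : R)) (c * ln (ln 3) + C / ln 2).
move=> l l' K x y w b iv l0 l'0 h D I1.
have -> : (w + b * l' - (c * l' - C)) / l' =
    (w - (c * l - C)) / l' - c * ((l' - l) / l') + b by field; rewrite gt_eqF.
have := ler_wpM2l D iv; lra.
Qed.
End PrimeSums.
(** * Density of the split primes *)

Section SplitPrimes.
Variable N : nat.
Hypothesis N0 : (0 < N)%N.
Variable f : {poly int}.
Hypothesis f_monic : f \is monic.
Hypothesis size_f : size f = N.+1.
Hypothesis f_irr : forall g h q : {poly int}, (size g <= N)%N -> (size h <= N)%N ->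
  g * h = q * f -> g = 0 \/ h = 0.
Local Notation rmodp := Pdiv.Ring.rmodp.

Definition splits (p : nat) : Prop := exists r : 'I_N -> int,
  (forall i, (p%:Z %| f.[r i])%Z) /\
  (forall i j, i != j -> ~~ (p%:Z %| r i - r j)%Z).

(* Matrix of the multiplication by [h] on [Z[X] / f], so that its determinant is
   a norm. *)
Definition mulmod_mx (h : {poly int}) : 'M[int]_N :=
  \matrix_(i < N, j < N) (rmodp ('X^i * h) f)`_j.

Lemma size_rmodp_f h : (size (rmodp h f) <= N)%N.
Proof. by rewrite -ltnS -size_f Pdiv.Ring.ltn_rmodpN0 // monic_neq0. Qed.

(** A vector killed by the matrix is a polynomial [g] such that [f] divides [g h], and [f_irr]
    applies. *)
Lemma mulmod_det_neq0 (h : {poly int}) : (size h <= N)%N -> h != 0 -> \det (mulmod_mx h) != 0.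
Proof.
move=> sh; apply: contraNneq => /eqP/det0P[v v0 vB].
pose g : {poly int} := \sum_(i < N) v 0 i *: 'X^i.
have cg (i : 'I_N) : g`_i = v 0 i.
  rewrite coef_sum (bigD1 i) //= coefZ coefXn eqxx mulr1 big1 ?addr0 // => j ji.
  by rewrite coefZ coefXn -val_eqE eq_sym /= in ji *; rewrite (negbTE ji) mulr0.
have sg : (size g <= N)%N.
  apply: leq_trans (size_sum _ _ _) _; apply/bigmax_leqP => i _.
  by apply: leq_trans (size_scale_leq _ _) _; rewrite size_polyXn ltn_ord.
have r0 : rmodp (g * h) f = 0.
  apply/polyP => j; rewrite coef0; case: (ltnP j N) => jN; last first.
    by rewrite nth_default // (leq_trans (size_rmodp_f _)).
  have := congr1 (fun M : 'rV_N => M 0 (Ordinal jN)) vB; rewrite /= !mxE => e0; rewrite -[RHS]e0.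
  rewrite mulr_suml (Pdiv.RingMonic.rmodp_sum f_monic) coef_sum.
  apply: eq_bigr => i _; rewrite mxE -scalerAl.
  by rewrite (Pdiv.RingMonic.rmodpZ f_monic) coefZ.
have e := Pdiv.RingMonic.rdivp_eq f_monic (g * h); rewrite r0 addr0 in e.
have [g0|-> //] := f_irr sg sh e.
by case/eqP: v0; apply/rowP => i; rewrite mxE -cg g0 coef0.
Qed.

(** The entries are linear in the coefficients of [h], with factors depending only on [f], and the
    determinant is homogeneous of degree [N] in the entries. *)
Lemma mulmod_det_bound : exists c : nat, (0 < c)%N /\
  forall (X : nat) (h : {poly int}), (0 < X)%N -> (size h <= N)%N ->
    (forall i, `|h`_i| <= X%:Z) -> (absz (\det (mulmod_mx h))%R <= c * X ^ N)%N.
Proof.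
pose E := (\sum_(i < N) \sum_(k < N) \sum_(j < N) absz (nth (0 : int)%R (rmodp 'X^(i + k)%N f)%R j))%N.
have boundE (i k j : 'I_N) : (absz (nth (0 : int)%R (rmodp 'X^(i + k)%N f)%R j) <= E)%N.
  rewrite /E (bigD1 i) //= (bigD1 k) //= (bigD1 j) //=.
  by rewrite -!addnA leq_addr.
exists (N`! * (N * E.+1) ^ N)%N; split.
  by rewrite muln_gt0 fact_gt0 expn_gt0 muln_gt0 N0.
move=> X h X0 sh hX.
have ent (i j : 'I_N) : (absz (mulmod_mx h i j)%R <= N * E.+1 * X)%N.
  have eh : h = \sum_(k < N) h`_k *: 'X^k.
    rewrite -{1}[h]coefK poly_def (big_ord_widen N (fun k => h`_k *: 'X^k)) //.
    rewrite [RHS](bigID (fun k : 'I_N => (k < size h)%N)) /= [X in _ + X]big1 ?addr0 //.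
    by move=> k; rewrite -leqNgt => /(nth_default 0) ->; rewrite scale0r.
  have -> : mulmod_mx h i j = \sum_(k < N) h`_k * (rmodp ('X^(i + k)%N) f)`_j.
    rewrite mxE {1}eh mulr_sumr (Pdiv.RingMonic.rmodp_sum f_monic) coef_sum.
    apply: eq_bigr => k _.
    by rewrite -scalerAr (Pdiv.RingMonic.rmodpZ f_monic) coefZ exprD.
  have := ler_norm_sum (index_enum 'I_N) (fun k : 'I_N => h`_k * (rmodp ('X^(i + k)%N) f)`_j) xpredT.
  move=> H; rewrite -lez_nat abszE; apply: le_trans H _.
  apply: (@le_trans _ _ (\sum_(k < N) (E.+1 * X)%N%:Z)); last first.
    by rewrite sumr_const card_ord -mulr_natl natz -PoszM mulnA.
  apply: ler_sum => k _; rewrite -abszE lez_nat abszM mulnC.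
  by rewrite leq_mul //; [rewrite ltnW // ltnS boundE | rewrite -lez_nat abszE hX].
rewrite -lez_nat abszE; apply: le_trans (ler_norm_sum _ _ _) _.
apply: (@le_trans _ _ (\sum_(s : 'S_N) ((N * E.+1 * X) ^ N)%N%:Z)); last first.
  rewrite sumr_const card_Sn -mulr_natl natz -PoszM lez_nat.
  by rewrite expnMn mulnA.
apply: ler_sum => s _; rewrite normrM normrX normrN1 expr1n mul1r normr_prod.
apply: (@le_trans _ _ (\prod_(i < N) (N * E.+1 * X)%N%:Z)).
  by apply: ler_prod => i _; rewrite normr_ge0 -abszE lez_nat ent.
by rewrite prodr_const card_ord -!natz natrX.
Qed.

(** Modulo [p], multiplying by the Vandermonde matrix of the roots evaluates the rows at the roots:
    each root of [h] makes a whole column divisible by [p]. The Vandermonde determinant is prime to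
    [p]. *)
Lemma split_logn_det p (r : 'I_N -> int) (h : {poly int}) :
  prime p -> (forall i, (p%:Z %| f.[r i])%Z) ->
  (forall i j, i != j -> ~~ (p%:Z %| r i - r j)%Z) -> \det (mulmod_mx h) != 0 ->
  (#|[pred l | (p%:Z %| h.[r l])%Z]| <= logn p `|\det (mulmod_mx h)|)%N.
Proof.
move=> pp fr rr dn0; set K := [pred l | _].
pose V := Vandermonde N (\row_(l < N) r l).
pose W := mulmod_mx h *m V.
have pW i l : l \in K -> (p%:Z %| W i l)%Z.
  rewrite inE => ph.
  have e := Pdiv.RingMonic.rdivp_eq f_monic ('X^i * h).
  have -> : W i l = (rmodp ('X^i * h) f).[r l].
    rewrite (@horner_coef_wide _ N) ?size_rmodp_f // mxE.
    by apply: eq_bigr => j _; rewrite !mxE.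
  have -> : rmodp ('X^i * h) f = 'X^i * h - Pdiv.Ring.rdivp ('X^i * h) f * f.
    by rewrite {2}e addrC addKr.
  rewrite hornerD hornerN !hornerM; apply: rpredB.
    exact: dvdz_mull.
  by apply: dvdz_mull; exact: fr.
pose d : 'rV[int]_N := \row_l (if l \in K then p%:Z else 1).
pose W' : 'M[int]_N := \matrix_(i, l) (if l \in K then (W i l %/ p%:Z)%Z else W i l).
have eW : W = W' *m diag_mx d.
  apply/matrixP => i l; rewrite mul_mx_diag [RHS]mxE [W' _ _]mxE [d _ _]mxE.
  by case: ifP => lK; rewrite ?mulr1 // divzK // pW.
have dd : \det (diag_mx d) = (p ^ #|K|)%N%:Z.
  rewrite det_diag (bigID (fun l => l \in K)) /= [X in _ * X]big1 ?mulr1; last first.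
    by move=> l lK; rewrite mxE (negbTE lK).
  rewrite (eq_bigr (fun=> p%:Z)); last by move=> l lK; rewrite mxE lK.
  by rewrite prodr_const -!natz natrX.
have cop : coprimez (p ^ #|K|)%N (\det V).
  rewrite coprimezE absz_nat coprimeXl // prime_coprime //.
  rewrite det_Vandermonde; elim/big_ind: _ => [|x y px py|i _].
  - by rewrite absz1 Euclid_dvd1.
  - by rewrite abszM Euclid_dvdM // negb_or px.
  elim/big_ind: _ => [|x y px py|j ij].
  - by rewrite absz1 Euclid_dvd1.
  - by rewrite abszM Euclid_dvdM // negb_or px.
  have := rr j i; rewrite !mxE dvdzE absz_nat; apply.
  by rewrite -val_eqE /= gtn_eqF.
rewrite -pfactor_dvdn ?absz_gt0 //.
have : ((p ^ #|K|)%N%:Z %| \det (mulmod_mx h) * \det V)%Z.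
  by rewrite -det_mulmx -/W eW det_mulmx dd dvdz_mull.
by rewrite Gauss_dvdzl // dvdzE absz_nat.
Qed.

Variable R : realType.

(** Cauchy-Schwarz, as the nonnegativity of the variance of the sizes of the fibres of [g]. *)
Lemma sum_collisions_ge (T C : finType) (g : T -> C) : (0 < #|C|)%N ->
  (#|T|%:R ^+ 2 : R) / #|C|%:R <= \sum_(u : T) \sum_(v : T) (g u == g v)%:R.
Proof.
move=> C0; have C0' : 0 < (#|C|%:R : R) by rewrite ltr0n.
pose n c : R := #|[pred u | g u == c]|%:R.
have sn : \sum_c n c = #|T|%:R.
  rewrite -natr_sum; congr _%:R.
  rewrite -sum1_card (partition_big g xpredT) //=.
  by apply: eq_bigr => c _; rewrite -sum1_card; apply: eq_bigl => u; rewrite inE.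
have -> : \sum_(u : T) \sum_(v : T) (g u == g v)%:R = \sum_c n c ^+ 2.
  rewrite (partition_big g xpredT) //=; apply: eq_bigr => c _.
  rewrite (eq_bigr (fun=> n c)); last first.
    move=> u /eqP ->; rewrite -natr_sum; congr _%:R.
    rewrite -sum1_card [RHS]big_mkcond; apply: eq_bigr => v _.
    by rewrite inE eq_sym; case: eqP.
  by rewrite sumr_const expr2 -[LHS]mulr_natr.
have : 0 <= \sum_c (n c - #|T|%:R / #|C|%:R) ^+ 2.
  by apply: sumr_ge0 => c _; exact: sqr_ge0.
under eq_bigr do rewrite sqrrB.
rewrite big_split /= sumrB sumrMnl -mulr_suml sn sumr_const -[X in _ + X]mulr_natl.
suff -> : #|C|%:R * (#|T|%:R / #|C|%:R : R) ^+ 2 = #|T|%:R ^+ 2 / #|C|%:R.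
  by rewrite mulrA -expr2 mulr2n; lra.
by field; rewrite gt_eqF.
Qed.

(** [insub] turns the index of a coefficient into an ordinal; below [N] its default [0] is never
    reached. *)
Definition box_poly (X : nat) (u : {ffun 'I_N -> 'I_X}) : {poly int} :=
  \poly_(i < N) (if insub i is Some i' then (u i' : nat)%:Z else 0).

Lemma coef_box_poly X (u : {ffun 'I_N -> 'I_X}) (i : 'I_N) : (box_poly u)`_i = (u i : nat)%:Z.
Proof. by rewrite coef_poly ltn_ord valK. Qed.

Lemma box_poly_inj X : injective (@box_poly X).
Proof.
move=> u v e; apply/ffunP => i; apply/val_inj.
by have := congr1 (fun s : {poly int} => s`_i) e; rewrite !coef_box_poly => -[].
Qed.

Lemma size_box_polyB X (u v : {ffun 'I_N -> 'I_X}) : (size (box_poly u - box_poly v)%R <= N)%N.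
Proof.
by apply: leq_trans (size_polyD _ _) _; rewrite size_polyN geq_max !size_poly.
Qed.

Lemma coef_box_polyB X (u v : {ffun 'I_N -> 'I_X}) i :
  `|(box_poly u - box_poly v)`_i| <= X%:Z.
Proof.
rewrite coefB; case: (ltnP i N) => iN; last first.
  by rewrite !nth_default ?subrr ?normr0 // (leq_trans (size_poly _ _) iN).
rewrite -[i]/(nat_of_ord (Ordinal iN)) !coef_box_poly.
have := ltn_ord (u (Ordinal iN)); have := ltn_ord (v (Ordinal iN)); lia.
Qed.

(** [X] is the least integer with [Y <= X ^ N]. Unless [X = 1], it is at most [2 (X - 1)], which
    gives the factor [2 ^ N]. *)
Lemma root_ceil Y : (0 < Y)%N ->
  exists X, [/\ (0 < X)%N, (Y <= X ^ N)%N & (X ^ N <= 2 ^ N * Y)%N].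
Proof.
move=> Y0; have ex : exists X, (Y <= X ^ N)%N.
  by exists Y; rewrite -{1}[Y]expn1 leq_pexp2l.
have [m hm hmin] := ex_minnP ex; exists m.
have m0 : (0 < m)%N by rewrite lt0n; apply: contraTneq hm => ->; rewrite exp0n // -ltnNge.
split=> //; case: m m0 hm hmin => [//|[|m]] _ hm hmin.
  by rewrite exp1n muln_gt0 expn_gt0 Y0.
have lt : (m.+1 ^ N < Y)%N by rewrite ltnNge; apply/negP => /hmin; rewrite ltnn.
apply: (@leq_trans (2 ^ N * m.+1 ^ N)%N); last by rewrite leq_mul2l ltnW ?orbT.
by rewrite -expnMn leq_exp2r // mul2n -addnn addSn ltnS addnS ltnS leq_addr.
Qed.

Theorem split_primes_sum : exists C : R, forall Y, (0 < Y)%N ->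
  \sum_(0 <= p < Y.+1 | prime p && `[< splits p >]) ln (p%:R : R) / p%:R
    <= N%:R^-1 * ln Y%:R + C.
Proof.
have [c [c0 Hc]] := mulmod_det_bound.
have NR0 : 0 < (N%:R : R) by rewrite ltr0n.
exists (ln 2 + ln c%:R / N%:R + ln 4) => Y Y0.
have [X [X0 YX XY]] := root_ceil Y0.
pose T := {ffun 'I_N -> 'I_X}.
have cT : #|{: T}| = (X ^ N)%N by rewrite card_ffun !card_ord.
have B0 : 0 < ((X ^ N)%N%:R : R) by rewrite ltr0n expn_gt0 X0.
set B : R := (X ^ N)%N%:R in B0.
set Q := fun p => prime p && `[< splits p >].
set S := \sum_(0 <= p < Y.+1 | Q p) _.
pose r p : 'I_N -> int :=
  match pselect (splits p) with left H => projT1 (cid H) | right _ => fun=> 0 end.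
have rP p : Q p -> (forall i, (p%:Z %| f.[r p i])%Z) /\
  (forall i j, i != j -> ~~ (p%:Z %| r p i - r p j)%Z).
  move=> /andP[_ /asboolP sp]; rewrite /r; case: pselect => // H.
  by case: cid.
pose dt (u v : T) := \det (mulmod_mx (box_poly u - box_poly v)).
have dt0 u v : u != v -> dt u v != 0.
  move=> uv; apply: mulmod_det_neq0; first exact: size_box_polyB.
  by rewrite subr_eq0; apply: contra uv => /eqP/box_poly_inj ->.
pose hit (u v : T) p l : R := (p%:Z %| (box_poly u - box_poly v).[r p l])%Z%:R.
(* On the diagonal all [N] roots are hit, and the subtracted [N] cancels them. *)
have low u v : \sum_(0 <= p < Y.+1 | Q p) ln p%:R * ((\sum_l hit u v p l) - N%:R * (u == v)%:R)
    <= (if u == v then 0 else ln (`|dt u v|%N%:R : R)).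
  case: eqP => [->|/eqP uv].
    rewrite big1 // => p _; rewrite /hit subrr.
    by under eq_bigr do rewrite horner0 dvdz0; rewrite sumr_const card_ord mulr1 subrr mulr0.
  rewrite mulr0; under eq_bigr do rewrite subr0.
  have dp : (0 < `|dt u v|)%N by rewrite absz_gt0 dt0.
  apply: le_trans (@logn_sum_le_ln R Y.+1 _ dp).
  rewrite big_mkcond [X in _ <= X]big_mkcond; apply: ler_sum_nat => p _.
  case: ifP => [/[dup] Qp /andP[pp _]|_]; last first.
    by case: ifP => // _; rewrite mulr_ge0 ?ler0n ?ln_nat_ge0.
  rewrite pp mulrC ler_wpM2r ?ln_nat_ge0 // -natr_sum ler_nat.
  have [fr rr] := rP _ Qp.
  apply: leq_trans (split_logn_det pp fr rr (dt0 _ _ uv)).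
  rewrite -sum1_card [X in (_ <= X)%N]big_mkcond; apply: leq_sum => l _.
  by rewrite inE; case: (_ \in _).
have up (u v : T) : (if u == v then 0 else ln (`|dt u v|%N%:R : R)) <= ln c%:R + N%:R * ln X%:R.
  have lnX : 0 <= ln c%:R + N%:R * ln (X%:R : R).
    by rewrite addr_ge0 ?mulr_ge0 ?ler0n ?ln_nat_ge0.
  case: eqP => // /eqP uv; have dp : (0 < `|dt u v|)%N by rewrite absz_gt0 dt0.
  have := ler_ln_nat R dp (Hc X _ X0 (size_box_polyB u v) (coef_box_polyB u v)).
  by rewrite mulr_natl ln_natM ?expn_gt0 ?X0 // natrX lnXn ?ltr0n.
(* Summation over all pairs: each root yields at least [B ^ 2 / p] collisions, and each of the
   [B ^ 2] pairs costs at most [ln c + N ln X]. *)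
have main : \sum_(0 <= p < Y.+1 | Q p) ln p%:R * (N%:R * B ^+ 2 / p%:R - N%:R * B)
   <= B ^+ 2 * (ln c%:R + N%:R * ln X%:R).
  apply: (@le_trans _ _ (\sum_(u : T) \sum_(v : T) (ln c%:R + N%:R * ln X%:R))); last first.
    rewrite !sumr_const cT; move: (_ + _) => K.
    by rewrite -[X in X <= _]mulr_natl -[K *+ _]mulr_natl mulrA -expr2.
  apply: (@le_trans _ _ (\sum_(u : T) \sum_(v : T) \sum_(0 <= p < Y.+1 | Q p)
      ln p%:R * ((\sum_l hit u v p l) - N%:R * (u == v)%:R))); last first.
    by apply: ler_sum => u _; apply: ler_sum => v _; exact: le_trans (low u v) (up u v).
  under [X in _ <= X]eq_bigr do rewrite exchange_big.
  rewrite [X in _ <= X]exchange_big; apply: ler_sum => p Qp.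
  under eq_bigr do rewrite -mulr_sumr.
  rewrite -mulr_sumr ler_wpM2l ?ln_nat_ge0 //.
  under [X in _ <= X]eq_bigr do rewrite sumrB.
  rewrite sumrB; apply: lerB.
    have pp : prime p by case/andP: Qp.
    under [X in _ <= X]eq_bigr do rewrite exchange_big.
    rewrite [X in _ <= X]exchange_big /=.
    have -> : N%:R * B ^+ 2 / p%:R = \sum_(l < N) B ^+ 2 / p%:R.
      by rewrite sumr_const card_ord -[RHS]mulr_natl mulrA.
    apply: ler_sum => l _.
    pose g (u : T) : 'F_p := ((box_poly u).[r p l])%:~R.
    have := @sum_collisions_ge T 'F_p g; rewrite card_Fp // cT => /(_ (prime_gt0 pp)).
    move=> H; apply: le_trans H _; apply: ler_sum => u _; apply: ler_sum => v _.
    rewrite /hit /g -subr_eq0 -rmorphB /= (intr_pchar_eq0 _ (pchar_Fp pp)).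
    by rewrite hornerD hornerN.
  rewrite (eq_bigr (fun=> N%:R)); last first.
    move=> u _; rewrite -mulr_sumr (bigD1 u) //= eqxx big1 ?addr0 ?mulr1 // => v vu.
    by rewrite eq_sym (negbTE vu).
  by rewrite sumr_const cT -[X in X <= _]mulr_natr.
have e1 : \sum_(0 <= p < Y.+1 | Q p) ln p%:R * (N%:R * B ^+ 2 / p%:R - N%:R * B)
   = N%:R * B ^+ 2 * S - N%:R * B * \sum_(0 <= p < Y.+1 | Q p) ln p%:R.
  rewrite /S !mulr_sumr -sumrB; apply: eq_bigr => p _; ring.
(* The diagonal correction is [N B] times this sum, of order [B ^ 2] because [Y <= B]. *)
have th : \sum_(0 <= p < Y.+1 | Q p) ln (p%:R : R) <= B * ln 4.
  apply: (@le_trans _ _ (Y%:R * ln 4)); last first.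
    by rewrite ler_wpM2r ?ler_nat // -[4]/(4%:R) ln_nat_ge0.
  apply: le_trans (chebyshev_theta R Y).
  rewrite big_mkcond [X in _ <= X]big_mkcond; apply: ler_sum => p _.
  by rewrite /Q; case: (prime p) => //=; case: ifP => // _; exact: ln_nat_ge0.
have lX : N%:R * ln (X%:R : R) <= N%:R * ln 2 + ln Y%:R.
  rewrite !mulr_natl -!lnXn ?ltr0n // -!natrX -ln_natM ?expn_gt0 //.
  by apply: ler_ln_nat => //; rewrite expn_gt0 X0.
have NB : 0 < N%:R * B ^+ 2 by rewrite mulr_gt0 // exprn_gt0.
rewrite -(ler_pM2l NB).
have h1 : N%:R * B * \sum_(0 <= p < Y.+1 | Q p) ln (p%:R : R) <= N%:R * B * (B * ln 4).
  by rewrite ler_wpM2l // mulr_ge0 // ltW.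
have h2 : B ^+ 2 * (N%:R * ln (X%:R : R)) <= B ^+ 2 * (N%:R * ln 2 + ln Y%:R).
  by rewrite ler_wpM2l // exprn_ge0 // ltW.
have -> : N%:R * B ^+ 2 * (N%:R^-1 * ln Y%:R + (ln 2 + ln c%:R / N%:R + ln 4)) =
   B ^+ 2 * ln Y%:R + N%:R * B ^+ 2 * ln 2 + B ^+ 2 * ln c%:R + N%:R * B * (B * ln 4) :> R.
  by field; rewrite gt_eqF.
move: main; rewrite e1; move: h1 h2.
rewrite !mulrDr; lra.
Qed.
End SplitPrimes.
(** * The sieve *)

Section PeriodicSums.
Variable R : realType.

Lemma periodic_mod (T : Type) (F : nat -> T) m n : (forall k, F (k + m)%N = F k) -> F n = F (n %% m)%N.
Proof.
move=> Fm; rewrite {1}(divn_eq n m) addnC; elim: (n %/ m)%N => [|k IH].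
  by rewrite mul0n addn0.
by rewrite mulSn [(m + _)%N]addnC addnA Fm.
Qed.

(** The Chinese remainder theorem reindexes a period of length [a b] by pairs of residues. *)
Lemma sum_periodicM (F G : nat -> R) a b : (0 < a)%N -> (0 < b)%N -> coprime a b ->
  (forall k, F (k + a)%N = F k) -> (forall k, G (k + b)%N = G k) ->
  \sum_(n < a * b) F n * G n = (\sum_(n < a) F n) * (\sum_(n < b) G n).
Proof.
move=> a0 b0 cab Fa Gb; rewrite big_distrlr /= pair_big /=.
have ab0 : (0 < a * b)%N by rewrite muln_gt0 a0.
pose h (u : 'I_a * 'I_b) : 'I_(a * b) := Ordinal (ltn_pmod (chinese a b u.1 u.2) ab0).
pose h' (n : 'I_(a * b)) : 'I_a * 'I_b := (Ordinal (ltn_pmod n a0), Ordinal (ltn_pmod n b0)).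
rewrite (reindex h) /=; last first.
  exists h' => [[i j] _|n _].
    congr pair; apply: val_inj => /=.
      by rewrite modn_dvdm ?dvdn_mulr // chinese_modl // modn_small.
    by rewrite modn_dvdm ?dvdn_mull // chinese_modr // modn_small.
  apply: val_inj => /=.
  rewrite -[RHS](modn_small (ltn_ord n)); apply/eqP.
  rewrite (chinese_remainder cab).
  by rewrite chinese_modl ?chinese_modr ?modn_mod // !eqxx.
apply: eq_bigr => [[i j]] _ /=.
rewrite (periodic_mod _ Fa) (periodic_mod _ Gb).
rewrite modn_dvdm ?dvdn_mulr // modn_dvdm ?dvdn_mull //.
by rewrite chinese_modl // chinese_modr // !modn_small.
Qed.

Lemma sum_periodic_prod (I : eqType) (s : seq I) (m : I -> nat) (F : I -> nat -> R) :
  uniq s -> (forall i, (0 < m i)%N) ->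
  {in s &, forall i j, i != j -> coprime (m i) (m j)} ->
  (forall i k, F i (k + m i)%N = F i k) ->
  \sum_(n < \prod_(i <- s) m i) \prod_(i <- s) F i n =
    \prod_(i <- s) \sum_(n < m i) F i n.
Proof.
move=> us m0 co Fm; elim: s us co => [|i s IH] /=.
  by rewrite !big_nil big_ord1 big_nil.
move=> /andP[is_ us] co.
have P0 : (0 < \prod_(j <- s) m j)%N by elim/big_ind: _ => // x y; rewrite muln_gt0 => -> ->.
have per k : \prod_(j <- s) F j (k + \prod_(j <- s) m j)%N = \prod_(j <- s) F j k.
  rewrite big_seq [RHS]big_seq; apply: eq_bigr => j js.
  rewrite (periodic_mod _ (Fm j)) [RHS](periodic_mod _ (Fm j)).
  by congr (F j _); rewrite (big_rem j) //= mulnC addnC modnMDl.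
rewrite !big_cons.
under eq_bigr do rewrite big_cons.
rewrite (sum_periodicM (F := F i) (G := fun n => \prod_(j <- s) F j n)) //.
  rewrite IH // => a b as_ bs; apply: co; rewrite inE ?as_ ?bs orbT //.
rewrite big_seq; elim/big_ind: _ => [|x y cx cy|j js]; first exact: coprimen1.
  by rewrite coprimeMr cx cy.
apply: co; rewrite ?inE ?eqxx ?js ?orbT //.
by apply: contraNneq is_ => ->.
Qed.

Lemma sum_periodic_shift (V : pzSemiRingType) (c : nat -> V) M k : (forall n, c (n + M)%N = c n) ->
  \sum_(0 <= n < k * M) c n = k%:R * \sum_(0 <= n < M) c n.
Proof.
move=> cM; elim: k => [|k IH]; first by rewrite mul0n big_geq // mul0r.
rewrite mulSn addnC (@big_cat_nat _ _ _ (k * M)) ?leq_addr //= IH -natr1 mulrDl mul1r; congr (_ + _).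
rewrite -{1}[(k * M)%N]add0n big_addn addKn; apply: eq_bigr => n _.
rewrite (periodic_mod _ cM) [RHS](periodic_mod _ cM).
by rewrite addnC modnMDl.
Qed.

(** Full periods sum to zero, and the incomplete one has fewer than [M] terms. *)
Lemma sum_periodic0_le (c : nat -> R) M X : (0 < M)%N -> (forall n, c (n + M)%N = c n) ->
  (forall n, `|c n| <= 1) -> \sum_(0 <= n < M) c n = 0 ->
  \sum_(0 <= n < X) c n <= M%:R.
Proof.
move=> M0 cM c1 s0; rewrite (divn_eq X M).
rewrite (@big_cat_nat _ _ _ (X %/ M * M)) ?leq_addr //= sum_periodic_shift // s0 mulr0 add0r.
apply: (@le_trans _ _ (\sum_(X %/ M * M <= n < X %/ M * M + X %% M) 1)).
  by apply: ler_sum => n _; apply: le_trans (ler_norm _) (c1 n).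
by rewrite big_const_nat iter_addr_0 addKn ler_nat ltnW // ltn_pmod.
Qed.

(** Round [X] up to a multiple of the period. *)
Lemma sum_periodic_ge0_le (c : nat -> R) M X (g : R) : (0 < M)%N -> (forall n, c (n + M)%N = c n) ->
  (forall n, 0 <= c n) -> \sum_(0 <= n < M) c n = M%:R * g ->
  \sum_(0 <= n < X) c n <= (X + M)%N%:R * g.
Proof.
move=> M0 cM c1 sg.
have M0' : 0 < (M%:R : R) by rewrite ltr0n.
have g0 : 0 <= g by rewrite -(pmulr_rge0 _ M0') -sg; apply: sumr_ge0 => n _.
apply: (@le_trans _ _ (\sum_(0 <= n < (X %/ M).+1 * M) c n)).
  have le : (X <= (X %/ M).+1 * M)%N by rewrite ltnW // ltn_ceil.
  by rewrite (@big_cat_nat _ _ _ X 0 ((X %/ M).+1 * M)) //= lerDl; apply: sumr_ge0 => n _.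
rewrite sum_periodic_shift // sg mulrA -natrM ler_wpM2r // ler_nat mulSn addnC leq_add2r.
exact: leq_divM.
Qed.
End PeriodicSums.

(** * Almost orthogonal functions and the sieve inequality *)

Section Sieve.
Variables (R : realType) (I : finType) (w : I -> nat) (om : I -> pred nat).
Hypothesis w_gt0 : forall i, (0 < w i)%N.
Hypothesis w_coprime : forall i j, i != j -> coprime (w i) (w j).
Hypothesis om_periodic : forall i n, om i (n + w i ^ 2)%N = om i n.

Definition sieve_count i : nat := \sum_(n < w i ^ 2) om i n.
Hypothesis count_le : forall i, (2 * sieve_count i <= w i ^ 2)%N.

Definition sieve_density i : R := (sieve_count i)%:R / ((w i ^ 2)%N%:R - (sieve_count i)%:R).
Local Notation g := sieve_density.
Local Notation m i := (w i ^ 2)%N.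

Lemma sieve_den_gt0 i : 0 < ((m i)%:R - (sieve_count i)%:R : R).
Proof.
rewrite subr_gt0 ltr_nat; have := count_le i.
have : (0 < m i)%N by rewrite expn_gt0 w_gt0.
by move: (m i) (sieve_count i) => a b; lia.
Qed.

Lemma sieve_density_ge0 i : 0 <= g i.
Proof. by rewrite divr_ge0 ?ler0n // ltW // sieve_den_gt0. Qed.

Lemma sieve_density_le1 i : g i <= 1.
Proof.
rewrite ler_pdivrMr ?sieve_den_gt0 // mul1r lerBrDr -natrD ler_nat.
by have := count_le i; lia.
Qed.

(* Mean zero and mean square [g i] over a period, so that the products of these
   functions over distinct sets of primes are orthogonal. *)
Definition sieve_fun i (n : nat) : R := if om i n then -1 else g i.
Local Notation phi := sieve_fun.

Lemma sieve_fun_periodic i n : phi i (n + m i)%N = phi i n.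
Proof. by rewrite /phi om_periodic. Qed.

Lemma sieve_fun_le1 i n : `|phi i n| <= 1.
Proof.
rewrite /phi; case: ifP => _; first by rewrite normrN1.
by rewrite ger0_norm ?sieve_density_ge0 // sieve_density_le1.
Qed.

Lemma sum_if_om i (a b : R) : \sum_(n < m i) (if om i n then a else b) =
  (sieve_count i)%:R * a + ((m i)%:R - (sieve_count i)%:R) * b.
Proof.
have -> : (sieve_count i)%:R = \sum_(n < m i) (om i n)%:R :> R by rewrite natr_sum.
have -> : (m i)%:R = \sum_(n < m i) 1 :> R by rewrite sumr_const card_ord.
rewrite -sumrB !mulr_suml -big_split; apply: eq_bigr => n _ /=.
by case: (om i n); rewrite ?mul1r ?subrr ?mul0r ?addr0 // subr0 mul1r add0r.
Qed.

Lemma sieve_fun_mean i : \sum_(n < m i) phi i n = 0.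
Proof.
rewrite sum_if_om /g mulrN1 mulrCA divff ?mulr1 ?addNr //.
by rewrite gt_eqF // sieve_den_gt0.
Qed.

Lemma sieve_fun_sq i : \sum_(n < m i) phi i n ^+ 2 = (m i)%:R * g i.
Proof.
have := sieve_den_gt0 i.
under eq_bigr do rewrite (fun_if (fun x : R => x ^+ 2)).
rewrite sum_if_om /g; move: (m i)%:R (sieve_count i)%:R => a b h.
by field; rewrite gt_eqF.
Qed.

Definition sieve_weight (J : {set I}) : nat := \prod_(i in J) w i.
Definition sieve_funs (J : {set I}) n : R := \prod_(i in J) phi i n.
Definition sieve_term (J : {set I}) : R := \prod_(i in J) g i.

Lemma sieve_term_ge0 J : 0 <= sieve_term J.
Proof. by apply: prodr_ge0 => i _; exact: sieve_density_ge0. Qed.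

(** A period of the factor at [i] in the product of the functions of [J] and [K]; it is [1] where
    that factor is constant. *)
Definition pair_modulus (J K : {set I}) i := if (i \in J) || (i \in K) then m i else 1%N.
Definition pair_fun (J K : {set I}) i n : R :=
  (if i \in J then phi i n else 1) * (if i \in K then phi i n else 1).

Lemma pair_funE J K n : sieve_funs J n * sieve_funs K n = \prod_(i : I) pair_fun J K i n.
Proof. by rewrite /sieve_funs big_mkcond [X in _ * X]big_mkcond -big_split. Qed.

Lemma pair_fun_periodic J K i n : pair_fun J K i (n + pair_modulus J K i)%N = pair_fun J K i n.
Proof.
rewrite /pair_fun /pair_modulus.
by case: (i \in J); case: (i \in K); rewrite /= ?sieve_fun_periodic.
Qed.

Lemma pair_sum J K : \sum_(0 <= n < \prod_(i : I) pair_modulus J K i) sieve_funs J n * sieve_funs K n =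
  \prod_(i : I) \sum_(n < pair_modulus J K i) pair_fun J K i n.
Proof.
rewrite big_mkord.
transitivity (\sum_(n < \prod_(i : I) pair_modulus J K i) \prod_(i : I) pair_fun J K i n).
  by apply: eq_bigr => n _; exact: pair_funE.
apply: sum_periodic_prod; rewrite ?index_enum_uniq //.
- by move=> i; rewrite /pair_modulus; case: ifP => // _; rewrite expn_gt0 w_gt0.
- move=> i j _ _ ij; rewrite /pair_modulus.
  case: ifP => _; last by rewrite coprime1n.
  case: ifP => _; last by rewrite coprimen1.
  by rewrite coprimeXl // coprimeXr // w_coprime.
- exact: pair_fun_periodic.
Qed.

Lemma pair_sum_period J K n :
  sieve_funs J (n + \prod_(i : I) pair_modulus J K i)%N *
    sieve_funs K (n + \prod_(i : I) pair_modulus J K i)%N = sieve_funs J n * sieve_funs K n.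
Proof.
rewrite !pair_funE; apply: eq_bigr => i _.
rewrite (periodic_mod _ (pair_fun_periodic J K i)) [RHS](periodic_mod _ (pair_fun_periodic J K i)).
by congr pair_fun; rewrite (bigD1 i) //= mulnC addnC modnMDl.
Qed.

Lemma pair_modulus_gt0 J K : (0 < \prod_(i : I) pair_modulus J K i)%N.
Proof.
elim/big_ind: _ => // [x y|i _]; first by rewrite muln_gt0 => -> ->.
by rewrite /pair_modulus; case: ifP => // _; rewrite expn_gt0 w_gt0.
Qed.

Lemma pair_modulus_le J K :
  (\prod_(i : I) pair_modulus J K i <= sieve_weight J ^ 2 * sieve_weight K ^ 2)%N.
Proof.
rewrite /sieve_weight -!mulnn -!big_split /= [X in (_ <= X * _)%N]big_mkcond.
rewrite [X in (_ <= _ * X)%N]big_mkcond -big_split /=; apply: leq_prod => i _.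
rewrite /pair_modulus -mulnn; have := w_gt0 i.
by case: (i \in J); case: (i \in K) => /= wi; rewrite ?muln1 ?mul1n // leq_pmulr // muln_gt0 wi.
Qed.

Lemma sieve_funs_le1 J n : `|sieve_funs J n| <= 1.
Proof.
rewrite normr_prod; suff /andP[] : 0 <= \prod_(i in J) `|phi i n| <= 1 by [].
elim/big_ind: _ => [|x y /andP[x0 x1] /andP[y0 y1]|i _].
- by rewrite ler01 lexx.
- by rewrite mulr_ge0 //= mulr_ile1.
- by rewrite normr_ge0 sieve_fun_le1.
Qed.

(** Some index belongs to exactly one of [J] and [K]. Its factor has mean zero, so the product sums
    to zero over a full period. *)
Lemma sum_pair_offdiag J K X : J != K ->
  \sum_(0 <= n < X) sieve_funs J n * sieve_funs K n <=
    (sieve_weight J ^ 2 * sieve_weight K ^ 2)%N%:R.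
Proof.
move=> JK; apply: (@le_trans _ _ (\prod_(i : I) pair_modulus J K i)%N%:R); last first.
  by rewrite ler_nat pair_modulus_le.
apply: sum_periodic0_le.
- exact: pair_modulus_gt0.
- exact: pair_sum_period.
- by move=> n; rewrite normrM mulr_ile1 // sieve_funs_le1.
have [i hi] : exists i, (i \in J) (+) (i \in K).
  apply/existsP; apply: contraNT JK => /existsPn H; apply/eqP/setP => i.
  by have := H i; case: (i \in J); case: (i \in K).
rewrite pair_sum (bigD1 i) //= [X in X * _](_ : _ = 0) ?mul0r //.
rewrite /pair_modulus /pair_fun; move: hi.
case: (i \in J); case: (i \in K) => //= _.
  by under eq_bigr do rewrite mulr1; rewrite sieve_fun_mean.
by under eq_bigr do rewrite mul1r; rewrite sieve_fun_mean.
Qed.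

(** All factors are squares, with mean [g i] by [sieve_fun_sq]. *)
Lemma sum_pair_diag J X :
  \sum_(0 <= n < X) sieve_funs J n * sieve_funs J n <=
    (X + sieve_weight J ^ 2)%N%:R * sieve_term J.
Proof.
have eM : (\prod_(i : I) pair_modulus J J i = sieve_weight J ^ 2)%N.
  rewrite /sieve_weight -mulnn -big_split /= [RHS]big_mkcond; apply: eq_bigr => i _.
  by rewrite /pair_modulus orbb mulnn.
rewrite -eM; apply: sum_periodic_ge0_le.
- exact: pair_modulus_gt0.
- exact: pair_sum_period.
- by move=> n; rewrite -expr2 sqr_ge0.
rewrite pair_sum natr_prod /sieve_term [in RHS](big_mkcond (fun i => i \in J)) -big_split /=.
apply: eq_bigr => i _; rewrite /pair_modulus /pair_fun orbb.
case: (i \in J) => /=; last by rewrite big_ord1 !mul1r.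
by rewrite -sieve_fun_sq; apply: eq_bigr => n _; rewrite expr2.
Qed.

Variable Q : nat.
Hypothesis Q2 : (2 <= Q)%N.

(** An index with [w i = 1] is a placeholder; leaving these out makes a set of the family determined
    by its weight. *)
Definition sieve_support : {set I} := [set i | (1 < w i)%N].
Definition sieve_family : {set {set I}} :=
  [set J : {set I} | (J \subset sieve_support) && (sieve_weight J <= Q)%N].
Definition sieve_mass : R := \sum_(J in sieve_family) sieve_term J.

Lemma sieve_term0 : sieve_term finset.set0 = 1.
Proof. by rewrite /sieve_term big_set0. Qed.

Lemma sieve_mass_ge1 : 1 <= sieve_mass.
Proof.
rewrite /sieve_mass (bigD1 finset.set0) /=; last first.
  by rewrite inE finset.sub0set /sieve_weight big_set0 ltnW.
by rewrite sieve_term0 lerDl; apply: sumr_ge0 => J _; exact: sieve_term_ge0.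
Qed.

(** If [i] in [J] were missing from [K], then [w i > 1] would divide a product of numbers coprime to
    it. *)
Lemma sieve_weight_inj : {in sieve_family &, injective sieve_weight}.
Proof.
suff H J K : J \in sieve_family -> sieve_weight J = sieve_weight K -> J \subset K.
  move=> J K hJ hK e; apply/eqP; rewrite finset.eqEsubset.
  by rewrite (H _ _ hJ e) (H _ _ hK (esym e)).
rewrite inE => /andP[sJ _] e; apply/fintype.subsetP => i iJ; apply: contraT => iK.
have /fintype.subsetP/(_ i iJ) : J \subset sieve_support by [].
rewrite inE ltnNge; apply: contraNT => _.
have : (w i %| sieve_weight K)%N by rewrite -e /sieve_weight (bigD1 i) //= dvdn_mulr.
have : coprime (w i) (sieve_weight K).
  rewrite /sieve_weight; elim/big_ind: _ => [|x y cx cy|j jK]; first exact: coprimen1.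
    by rewrite coprimeMr cx cy.
  by apply: w_coprime; apply: contraNneq iK => ->.
rewrite /coprime => /eqP c /gcdn_idPl d; by rewrite -d c.
Qed.

Lemma card_sieve_family : (#|sieve_family| <= Q.+1)%N.
Proof.
pose h (J : {set I}) : 'I_Q.+1 := inord (sieve_weight J).
rewrite -[X in (_ <= X)%N](card_ord Q.+1).
have inj : {in sieve_family &, injective h}.
  move=> J K hJ hK /(congr1 val) /=.
  have bJ J' : J' \in sieve_family -> (sieve_weight J' < Q.+1)%N by rewrite inE => /andP[].
  by rewrite !inordK ?bJ //; exact: sieve_weight_inj.
by rewrite -(card_in_imset inj) max_card.
Qed.

(** Markov's inequality, each set [J] having probability [sieve_term J / G]: by hypothesis the mean
    of [ln (sieve_weight J)] is at most half of [ln Q]. *)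
Lemma sieve_mass_ge :
  \sum_i g i * ln (w i)%:R <= ln (Q%:R : R) / 2 ->
  (\prod_i (1 + g i)) / 2 <= sieve_mass.
Proof.
move=> H; set G := \prod_i (1 + g i).
have lnQ : 0 < ln (Q%:R : R) by rewrite ln_gt0 // ltr1n.
have G0 : 0 <= G by apply: prodr_ge0 => i _; rewrite addr_ge0 ?sieve_density_ge0.
have eG : G = \sum_(J : {set I}) sieve_term J.
  rewrite /G; under eq_bigr do rewrite addrC.
  rewrite bigA_distr; apply: eq_bigr => J _.
  by rewrite /sieve_term [RHS]big_mkcond.
(* The sets containing [i] are selected by replacing [1 + g i] with [g i] in the product. *)
have eGi i : \sum_(J : {set I}) (i \in J)%:R * sieve_term J <= g i * G.
  have -> : \sum_(J : {set I}) (i \in J)%:R * sieve_term J =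
     \prod_j (g j + (if j == i then 0 else 1)).
    rewrite bigA_distr; apply: eq_bigr => J _; rewrite /sieve_term.
    rewrite [in LHS]big_mkcond /=; case: (boolP (i \in J)) => iJ.
      rewrite mul1r; apply: eq_bigr => j _; case: ifP => // jJ.
      by rewrite ifF //; apply: contraFF jJ => /eqP ->.
    by rewrite mul0r [RHS](bigD1 i) //= (negbTE iJ) eqxx mul0r.
  rewrite /G (bigD1 i) //= [X in _ <= _ * X](bigD1 i) //= eqxx addr0.
  rewrite ler_wpM2l ?sieve_density_ge0 //.
  rewrite (eq_bigr (fun j => 1 + g j)); last by move=> j /negbTE ->; rewrite addrC.
  rewrite ler_peMl ?lerDl ?sieve_density_ge0 //.
  by apply: prodr_ge0 => j _; rewrite addr_ge0 ?sieve_density_ge0.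
have lnW J : ln (sieve_weight J)%:R = \sum_i (i \in J)%:R * ln (w i)%:R :> R.
  under [RHS]eq_bigr do rewrite mulr_natl mulrb.
  rewrite -big_mkcond /sieve_weight.
  suff [] : (0 < \prod_(i in J) w i)%N /\
     ln ((\prod_(i in J) w i)%N%:R : R) = \sum_(i in J) ln (w i)%:R by [].
  elim/big_ind2: _ => [|x1 x2 y1 y2 [x10 Hx] [y10 Hy]|i _]; rewrite ?ln1 //.
  by rewrite muln_gt0 x10 y10 ln_natM // Hx Hy.
have E : \sum_(J : {set I}) sieve_term J * ln (sieve_weight J)%:R <= G * (ln (Q%:R : R) / 2).
  have -> : \sum_(J : {set I}) sieve_term J * ln (sieve_weight J)%:R =
     \sum_i ln (w i)%:R * \sum_(J : {set I}) (i \in J)%:R * sieve_term J :> R.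
    under eq_bigr do rewrite lnW mulr_sumr.
    rewrite exchange_big; apply: eq_bigr => i _; rewrite mulr_sumr.
    by apply: eq_bigr => J _; rewrite mulrC -mulrA mulrCA.
  apply: le_trans (ler_wpM2l G0 H); rewrite mulr_sumr; apply: ler_sum => i _.
  rewrite mulrCA mulrA [X in _ <= X]mulrC; apply: ler_wpM2l; first exact: ln_nat_ge0.
  exact: eGi.
(* A set outside the family contains a placeholder, so that its term is zero, or has weight above
   [Q]. *)
have pt J : sieve_term J - sieve_term J * ln (sieve_weight J)%:R / ln Q%:R <=
    (if J \in sieve_family then sieve_term J else 0).
  have [hJ|] := boolP (J \in sieve_family).
    by rewrite gerBl !mulr_ge0 ?sieve_term_ge0 ?ln_nat_ge0 // invr_ge0 ltW.
  rewrite inE negb_and => /orP[/subsetPn[i iJ]|].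
    rewrite inE -leqNgt => wi1.
    have w1 : w i = 1%N by apply/eqP; rewrite eqn_leq wi1 w_gt0.
    have c0 : sieve_count i = 0%N by have := count_le i; rewrite w1 exp1n; lia.
    have -> : sieve_term J = 0 by rewrite /sieve_term (bigD1 i) //= /sieve_density c0 !mul0r.
    by rewrite !mul0r subrr.
  rewrite -ltnNge => WQ; rewrite subr_le0 -mulrA ler_peMr ?sieve_term_ge0 //.
  rewrite ler_pdivlMr // mul1r; apply: ler_ln_nat; first exact: ltnW.
  exact: ltnW.
have : \sum_(J : {set I}) (sieve_term J - sieve_term J * ln (sieve_weight J)%:R / ln Q%:R) <= sieve_mass.
  by rewrite /sieve_mass [X in _ <= X]big_mkcond; apply: ler_sum => J _; exact: pt.
rewrite sumrB -eG -mulr_suml.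
have : (\sum_(J : {set I}) sieve_term J * ln (sieve_weight J)%:R) / ln Q%:R <= G / 2.
  by rewrite ler_pdivrMr //; apply: le_trans E _; rewrite mulrA mulrAC.
lra.
Qed.

(** On sifted [n] every factor is [g i], so [F n] is the mass; its square times [Z] is at most the
    second moment of [F]. The condition on [X] makes the off-diagonal error at most [X]. *)
Theorem sieve_upper_bound X :
  \sum_i g i * ln (w i)%:R <= ln (Q%:R : R) / 2 -> (Q.+1 ^ 6 <= X)%N ->
  (\sum_(0 <= n < X) [forall i, ~~ om i n])%:R * (\prod_i (1 + g i)) <= 6 * X%:R :> R.
Proof.
move=> H QX; set Z := (\sum_(0 <= n < X) _)%N; set G := \prod_i (1 + g i).
pose F n := \sum_(J in sieve_family) sieve_funs J n.
have m1 := sieve_mass_ge1; have mG := sieve_mass_ge H; rewrite -/G in mG.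
have ZF : Z%:R * sieve_mass ^+ 2 <= \sum_(0 <= n < X) F n ^+ 2.
  rewrite /Z natr_sum mulr_suml; apply: ler_sum => n _.
  case: forallP => h; last by rewrite mul0r sqr_ge0.
  suff -> : F n = sieve_mass by rewrite mul1r.
  apply: eq_bigr => J _.
  by apply: eq_bigr => i _; rewrite /sieve_fun (negbTE (h i)).
(* At most [(Q + 1) ^ 2] off-diagonal pairs contribute at most [Q ^ 4] each. *)
have FX : \sum_(0 <= n < X) F n ^+ 2 <= (X + Q ^ 2)%N%:R * sieve_mass + (Q.+1 ^ 6)%N%:R.
  have -> : \sum_(0 <= n < X) F n ^+ 2 = \sum_(J in sieve_family) \sum_(K in sieve_family)
      \sum_(0 <= n < X) sieve_funs J n * sieve_funs K n.
    under eq_bigr do rewrite /F expr2 big_distrlr /=.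
    by rewrite exchange_big; apply: eq_bigr => J _; rewrite exchange_big.
  have fam J : J \in sieve_family -> (sieve_weight J <= Q)%N by rewrite inE => /andP[].
  apply: (@le_trans _ _ (\sum_(J in sieve_family)
      ((X + Q ^ 2)%N%:R * sieve_term J + \sum_(K in sieve_family) (Q ^ 4)%N%:R))).
    apply: ler_sum => J hJ; rewrite (bigD1 J) //=; apply: lerD.
      apply: le_trans (sum_pair_diag J X) _; rewrite ler_wpM2r ?sieve_term_ge0 //.
      by rewrite ler_nat leq_add2l leq_exp2r // fam.
    rewrite [X in _ <= X](bigD1 J) //= -[X in X <= _]add0r; apply: lerD => //.
    apply: ler_sum => K /andP[hK KJ]; rewrite eq_sym in KJ.
    apply: le_trans (sum_pair_offdiag X KJ) _; rewrite ler_nat -[4%N]/(2 + 2)%N expnD.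
    by rewrite leq_mul // leq_exp2r // fam.
  rewrite big_split /= -mulr_sumr lerD2l !sumr_const -!mulrnA ler_nat.
  rewrite [(Q.+1 ^ 6)%N](_ : _ = Q.+1 ^ 4 * (Q.+1 * Q.+1))%N; last by rewrite mulnn -expnD.
  by rewrite leq_mul ?leq_mul ?card_sieve_family // leq_exp2r.
have m0 : 0 < sieve_mass by apply: lt_le_trans m1.
have X1 : ((Q ^ 2)%N%:R : R) <= X%:R.
  rewrite ler_nat; apply: leq_trans QX; apply: (@leq_trans (Q.+1 ^ 2)); first by rewrite leq_exp2r.
  by rewrite leq_pexp2l.
have X2 : ((Q.+1 ^ 6)%N%:R : R) <= X%:R by rewrite ler_nat.
have Z0 : 0 <= (Z%:R : R) by rewrite ler0n.
have X0 : 0 <= (X%:R : R) by rewrite ler0n.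
(* The second moment is at most [2 X sieve_mass + X], and the mass is at least [1]. *)
have Zm : Z%:R * sieve_mass <= 3 * X%:R.
  rewrite -(ler_pM2r m0) -mulrA -expr2; apply: le_trans ZF _; apply: le_trans FX _.
  rewrite natrD.
  have := ler_wpM2r (ltW m0) X1; have := ler_wpM2l X0 m1; rewrite mulr1 mulrDl; lra.
have := ler_wpM2l Z0 mG; lra.
Qed.
End Sieve.
(** Everything that the analytic argument takes from the field. For [p] prime to [D], the
    alternative is whether [f] has a root mod [p]. *)
Lemma number_field_data (L : splittingFieldType rat) : galois 1%VS {:L} ->
  exists (f : {poly int}) (D : int),
  [/\ f \is monic, size f = (\dim {:L}).+1,
      (forall g h q : {poly int}, (size g <= \dim {:L})%N -> (size h <= \dim {:L})%N ->
         g * h = q * f -> g = 0 \/ h = 0), D != 0 &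
      forall p, prime p -> ~~ (p%:Z %| D)%Z ->
        splits (\dim {:L}) f p \/
        (exists2 d, (d %| \dim {:L})%N & (1 < d)%N /\ P_r L d p) /\
        (forall z : int, bK L z -> (p%:Z %| z)%Z -> ((p ^ 2)%N%:Z %| z)%Z)].
Proof.
move=> galL; have [alpha [oa ga]] := integral_primitive_element galL.
have [f [fm fP]] := int_minpoly galL oa.
have [D [D0 Ddisc Dgen Ddiff]] := discriminant_facts galL oa ga.
have fa := int_minpoly_alpha0 fP.
exists f, D; split=> //; first exact: (size_int_minpoly fP).
  move=> g h q sg sh e.
  have : (map_poly intr g).[alpha] * (map_poly intr h).[alpha] = 0.
    by rewrite -hornerM -rmorphM e rmorphM hornerM fa mulr0.
  move=> /eqP; rewrite mulf_eq0 => /orP[|] /eqP z.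
    by left; exact: (small_int_poly_eq0 galL ga sg z).
  by right; exact: (small_int_poly_eq0 galL ga sh z).
move=> p pp pD; have [[c hc]|H] := pselect (exists c : int, (p%:Z %| f.[c])%Z).
  by left; exact: (split_of_root oa ga fm fP Dgen Ddiff pp pD hc).
have nr c : ~~ (p%:Z %| f.[c])%Z by apply/negP => hc; apply: H; exists c.
right; split; first exact: (nonsplit_P_r oa ga fm fP Dgen Ddiff pp pD Ddisc nr).
by move=> z; exact: (bK_prime_sq_dvd oa fa pp nr).
Qed.
(** * Application to the linear forms *)

Section LinearForms.
Implicit Types (a b : int) (p q n : nat).

Definition exactly_divides p (z : int) : bool := (p%:Z %| z)%Z && ~~ ((p ^ 2)%N%:Z %| z)%Z.

Definition dvd_form a b q n : bool := (q%:Z %| a * n%:Z + b)%Z.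

(** The only root is [- u b] mod [q], where [u] inverts [a]. *)
Lemma count_linear_root a b q : (0 < q)%N -> coprimez a q ->
  (\sum_(0 <= n < q) dvd_form a b q n)%N = 1%N.
Proof.
move=> q0 /coprimezP[[u v] /= uv].
have q0' : q%:Z != 0 by rewrite -lt0n.
pose s := (- (u * b) %% q%:Z)%Z.
have s0 : 0 <= s by exact: modz_ge0.
have sq : (`|s| < q)%N by rewrite -ltz_nat abszE ger0_norm // ltz_pmod.
have key n : (n < q)%N -> dvd_form a b q n = (n == `|s|%N).
  move=> nq; rewrite /dvd_form -eqz_nat abszE ger0_norm // /s.
  rewrite -[n%:Z](@modz_small _ q%:Z) // eqz_mod_dvd opprK modz_small //.
  apply/idP/idP => h.
    have -> : n%:Z + u * b = u * (a * n%:Z + b) + v * n%:Z * q%:Z.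
      by rewrite -[X in X + _ = _]mul1r -uv; ring.
    by rewrite rpredD ?dvdz_mull.
  have -> : a * n%:Z + b = a * (n%:Z + u * b) + v * b * q%:Z.
    by rewrite -[X in _ + X = _]mul1r -uv; ring.
  by rewrite rpredD ?dvdz_mull.
rewrite (eq_big_nat _ _ (F2 := fun n => (n == `|s|%N) : nat)); last first.
  by move=> n /andP[_ nq]; rewrite key.
rewrite big_mkord (bigD1 (Ordinal sq)) //= eqxx big1 // => n.
by rewrite -val_eqE /= => /negbTE ->.
Qed.

Lemma dvdz_linear_shift a b q n k : dvd_form a b q (n + k * q) = dvd_form a b q n.
Proof.
rewrite /dvd_form.
have -> : a * (n + k * q)%N%:Z + b = a * n%:Z + b + a * k%:Z * q%:Z.
  by rewrite PoszD PoszM; ring.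
by rewrite rpredDr // dvdz_mull.
Qed.

Lemma exactly_divides_shift a b p n :
  exactly_divides p (a * (n + p ^ 2)%N%:Z + b) = exactly_divides p (a * n%:Z + b).
Proof.
rewrite /exactly_divides -!/(dvd_form _ _ _ _); congr (_ && ~~ _); first by rewrite -mulnn dvdz_linear_shift.
by have := dvdz_linear_shift a b (p ^ 2) n 1; rewrite mul1n.
Qed.

(** Among the classes mod [p ^ 2], the form is divisible by [p] on [p] of them, and by [p ^ 2] on
    one of these. *)
Lemma count_exactly_divides a b p : prime p -> ~~ (p%:Z %| a)%Z ->
  (\sum_(n < p ^ 2) exactly_divides p (a * n%:Z + b)%R)%N = p.-1.
Proof.
move=> pp pa; have p0 := prime_gt0 pp.
have co k : coprimez a (p ^ k)%N.
  by rewrite coprimezE absz_nat coprime_sym coprimeXl // prime_coprime.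
have c1 : (\sum_(0 <= n < p ^ 2) dvd_form a b p n = p)%N.
  rewrite -mulnn (@sum_periodic_shift nat (fun n => dvd_form a b p n : nat)).
    rewrite count_linear_root //; last exact: (co 1%N).
    exact: (etrans (mulr1 _) (natn p)).
  by move=> n; have := dvdz_linear_shift a b p n 1; rewrite mul1n => ->.
have c2 : (\sum_(0 <= n < p ^ 2) dvd_form a b (p ^ 2) n = 1)%N.
  by rewrite count_linear_root // expn_gt0 p0.
rewrite -(big_mkord xpredT (fun n => exactly_divides p (a * n%:Z + b) : nat)).
suff : (\sum_(0 <= n < p ^ 2) exactly_divides p (a * n%:Z + b)%R +
    \sum_(0 <= n < p ^ 2) dvd_form a b (p ^ 2) n = \sum_(0 <= n < p ^ 2) dvd_form a b p n)%N.
  by rewrite c1 c2 addn1 => /(congr1 predn).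
rewrite -big_split /=; apply: eq_bigr => n _; rewrite /exactly_divides /dvd_form.
have [h|] := boolP ((p ^ 2)%N%:Z %| a * n%:Z + b)%Z; last by rewrite andbT addn0.
rewrite andbF /=; case: (boolP (p%:Z %| _)%Z) => //; apply: contraNeq => _.
by apply: dvdz_trans h; rewrite -mulnn PoszM dvdz_mulr.
Qed.

Variables (M : nat) (a b : 'I_M -> int).

Definition some_exactly_divides p n : bool :=
  [exists m, exactly_divides p (a m * n%:Z + b m)].

(** The classes of two forms are disjoint: on a common one [p] would divide the determinant, which
    is a combination of the two values. So the counts add up. *)
Lemma count_some_exactly_divides p : prime p ->
  (forall m, ~~ (p%:Z %| a m)%Z) ->
  (forall m k, m != k -> ~~ (p%:Z %| a m * b k - a k * b m)%Z) ->
  (\sum_(n < p ^ 2) some_exactly_divides p n)%N = (M * p.-1)%N.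
Proof.
move=> pp pa pab.
transitivity (\sum_(n < p ^ 2) \sum_(m < M) exactly_divides p (a m * n%:Z + b m)%R)%N.
  apply: eq_bigr => n _; rewrite /some_exactly_divides; case: existsP => [[m hm]|h].
    rewrite (bigD1 m) //= hm big1 // => k km.
    apply/eqP; rewrite eqb0; apply: contra (pab m k _); last by rewrite eq_sym.
    move: hm; rewrite /exactly_divides => /andP[hm _] /andP[hk _].
    have -> : a m * b k - a k * b m =
        a m * (a k * n%:Z + b k) - a k * (a m * n%:Z + b m) by ring.
    by rewrite rpredB ?dvdz_mull.
  rewrite big1 // => m _; apply/eqP; rewrite eqb0; apply/negP => hm.
  by apply: h; exists m.
rewrite exchange_big /= (eq_bigr (fun=> p.-1)); last first.
  by move=> m _; rewrite count_exactly_divides.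
by rewrite sum_nat_const card_ord.
Qed.

Lemma Dprod_ndvd p : prime p -> ~~ (p %| `|Dprod a b|)%N ->
  (forall m, ~~ (p%:Z %| a m)%Z) /\
  (forall m k, m != k -> ~~ (p%:Z %| a m * b k - a k * b m)%Z).
Proof.
move=> pp; rewrite -[X in ~~ X]/(p%:Z %| Dprod a b)%Z /Dprod => H; split.
  move=> m; apply: contra H => h.
  by rewrite (bigD1 m) //= -!mulrA dvdz_mulr.
move=> m k mk; apply: contra H => h.
by rewrite dvdz_mull // (bigD1 m) //= dvdz_mulr // (bigD1 k) ?dvdz_mulr // eq_sym.
Qed.
End LinearForms.

(** * Sum of the inverses of the nonsplit primes *)

Section NonsplitPrimes.
Variables (R : realType) (N : nat) (f : {poly int}) (p0 : nat).
Hypothesis N0 : (0 < N)%N.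
Hypothesis f_monic : f \is monic.
Hypothesis size_f : size f = N.+1.
Hypothesis f_irr : forall g h q : {poly int}, (size g <= N)%N -> (size h <= N)%N ->
  g * h = q * f -> g = 0 \/ h = 0.

Definition nonsplit p := [&& prime p, (p0 < p)%N & ~~ `[< splits N f p >]].

Lemma nonsplit_prime p : nonsplit p -> prime p. Proof. by case/and3P. Qed.

(** From Mertens' lower bound, subtract the split primes and the primes up to [p0], whose
    contribution is bounded. *)
Lemma nonsplit_ln_sum : exists C : R, 0 <= C /\ forall Y, (0 < Y)%N ->
  (1 - N%:R^-1) * ln Y%:R - C <=
  \sum_(0 <= k < Y.+1) (if nonsplit k then k%:R^-1 else 0) * ln (k%:R : R).
Proof.
have [C1 HC1] := split_primes_sum N0 f_monic size_f f_irr R.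
pose C0 : R := \sum_(0 <= p < p0.+1) ln p%:R / p%:R.
have t0 p : 0 <= ln (p%:R : R) / p%:R by rewrite divr_ge0 ?ln_nat_ge0.
have C00 : 0 <= C0 by apply: sumr_ge0 => p _.
exists (3 + `|C1| + C0); split; first by rewrite !addr_ge0.
move=> Y Y0; have := HC1 _ Y0; have := mertens_lower R Y0.
have small : \sum_(0 <= p < Y.+1 | (p <= p0)%N) ln (p%:R : R) / p%:R <= C0.
  rewrite /C0; have [le|lt] := leqP Y p0.
    rewrite [X in _ <= X](@big_cat_nat _ _ _ Y.+1) //= -[X in X <= _]addr0 lerD //.
      by rewrite big_mkcond; apply: ler_sum => p _; case: ifP.
    by apply: sumr_ge0 => p _.
  rewrite (@big_cat_nat _ _ _ p0.+1) //=; last exact: ltnW.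
  rewrite [X in _ + X]big_nat_cond [X in _ + X]big1 ?addr0; last first.
    by move=> p /andP[/andP[h _] h']; rewrite ltnNge h' in h.
  by rewrite big_mkcond; apply: ler_sum => p _; case: ifP.
have : \sum_(0 <= p < Y.+1 | prime p) ln (p%:R : R) / p%:R <=
   \sum_(0 <= k < Y.+1) (if nonsplit k then k%:R^-1 else 0) * ln (k%:R : R) +
   \sum_(0 <= p < Y.+1 | prime p && `[< splits N f p >]) ln p%:R / p%:R +
   \sum_(0 <= p < Y.+1 | (p <= p0)%N) ln p%:R / p%:R.
  rewrite big_mkcond [X in _ <= _ + X + _]big_mkcond [X in _ <= _ + X]big_mkcond -!big_split /=.
  apply: ler_sum => p _; have := t0 p; rewrite /nonsplit.
  case: (prime p) => /= h; last first.
    by rewrite mul0r !add0r; case: ifP.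
  rewrite ltnNge; case: (p <= p0)%N => /=; first by rewrite mul0r add0r lerDr; case: ifP.
  by case: `[< _ >] => /=; rewrite ?mul0r ?addr0 ?add0r // mulrC.
have := ler_norm C1; rewrite mulrBl mul1r; lra.
Qed.

Lemma nonsplit_inv_sum : exists C : R, forall z, (2 <= z)%N ->
  (1 - N%:R^-1) * ln (ln z%:R) - C <= \sum_(0 <= k < z.+1 | nonsplit k) (k%:R^-1 : R).
Proof.
have [C [C0 HC]] := nonsplit_ln_sum.
exists ((1 - N%:R^-1) * ln (ln 3) + C / ln 2) => z z2; rewrite big_mkcond.
apply: sum_inv_lower => //.
- by rewrite subr_ge0 invf_le1 ?ltr0n // ler1n.
- by move=> n; case: ifP.
Qed.
End NonsplitPrimes.

(** * Sieving the linear forms by the nonsplit primes *)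

Section Application.
Variables (R : realType) (T : pred nat) (M : nat) (a b : 'I_M -> int).
Hypothesis M0 : (0 < M)%N.
Hypothesis T_prime : forall p, T p -> prime p.
Hypothesis T_large : forall p, T p -> (4 * M <= p)%N.

(** At these primes the forms exclude the full number [M (p - 1)] of classes; the loss at the other
    primes of [T] is measured by [G] below. *)
Definition active p := T p && ~~ (p %| `|Dprod a b|)%N.

Lemma active_count p : active p -> (\sum_(n < p ^ 2) some_exactly_divides a b p n)%N = (M * p.-1)%N.
Proof.
move=> /andP[/T_prime pp pD]; have [pa pab] := Dprod_ndvd pp pD.
exact: count_some_exactly_divides.
Qed.

(** A lower bound for the logarithm of the product of the [1 + g p]; the term at [p] is
    [M (p - 1) / p ^ 2]. *)
Definition sieve_exponent z : R :=
  \sum_(0 <= p < z.+1 | active p) (M%:R / p%:R - M%:R / p%:R ^+ 2).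

Lemma sieve_application X z : (2 <= z)%N -> (((4 * z) ^ (4 * M)).+1 ^ 6 <= X)%N ->
  (\sum_(0 <= n < X) [forall p : 'I_z.+1, ~~ (active p && some_exactly_divides a b p n)])%:R
    * expR (sieve_exponent z) <= 6 * X%:R :> R.
Proof.
(* This [Q] satisfies [ln Q / 2 = 2 M (ln z + ln 4)]. As [g p <= 2 M / p], Mertens' upper bound then
   gives the hypothesis of the sieve. *)
move=> z2 QX; set Q := ((4 * z) ^ (4 * M))%N in QX.
(* Inactive indices get modulus [1] and no excluded class. *)
pose w (p : 'I_z.+1) : nat := if active p then nat_of_ord p else 1%N.
pose om (p : 'I_z.+1) : pred nat := fun n => active p && some_exactly_divides a b p n.
have w0 p : (0 < w p)%N.
  by rewrite /w; case: ifP => // /andP[/T_prime/prime_gt0].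
have wco p q : p != q -> coprime (w p) (w q).
  move=> pq; rewrite /w; case: ifP => [/andP[/T_prime pp _]|_]; last by rewrite coprime1n.
  case: ifP => [/andP[/T_prime pq' _]|_]; last by rewrite coprimen1.
  by rewrite prime_coprime // dvdn_prime2.
have omp p n : om p (n + w p ^ 2)%N = om p n.
  rewrite /om /w; case: ifP => //= _.
  by apply: eq_existsb => m; exact: exactly_divides_shift.
have cnt p : sieve_count w om p = if active p then (M * p.-1)%N else 0%N.
  rewrite /sieve_count /om /w; case: ifP => h; last by rewrite big1.
  by rewrite -(active_count h); apply: eq_bigr.
have cle p : (2 * sieve_count w om p <= w p ^ 2)%N.
  rewrite cnt /w; case: ifP => // /andP[/T_large h _].
  apply: (@leq_trans (2 * (M * p))%N); first by rewrite !leq_mul // leq_pred.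
  by rewrite -mulnn mulnA leq_mul // (leq_trans _ h) // leq_mul2r orbT.
have Q2 : (2 <= Q)%N.
  rewrite /Q; apply: (@leq_trans (2 ^ 1)%N) => //.
  apply: (@leq_trans (2 ^ (4 * M))%N); first by rewrite leq_exp2l // muln_gt0.
  by rewrite leq_exp2r ?muln_gt0 // (leq_trans z2) // leq_pmull.
have H : \sum_i sieve_density R w om i * ln (w i)%:R <= ln (Q%:R : R) / 2.
  have z0 : (0 < z)%N by exact: ltnW.
  have -> : ln (Q%:R : R) / 2 = (2 * M%:R) * (ln z%:R + ln 4%:R).
    rewrite /Q natrX lnXn ?ltr0n ?muln_gt0 // ln_natM // -[_ *+ (4 * M)]mulr_natl natrM.
    by rewrite [ln 4%:R + _]addrC; field.
  have := mertens_upper R z0; rewrite -(ler_pM2l (_ : 0 < 2 * M%:R)); last first.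
    by rewrite mulr_gt0 ?ltr0n.
  apply: le_trans; rewrite mulr_sumr big_mkord big_mkcond [X in _ <= X]big_mkcond.
  rewrite /=; apply: ler_sum => p _; rewrite /sieve_density cnt /w.
  case: ifP => [/[dup] act /andP[/[dup] Tp /T_prime pp _]|_]; last first.
    by rewrite ln1 mulr0; case: ifP => // _; rewrite !mulr_ge0 ?ler0n ?ln_nat_ge0 // invr_ge0.
  rewrite pp mulrCA mulrC ler_wpM2l ?ln_nat_ge0 //.
  have p0 : 0 < ((p : nat)%:R : R) by rewrite ltr0n prime_gt0.
  have c1 : (M * p.-1)%N%:R <= M%:R * (p : nat)%:R :> R.
    by rewrite -natrM ler_nat leq_mul // leq_pred.
  have c2 : 2 * (M * p.-1)%N%:R <= (p : nat)%:R ^+ 2 :> R.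
    by rewrite -natrX -natrM ler_nat; have := cle p; rewrite cnt /w act.
  have M2 : 0 <= (M%:R : R) by [].
  rewrite natrX ler_pdivrMr; last by have := exprn_gt0 2 p0; lra.
  have h1 : 2 * M%:R / (p : nat)%:R * (p : nat)%:R ^+ 2 = 2 * M%:R * (p : nat)%:R :> R.
    by field; rewrite gt_eqF.
  have h2 : 2 * M%:R / (p : nat)%:R * (M * p.-1)%N%:R <=
     2 * M%:R / (p : nat)%:R * ((p : nat)%:R ^+ 2 / 2) :> R.
    by rewrite ler_wpM2l //; lra.
  have h3 : 2 * M%:R / (p : nat)%:R * ((p : nat)%:R ^+ 2 / 2) = M%:R * (p : nat)%:R :> R.
    by field; rewrite gt_eqF.
  lra.
have := sieve_upper_bound w0 wco omp cle Q2 H QX.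
apply: le_trans; rewrite ler_wpM2l // /sieve_exponent big_mkord big_mkcond /= expR_sum.
apply: ler_prod => p _; rewrite expR_ge0 /= /sieve_density cnt /w.
case: ifP => [act|_]; last by rewrite mul0r addr0 expR0.
have /andP[/T_prime pp _] := act.
have p0 : 0 < ((p : nat)%:R : R) by rewrite ltr0n prime_gt0.
have ec : (M * p.-1)%N%:R = M%:R * ((p : nat)%:R - 1) :> R.
  by rewrite natrM -subn1 natrB ?prime_gt0.
have c2 : 2 * (M%:R * ((p : nat)%:R - 1)) <= (p : nat)%:R ^+ 2 :> R.
  by rewrite -ec -natrX -natrM ler_nat; have := cle p; rewrite cnt /w act.
rewrite ec natrX; set y : R := (p : nat)%:R in p0 ec c2 *; clearbody y.
have y2 : 0 < y ^+ 2 by rewrite exprn_gt0.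
have den : 0 < y ^+ 2 - M%:R * (y - 1) by lra.
(* With [t = M (y - 1) / y ^ 2], the factor [1 + g p] is [1 / (1 - t)], and
   [1 - t <= expR (- t)]. *)
have -> : 1 + M%:R * (y - 1) / (y ^+ 2 - M%:R * (y - 1)) =
   ((y ^+ 2 - M%:R * (y - 1)) / y ^+ 2)^-1.
  by rewrite invf_div; field; rewrite gt_eqF.
rewrite -[X in X <= _]invrK -expRN lef_pV2 ?posrE ?expR_gt0 ?divr_gt0 //.
apply: le_trans (expR_ge1Dx _); rewrite le_eqVlt; apply/orP; left; apply/eqP.
by field; rewrite gt_eqF.
Qed.

(** After taking inverses, [expR] is bounded below by its tangent, and
    [(1 - t + t ^ 2) (1 + t) = 1 + t ^ 3]. *)
Lemma expR_sub_sq_le (t : R) : 0 <= t -> expR (t - t ^+ 2) <= 1 + t.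
Proof.
move=> t0; have t1 : 0 < 1 + t by lra.
rewrite -[X in _ <= X]invrK -[X in X <= _]invrK -expRN.
rewrite lef_pV2 ?posrE ?expR_gt0 ?invr_gt0 //.
apply: le_trans (expR_ge1Dx _); rewrite -(ler_pM2r t1) mulVf ?gt_eqF //.
have -> : (1 + - (t - t ^+ 2)) * (1 + t) = 1 + t ^+ 3 by ring.
by rewrite lerDl exprn_ge0.
Qed.

(** Comparison with the telescoping differences [1 / (p - 1) - 1 / p]. *)
Lemma sum_inv_sq_le (P : pred nat) n : (forall p, P p -> (2 <= p)%N) ->
  \sum_(0 <= p < n | P p) (p%:R ^+ 2)^-1 <= (1 : R).
Proof.
move=> P2; have [n2|n2] := leqP n 2.
  rewrite big_nat_cond big1 ?ler01 // => p /andP[/andP[_ pn] /P2 p2]; lia.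
apply: (@le_trans _ _ (\sum_(2 <= p < n) ((p.-1%:R)^-1 - (p%:R)^-1))).
  rewrite (@big_cat_nat _ _ _ 2 0) //=; last exact: ltnW.
  rewrite [X in X + _]big_nat_cond [X in X + _]big1 ?add0r; last first.
    by move=> p /andP[/andP[_ pn] /P2 p2]; lia.
  rewrite big_mkcond; apply: ler_sum_nat => p /andP[p2 _].
  case: p p2 => [|[|p]] // _ /=; have x0 : 0 < (p.+1%:R : R) by rewrite ltr0n.
  rewrite -[p.+2%:R]natr1; move: (p.+1%:R : R) x0 => x x0.
  have x1 : 0 < x + 1 by lra.
  have -> : x^-1 - (x + 1)^-1 = (x * (x + 1))^-1 by field; rewrite !gt_eqF.
  have h : ((x + 1) ^+ 2)^-1 <= (x * (x + 1))^-1.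
    rewrite lef_pV2 ?posrE ?exprn_gt0 ?mulr_gt0 // expr2 ler_wpM2r ?(ltW x1) //; lra.
  by case: ifP => // _; rewrite invr_ge0 mulr_ge0 // ltW.
have -> : \sum_(2 <= p < n) ((p.-1%:R)^-1 - (p%:R)^-1) = 1 - (n.-1%:R)^-1 :> R.
  case: n n2 => [|[|n]] // _; rewrite big_add1 /=.
  rewrite (eq_bigr (fun k => - ((k.+1%:R)^-1 - (k%:R)^-1))); last by move=> k _; rewrite opprB.
  rewrite sumrN (telescope_sumr (fun k => (k%:R : R)^-1)) // opprB.
  by congr (_ - _); exact: invr1.
by rewrite gerBl invr_ge0.
Qed.

Variable G : R.
Hypothesis G_ge : forall z,
  \prod_(0 <= p < z.+1 | T p && (p %| `|Dprod a b|)%N) (1 + M%:R / p%:R) <= G.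

(** The primes of [T] that are not active divide [Dprod a b]; by [expR_sub_sq_le] their sum of
    [M / p] is at most [ln G + M ^ 2]. The squares at the active primes cost at most [M]. *)
Lemma sieve_exponent_ge z :
  M%:R * \sum_(0 <= p < z.+1 | T p) p%:R^-1 - M%:R - M%:R ^+ 2 - ln G <= sieve_exponent z.
Proof.
pose B := fun p => T p && (p %| `|Dprod a b|)%N.
have T2 p : T p -> (2 <= p)%N by move=> /T_prime/prime_gt1.
have eS : \sum_(0 <= p < z.+1 | T p) (p%:R^-1 : R) =
   \sum_(0 <= p < z.+1 | active p) p%:R^-1 + \sum_(0 <= p < z.+1 | B p) p%:R^-1.
  rewrite big_mkcond [X in _ = X + _]big_mkcond [X in _ = _ + X]big_mkcond -big_split /=.
  apply: eq_bigr => p _; rewrite /active /B; case: (T p) => /=; last by rewrite addr0.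
  by case: (p %| _)%N; rewrite /= ?addr0 ?add0r.
have eX : sieve_exponent z = M%:R * \sum_(0 <= p < z.+1 | active p) p%:R^-1
   - M%:R * \sum_(0 <= p < z.+1 | active p) (p%:R ^+ 2)^-1.
  by rewrite /sieve_exponent sumrB -!mulr_sumr.
have M0' : 0 <= (M%:R : R) by [].
have h1 : M%:R * \sum_(0 <= p < z.+1 | active p) (p%:R ^+ 2)^-1 <= M%:R :> R.
  rewrite -[X in _ <= X]mulr1 ler_wpM2l // sum_inv_sq_le // => p /andP[Tp _]; exact: T2.
have h2 : M%:R ^+ 2 * \sum_(0 <= p < z.+1 | B p) (p%:R ^+ 2)^-1 <= M%:R ^+ 2 :> R.
  rewrite -[X in _ <= X]mulr1 ler_wpM2l ?exprn_ge0 // sum_inv_sq_le // => p /andP[Tp _]; exact: T2.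
have Gp : 0 < \prod_(0 <= p < z.+1 | B p) (1 + M%:R / p%:R : R).
  by apply: prodr_gt0 => p _; rewrite ltr_wpDr // divr_ge0.
have h3 : expR (\sum_(0 <= p < z.+1 | B p) (M%:R / p%:R - (M%:R / p%:R) ^+ 2)) <= G.
  apply: le_trans (G_ge z); rewrite expR_sum; apply: ler_prod => p _.
  by rewrite expR_ge0 expR_sub_sq_le // divr_ge0.
have h4 : \sum_(0 <= p < z.+1 | B p) (M%:R / p%:R - (M%:R / p%:R) ^+ 2) <= ln G.
  rewrite -[X in X <= _]expRK ler_ln ?posrE ?expR_gt0 //; exact: lt_le_trans (expR_gt0 _) h3.
move: h4; rewrite sumrB -mulr_sumr.
have -> : \sum_(0 <= p < z.+1 | B p) (M%:R / p%:R) ^+ 2 =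
   M%:R ^+ 2 * \sum_(0 <= p < z.+1 | B p) (p%:R ^+ 2)^-1 :> R.
  by rewrite mulr_sumr; apply: eq_bigr => p _; rewrite expr_div_n.
rewrite eX eS mulrDr; lra.
Qed.

(** [z] is the largest integer with [z ^ K <= X]. As [4 <= z ^ 2], the number [(4 z) ^ (4 M) + 1] is
    at most [z ^ (12 M + 1)], whose sixth power is [z ^ K]. By maximality
    [X < (z + 1) ^ K <= z ^ (2 K)]. *)
Lemma sieve_parameters X : (2 ^ (72 * M + 6) <= X)%N -> exists z,
  [/\ (2 <= z)%N, (((4 * z) ^ (4 * M)).+1 ^ 6 <= X)%N &
      ln (X%:R : R) <= (2 * (72 * M + 6))%N%:R * ln z%:R].
Proof.
set K := (72 * M + 6)%N => KX.
have K0 : (0 < K)%N by rewrite addn_gt0 orbT.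
have ub j : (j ^ K <= X)%N -> (j <= X)%N.
  by move=> h; apply: leq_trans h; case: j => // j; rewrite -{1}[j.+1]expn1 leq_pexp2l.
have [z zX zmax] := ex_maxnP (ex_intro (fun j => (j ^ K <= X)%N) _ KX) ub.
have z2 : (2 <= z)%N := zmax _ KX; have z0 : (0 < z)%N := ltnW z2.
exists z; split=> //.
  apply: leq_trans zX; apply: (@leq_trans ((z ^ (12 * M + 1)) ^ 6)); last first.
    by rewrite -expnM leq_pexp2l // /K; lia.
  rewrite leq_exp2r // addn1 expnS.
  have h : ((4 * z) ^ (4 * M) <= z ^ (12 * M))%N.
    rewrite -[(12 * M)%N]/((3 * 4) * M)%N -mulnA [(z ^ _)%N]expnM leq_exp2r ?muln_gt0 //.
    by rewrite expnSr leq_mul2r -[4%N]/(2 ^ 2)%N leq_exp2r // z2 orbT.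
  apply: (@leq_trans (2 * z ^ (12 * M))%N); last by rewrite leq_mul2r z2 orbT.
  by rewrite mul2n -addnn -addn1 leq_add // expn_gt0 z0.
have Xz : (X <= z ^ (2 * K))%N.
  have lt : (X < z.+1 ^ K)%N by rewrite ltnNge; apply/negP => /zmax; rewrite ltnn.
  apply: leq_trans (ltnW lt) _; rewrite expnM leq_exp2r //.
  by rewrite -mulnn; move: z2; case: (z) => [|[|y]] // _; lia.
have X0 : (0 < X)%N by apply: leq_trans KX; rewrite expn_gt0.
by have := ler_ln_nat R X0 Xz; rewrite natrX lnXn ?ltr0n // mulr_natl.
Qed.

(** The saving is first a power of [ln z]; the last bound of [sieve_parameters] turns it into the
    same power of [ln X], up to a constant factor. *)
Lemma sifted_count_le (c C : R) X : 0 <= c ->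
  (forall z, (2 <= z)%N -> c * ln (ln z%:R) - C <= \sum_(0 <= p < z.+1 | T p) p%:R^-1) ->
  0 < G -> (2 ^ (72 * M + 6) <= X)%N -> exists z,
  (\sum_(0 <= n < X) [forall p : 'I_z.+1, ~~ (active p && some_exactly_divides a b p n)])%:R
    <= 6 * X%:R * G * expR (M%:R * C + M%:R + M%:R ^+ 2)
       * (2 * (72 * M + 6))%N%:R `^ (M%:R * c) / ln X%:R `^ (M%:R * c).
Proof.
move=> c0 HC G0 HX; have [z [z2 QX lnXz]] := sieve_parameters HX; exists z.
have X1 : (1 < X)%N by apply: leq_trans HX; rewrite (@leq_exp2l 2 1) // addnS.
have := sieve_application z2 QX; set Z := (\sum_(0 <= n < X) _)%N => HZ.
have lnz : 0 < ln (z%:R : R) by rewrite ln_gt0 // ltr1n.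
have lnX : 0 < ln (X%:R : R) by rewrite ln_gt0 // ltr1n.
set e := M%:R * c; have e0 : 0 <= e by rewrite mulr_ge0.
set E := M%:R * C + M%:R + M%:R ^+ 2.
set k : R := (2 * (72 * M + 6))%N%:R in lnXz *.
have k0 : 0 <= k by rewrite ler0n.
have ex : e * ln (ln z%:R) - E - ln G <= sieve_exponent z.
  apply: le_trans (sieve_exponent_ge z); rewrite /E /e.
  have := ler_wpM2l (ler0n R M) (HC z z2); rewrite mulrBr mulrA; lra.
have low : ln z%:R `^ e / (expR E * G) <= expR (sieve_exponent z).
  apply: le_trans (_ : expR (e * ln (ln z%:R) - E - ln G) <= _); last by rewrite ler_expR.
  rewrite le_eqVlt; apply/orP; left; apply/eqP; clearbody E e.
  by rewrite !expRD !expRN lnK ?posrE // /powR gt_eqF // invfM mulrA.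
have pX : ln X%:R `^ e <= k `^ e * ln z%:R `^ e.
  by rewrite -powRM ?(ltW lnz) // ge0_ler_powR ?nnegrE ?mulr_ge0 ?(ltW lnz) ?(ltW lnX).
have pX0 : 0 < ln (X%:R : R) `^ e by exact: powR_gt0.
rewrite ler_pdivlMr //.
have Z0 : 0 <= (Z%:R : R) by [].
have EG : 0 < expR E * G by rewrite mulr_gt0 ?expR_gt0.
apply: le_trans (ler_wpM2l Z0 pX) _.
have h : Z%:R * ln z%:R `^ e <= 6 * X%:R * (expR E * G).
  rewrite -ler_pdivrMr // -mulrA; apply: le_trans HZ; exact: ler_wpM2l.
rewrite mulrCA [X in _ <= X]mulrC; apply: ler_wpM2l; first exact: powR_ge0.
by apply: le_trans h _; rewrite mulrA mulrAC.
Qed.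
End Application.

(** * Assembly of the uniform bound *)

Theorem mainTheorem1 (R : realType) (L : splittingFieldType rat) (M : nat) :
  galois 1%VS {:L} -> (2 <= \dim {:L})%N -> (2 <= M)%N ->
  exists C : R, exists x0 : R, 0 < C /\
    forall a b : 'I_M -> int,
      (forall m, 0 < a m) ->
      \prod_(m < M) \prod_(k < M | k != m) (a m * b k - a k * b m) != 0 ->
      forall x : R, x0 <= x ->
        S L a b x <= C * gamma L R a b * x
                     / ln x `^ (M%:R * (1 - (\dim {:L})%:R^-1)).
Proof.
move=> galL N2 M2; set N := \dim {:L} in N2 *.
have N0 : (0 < N)%N by exact: ltnW.
have M0 : (0 < M)%N by exact: ltnW.
have [f [D [fm sf firr D0 HD]]] := number_field_data galL.
(* A prime above [|D|] does not divide [D]; one above [4 M] has at most half of the classes mod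
   [p ^ 2] excluded. *)
set p0 := (`|D| + 4 * M)%N.
pose T := nonsplit N f p0.
have T_prime p : T p -> prime p by exact: nonsplit_prime.
have T_large p : T p -> (4 * M <= p)%N.
  by move=> /and3P[_ /ltnW h _]; apply: leq_trans h; exact: leq_addl.
have T_props p : T p ->
    (exists2 d, (d %| N)%N & (1 < d)%N /\ P_r L d p) /\
    (forall z : int, bK L z -> (p%:Z %| z)%Z -> ((p ^ 2)%N%:Z %| z)%Z).
  move=> /and3P[pp lp /asboolPn ns].
  have pD : ~~ (p%:Z %| D)%Z.
    rewrite dvdzE absz_nat; apply/negP => /dvdn_leq; rewrite absz_gt0 => /(_ D0).
    by rewrite leqNgt (leq_ltn_trans _ lp) // leq_addr.
  by have [|] := HD p pp pD.
have [C HC] := nonsplit_inv_sum R p0 N0 fm sf firr.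
set c : R := 1 - N%:R^-1 in HC *.
have c0 : 0 <= c by rewrite subr_ge0 invf_le1 ?ltr0n // ler1n.
set K := (72 * M + 6)%N.
set E : R := expR (M%:R * C + M%:R + M%:R ^+ 2) * (2 * K)%N%:R `^ (M%:R * c).
have E0 : 0 < E by rewrite mulr_gt0 ?expR_gt0 ?powR_gt0 // ltr0n muln_gt0 addn_gt0 orbT.
(* The factor [6] of the sieve is doubled by [X <= 2 x], and [2 ^ K] is the threshold of
   [sieve_parameters]. *)
exists (12 * E), (2 ^ K)%N%:R; split; first by rewrite mulr_gt0.
move=> a b a0 ab0 x xK.
have D'0 : Dprod a b != 0.
  by rewrite /Dprod mulf_neq0 //; apply/prodf_neq0 => m _; rewrite gt_eqF.
(* A prime of [T] dividing [Dprod a b] lies in [P'], and the remaining factors of [gamma] are at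
   least [1]. The two products are compared over a common range. *)
have G_ge z : \prod_(0 <= p < z.+1 | T p && (p %| `|Dprod a b|)%N) (1 + M%:R / p%:R) <= gamma L R a b.
  rewrite /gamma -(big_mkord (fun p => `[< in_P' L a b p >]) (fun p => 1 + M%:R / p%:R : R)).
  set n := `|Dprod a b|%N.
  have f1 p : 1 <= 1 + M%:R / p%:R :> R by rewrite lerDl divr_ge0.
  have sub p : T p && (p %| n)%N -> (p < n.+1)%N && `[< in_P' L a b p >].
    move=> /andP[Tp pn]; rewrite ltnS dvdn_leq ?absz_gt0 //=.
    apply/asboolP; split=> //; have [[d dN [d1 Pd]] _] := T_props _ Tp.
    by exists d; split.
  apply: (@le_trans _ _ (\prod_(0 <= p < (z.+1 + n.+1)%N | (p < n.+1)%N && `[< in_P' L a b p >]) (1 + M%:R / p%:R))).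
    rewrite [X in _ <= X](@big_cat_nat _ _ _ z.+1) ?leq_addr //=.
    rewrite -[X in X <= _]mulr1; apply: ler_pM => //.
    - by apply: prodr_ge0 => p _; exact: le_trans (f1 p).
    - rewrite big_mkcond [X in _ <= X]big_mkcond; apply: ler_prod => p _.
      apply/andP; split; first by case: ifP => // _; exact: le_trans (f1 p).
      by case: ifP => [/sub ->//|_]; case: ifP.
    - by elim/big_ind: _ => // u v u1 v1; exact: mulr_ege1.
  rewrite (@big_cat_nat _ _ _ n.+1) ?leq_addl //= [X in _ * X]big_nat_cond [X in _ * X]big1 ?mulr1; last first.
    by move=> p /andP[/andP[h _] /andP[h' _]]; rewrite ltnNge h in h'.
  rewrite le_eqVlt; apply/orP; left; apply/eqP.
  rewrite big_nat_cond [RHS]big_nat_cond; apply: eq_bigl => p /=.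
  by case: (p < n.+1)%N; rewrite ?andbF.
have G0 : 0 < gamma L R a b.
  by apply: prodr_gt0 => p _; rewrite ltr_wpDr // divr_ge0.
have x1 : 1 <= x.
  by apply: le_trans xK; rewrite -[1]/(1%:R) ler_nat expn_gt0.
have /andP[tx1 tx2] := truncn_itv (le_trans ler01 x1).
set X := (Num.truncn x).+1 in tx2 *.
have X2 : X%:R <= 2 * x by rewrite /X -natr1; lra.
have KX : (2 ^ K <= X)%N by rewrite -(ler_nat R) (le_trans xK) // ltW.
have [z HZ] := sifted_count_le M0 T_prime T_large G_ge c0 HC G0 KX.
(* [S] starts at [n = 1]; the sifted count has the additional nonnegative term [n = 0]. *)
have SZ : S L a b x <= (\sum_(0 <= n < X) [forall p : 'I_z.+1,
    ~~ (active T a b p && some_exactly_divides a b p n)])%:R.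
  rewrite /S natr_sum [X in _ <= X]big_ltn // -[X in X <= _]add0r; apply: lerD => //.
  apply: ler_sum => n _.
  have [h|/existsNP[m hm]] := pselect (forall m, bK L (a m * n%:Z + b m)); last first.
    by rewrite (bigD1 m) //= asboolF // mul0r.
  rewrite big1 ?ler1n; last by move=> m _; rewrite asboolT.
  (* When all the values are norms, divisibility by [p] implies divisibility by [p ^ 2], so [n] lies
     in no excluded class. *)
  rewrite lt0b; apply/forallP => p; apply/negP => /andP[/andP[Tp _]].
  move=> /existsP[m /andP[pm]]; have [_ /(_ _ (h m) pm) ->] := T_props _ Tp.
  by [].
apply: le_trans SZ _; apply: le_trans HZ _.
set e := M%:R * c; have e0 : 0 <= e by rewrite mulr_ge0.
have lnx0 : 0 < ln x.
  apply: ln_gt0; apply: lt_le_trans xK; rewrite -[1]/(1%:R) ltr_nat.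
  by rewrite -(expn0 2) ltn_exp2l // addn_gt0 orbT.
have lnxX : ln x <= ln X%:R.
  by rewrite ler_ln ?posrE ?ltr0n //; [exact: ltW | exact: lt_le_trans x1].
have pe : (ln X%:R `^ e)^-1 <= (ln x `^ e)^-1.
  have lX0 : 0 < ln (X%:R : R) by exact: lt_le_trans lnxX.
  rewrite lef_pV2 ?posrE ?powR_gt0 //.
  by rewrite ge0_ler_powR ?nnegrE ?(ltW lnx0) ?(ltW lX0).
rewrite -[6 * _ * _ * _ * _]mulrA -/E.
apply: ler_pM => //.
- by apply: mulr_ge0 (ltW E0); apply: mulr_ge0 (ltW G0); exact: mulr_ge0.
- by rewrite invr_ge0 powR_ge0.
have -> : 12 * E * gamma L R a b * x = 6 * (2 * x) * gamma L R a b * E by ring.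
rewrite ler_wpM2r ?(ltW E0) // ler_wpM2r ?(ltW G0) //; lra.
Qed.
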